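(* Let $k$ be a field, $n\geq 1$, let $P(\underline{X},Z)\in k[\underline{X},Z]$ be a monic polynomial in $Z$ with $\deg_Z P(\underline{X},Z)\geq 2$, and let $Q(\underline{X},Y,Z)\in k[\underline{X},Y,Z]$ be a monic polynomial in $Y$ with $\deg_Y Q(\underline{X},Y,Z)\geq 2$. For $[d],[e]\in\mathbb{N}_{\geq 1}^n$ put $$L_{[d],[e]}=\frac{k[\underline{X},Y,Z,T]}{(\underline{X}^{[d]}Y-P(\underline{X},Z),\ \underline{X}^{[e]}T-Q(\underline{X},Y,Z))}.$$ Write $P'(\underline{X},Z):=\frac{\partial P(\underline{X},Z)}{\partial Z}$ and $Q'(\underline{X},Y,Z):=\frac{\partial Q(\underline{X},Y,Z)}{\partial Y}$. Suppose that for all $i\in\{1,\ldots,n\}$, $$\big(P(\underline{X},Z)|_{X_i=0},\ P'(\underline{X},Z)|_{X_i=0}\big)k[\underline{X}_{\hat{X_i}},Z]=k[\underline{X}_{\hat{X_i}},Z]$$ and $$\big(P(\underline{X},Z)|_{X_i=0},\ Q(\underline{X},Y,Z)|_{X_i=0},\ Q'(\underline{X},Y,Z)|_{X_i=0}\big)k[\underline{X}_{\hat{X_i}},Y,Z]=k[\underline{X}_{\hat{X_i}},Y,Z].$$ Then for every $[d],[e]\in\mathbb{N}_{\geq 1}^n$, $$L_{[d],[e]}\ncong L_{[d],[e]+1}\quad\text{but}\quad L_{[d],[e]}^{[1]}\cong L_{[d],[e]+1}^{[1]}$$ as $k$-algebras.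
   Context: Notation: $\underline{X}=(X_1,\ldots,X_n)$, and $X_1,\ldots,X_n,Y,Z,T$ are indeterminates over $k$. For $[d]=(d_1,\ldots,d_n)$, $\underline{X}^{[d]}:=X_1^{d_1}\cdots X_n^{d_n}$, and similarly for $[e]=(e_1,\ldots,e_n)$. $[e]+1:=(e_1+1,\ldots,e_n+1)$. $\mathbb{N}_{\geq 1}$ is the set of integers $\geq 1$. $\underline{X}_{\hat{X_i}}$ denotes the list of variables $X_1,\ldots,X_n$ with $X_i$ removed. For a polynomial $F$, $F|_{X_i=0}$ is obtained by setting $X_i=0$. For a ring $R$, $R^{[1]}$ denotes the polynomial ring in one variable over $R$. *)

(* Defs.v *)
From HB Require Import structures.
From mathcomp Require Import all_boot all_order all_algebra.
From mathcomp Require Import ring_quotient boolp.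
From mathcomp Require Import mpoly.

Set Implicit Arguments.
Unset Strict Implicit.
Unset Printing Implicit Defensive.

Import GRing.Theory.
Local Open Scope ring_scope.
Local Open Scope quotient_scope.

(* Membership is a classical boolean, as required by {ideal_quot _}. *)
Definition ideal_gen (R : comNzRingType) (s : seq R) : {pred R} :=
  fun x => `[< exists c : 'I_(size s) -> R, x = \sum_(i < size s) c i * s`_i >].

Lemma ideal_gen_closed (R : comNzRingType) (s : seq R) :
  1 \notin ideal_gen s -> idealr_closed (ideal_gen s).
Proof.
move=> s1; split=> //.
  by apply/asboolP; exists (fun=> 0); rewrite big1 // => i _; rewrite mul0r.
move=> a _ _ /asboolP [cu ->] /asboolP [cv ->]; apply/asboolP.
exists (fun i => a * cu i + cv i); rewrite mulr_sumr -big_split /=.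
by apply: eq_bigr => i _; rewrite mulrDl mulrA.
Qed.

(* An algebra over k is given here by its structure morphism k -> A; this
   covers {poly L}, which the library only makes an algebra over L. *)
Definition alg_iso (k A B : nzRingType)
    (iA : {rmorphism k -> A}) (iB : {rmorphism k -> B}) : Prop :=
  exists f : {rmorphism A -> B}, bijective f /\ forall c, f (iA c) = iB c.

(* The extra indeterminates are adjoined one at a time to k[X], in the order
   Z, Y, T, so the variable of the outermost {poly _} is Z in kXZ, Y in kXYZ
   and T in kXYZT. *)
Notation kXZ k n := {poly {mpoly k[n]}}.
Notation kXYZ k n := {poly {poly {mpoly k[n]}}}.
Notation kXYZT k n := {poly {poly {poly {mpoly k[n]}}}}.

Section DoubleDanielewski.

Variables (k : fieldType) (n : nat).
Variables (d e : 'X_{1..n}) (P : kXZ k n) (Q : kXYZ k n).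

Definition rel1 : kXYZT k n := ((('X_[d] : {mpoly k[n]})%:P%:P * 'X - P%:P : kXYZ k n)%:P).
Definition rel2 : kXYZT k n := ('X_[e] : {mpoly k[n]})%:P%:P%:P * 'X - Q%:P.

Definition relIdeal : {pred kXYZT k n} := ideal_gen [:: rel1; rel2].

(* The ideal is proper: X |-> 1, Y |-> P(1, Z), T |-> Q(1, P(1, Z), Z) defines
   a morphism to k[Z] which kills both relations. *)
Lemma relIdeal_proper : 1 \notin relIdeal.
Proof.
pose f0 : {rmorphism {mpoly k[n]} -> k} := @meval n k (fun=> 1).
have f0X m : f0 'X_[m] = 1.
  by rewrite /f0 /= mevalX big1 // => i _; rewrite expr1n.
pose f1 : {rmorphism {poly {mpoly k[n]}} -> {poly k}} := map_poly f0.
pose f2 : {rmorphism {poly {poly {mpoly k[n]}}} -> {poly k}} :=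
  horner_eval (f1 P) \o map_poly f1.
pose f3 : {rmorphism {poly {poly {poly {mpoly k[n]}}}} -> {poly k}} :=
  horner_eval (f2 Q) \o map_poly f2.
have f1C c : f1 c%:P = (f0 c)%:P by rewrite /f1 /= map_polyC.
have f2C c : f2 c%:P = f1 c by rewrite /f2 /= map_polyC /horner_eval hornerC.
have f3C c : f3 c%:P = f2 c by rewrite /f3 /= map_polyC /horner_eval hornerC.
have f2X : f2 'X = f1 P by rewrite /f2 /= map_polyX /horner_eval hornerX.
have f3X : f3 'X = f2 Q by rewrite /f3 /= map_polyX /horner_eval hornerX.
have r1 : f3 rel1 = 0.
  by rewrite /rel1 f3C rmorphB rmorphM !f2C f1C f2X f0X polyC1 mul1r subrr.
have r2 : f3 rel2 = 0.
  by rewrite /rel2 rmorphB rmorphM !f3C !f2C f1C f3X f0X polyC1 mul1r subrr.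
apply/asboolP => -[c]; rewrite !big_ord_recl big_ord0 /= addr0.
move/(congr1 f3)/eqP; rewrite rmorph1 rmorphD !rmorphM r1 r2.
by rewrite !mulr0 addr0 oner_eq0.
Qed.

HB.instance Definition _ :=
  isIdealr.Build (kXYZT k n) relIdeal (ideal_gen_closed relIdeal_proper).

Definition L := {ideal_quot relIdeal}.

HB.instance Definition _ := GRing.ComNzRing.on L.

Definition L_str : {rmorphism k -> L} :=
  \pi_L \o (polyC \o (polyC \o (polyC \o @mpolyC n k))).

Definition L1_str : {rmorphism k -> {poly L}} := polyC \o L_str.

End DoubleDanielewski.

(* k[X] -> k[X without X_i], evaluation at X_i = 0: the variables other than
   X_i are the X_(lift i j), j : 'I_n.-1. *)
Definition at0 (k : fieldType) (n : nat) (i : 'I_n) :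
    {rmorphism {mpoly k[n]} -> {mpoly k[n.-1]}} :=
  comp_mpoly [tuple if unlift i j is Some j' then 'X_j' else 0 | j < n].

Definition at0Z (k : fieldType) (n : nat) (i : 'I_n) :
    {rmorphism kXZ k n -> kXZ k n.-1} :=
  map_poly (at0 k i).

Definition at0YZ (k : fieldType) (n : nat) (i : 'I_n) :
    {rmorphism kXYZ k n -> kXYZ k n.-1} :=
  map_poly (at0Z k i).

Definition multinom_succ (n : nat) (m : 'X_{1..n}) : 'X_{1..n} :=
  [multinom (m i).+1 | i < n].

(* Main.v *)
Require Import Defs.
From HB Require Import structures.
From mathcomp Require Import all_boot all_order all_algebra.
From mathcomp Require Import ring_quotient boolp mpoly.
From mathcomp Require Import ring lra zify.

Set Implicit Arguments.
Unset Strict Implicit.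
Unset Printing Implicit Defensive.

Import GRing.Theory Num.Theory Order.TTheory.
Local Open Scope ring_scope.

(** Write B(e) for the ring L_[d],[e], let p and q be the degrees of P in Z and
of Q in Y, and let X stand for the product of the variables X_i.

Since P and Q are monic, each X_i is regular modulo the two relations, so B(e)
is the subalgebra k[X_1, .., X_n, Z, y, t] of Frac k[X, Z] generated by
y = P / X^d and t = Q(y) / X^e ([presentedP], [embedding]).

Non-isomorphism.  Fix j and order the exponents of the monomials X^a Z^b so
that the leading monomial has the least exponent in X_j, then the largest
exponent in Z.  The leading exponent [lexp] is a valuation; extend it to the
fraction field.  The relations rewrite Z^p into X^d y and y^q into X^e t up to
terms with a smaller value, and the normal monomials X^a Z^b y^c t^g with b < p
and c < q have pairwise distinct values.  Hence every nonzero element of B(e)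
has the value of a normal monomial ([inA_form]), and an element whose
value has a positive exponent in X_j is divisible by X_j in B(e) ([inA_dvd]).

Consider an isomorphism from B(e1) to B(e2).  Inside B(e1), the preimage of
k[X_1, .., X_n] has values in a subspace of dimension at most n ([val_rank]),
so some nonzero functional l kills them, and since B(e1) is a polynomial ring
in one variable over this preimage up to denominators, l has constant sign on
the values of B(e1) ([functional_sign], by the theory of key polynomials).
The values of B(e1) span a simplicial cone, with rays the exponents of the X_i
and of t, so the values of the preimage lie in a facet ([some_facet]).
Arithmetic excludes the facets opposite to an X_i ([no_x_facet]), and the
remaining facet leads to X_j being a fraction of elements of the preimage
([x_fraction_of_constants]).  It follows that the isomorphism sends X_j into
k[X_1, .., X_n] ([image_x]) and Z to a polynomial of degree one in Z ([image_z]).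
The image of X_j divides a monomial, hence is a monomial up to a constant, and
comparing the values of the images of y and t forces mdeg e1 <= mdeg e2
([mdeg_le]).  This fails for e1 = e + 1 and e2 = e.

Stable isomorphism.  Substituting Z + X^(d+e) W for Z is compatible with the
relations and sends t to t + W P' Q' modulo X ([shift_solution]).  By the two
comaximality hypotheses P' Q' has an inverse g modulo X, which is a polynomial
in X_1, .., X_n, Z, y ([unit_mod_ones]).  In B(e)[V], the choice W = X V - g t
makes the image of t divisible by X, which defines a morphism from B(e + 1);
in B(e + 1)[V'] the choice W = V' defines a morphism from B(e).  Extended to V
and V' they are inverse to each other ([stable_iso]). *)

(** * Morphisms from polynomial rings *)

Lemma mpoly_gen (R : comNzRingType) n (K : {mpoly R[n]} -> Prop) :
  (forall c, K c%:MP) -> (forall i, K 'X_i) ->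
  (forall p q, K p -> K q -> K (p + q)) ->
  (forall p q, K p -> K q -> K (p * q)) -> forall p, K p.
Proof.
move=> KC KX KD KM.
have K1 : K 1 by rewrite -mpolyC1; exact: KC.
have KXm m : K 'X_[m].
  rewrite mpolyXE_id; apply: (big_ind K) => // i _.
  by elim: (m i) => [|a IH]; rewrite ?expr0 // exprS; apply: KM.
apply: mpolyind => [|c m p _ _ Kp]; first by rewrite -mpolyC0; exact: KC.
by apply: KD => //; rewrite -mul_mpolyC; apply: KM.
Qed.

Lemma mpoly_morph_ext (R : comNzRingType) n (S : nzRingType)
    (f g : {rmorphism {mpoly R[n]} -> S}) :
  (forall c, f c%:MP = g c%:MP) -> (forall i, f 'X_i = g 'X_i) -> f =1 g.
Proof.
move=> fgC fgX; apply: mpoly_gen => // p q; first by rewrite !rmorphD => -> ->.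
by rewrite !rmorphM => -> ->.
Qed.

Lemma poly_morph_ext (R S : nzRingType) (f g : {rmorphism {poly R} -> S}) :
  (forall c, f c%:P = g c%:P) -> f 'X = g 'X -> f =1 g.
Proof.
move=> fgC fgX; elim/poly_ind => [|p c IH]; first by rewrite !rmorph0.
by rewrite !rmorphD !rmorphM fgC fgX IH.
Qed.

(** * Valuations and key polynomials *)

Section Valuations.

(** The group of values carries no order here: all that key polynomials use of
    the ultrametric inequality is its equality case for distinct values. *)
Definition is_val (G : zmodType) (R : nzRingType) (v : R -> G) : Prop :=
  (forall x y : R, x != 0 -> y != 0 -> v (x * y) = v x + v y) /\
  (forall x y : R, x != 0 -> y != 0 -> v x <> v y ->
     x + y != 0 /\ (v (x + y) = v x \/ v (x + y) = v y)).

Lemma is_val_comp (G : zmodType) (R S : nzRingType) (v : S -> G)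
    (f : {rmorphism R -> S}) :
  injective f -> is_val v -> is_val (v \o f).
Proof.
move=> finj [vM vD].
have f0 x : (f x != 0) = (x != 0) by rewrite -(inj_eq finj) rmorph0.
split=> x y; rewrite -!f0 => x0 y0 /=; first by rewrite rmorphM vM.
by rewrite rmorphD; exact: vD.
Qed.

Lemma is_val1 (G : zmodType) (R : nzRingType) (v : R -> G) :
  is_val v -> v 1 = 0.
Proof.
case=> vM _; have := vM 1 1 (oner_neq0 _) (oner_neq0 _).
by rewrite mulr1 => /eqP; rewrite -subr_eq subrr eq_sym => /eqP.
Qed.

(** The theory of key polynomials in its simplest case: [H] is an isolated
    subgroup containing the values of the constants, and [a] has minimal degree
    among the polynomials with value outside [H].  Pseudo-divide [h] by [a] as
    q a + r.  A coincidence v (q a) = v r would put a multiple of v a in [H], so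
    the value of q a + r is that of q a or of r, and induction applies to q. *)
Lemma key_polynomial (G : zmodType) (D : idomainType) (v : {poly D} -> G)
    (H : G -> Prop) (a : {poly D}) :
  is_val v -> (forall x y, H x -> H y -> H (x - y)) ->
  (forall x m, H (x *+ m.+1) -> H x) ->
  (forall c : D, c != 0 -> H (v c%:P)) ->
  ~ H (v a) ->
  (forall u : {poly D}, u != 0 -> (size u < size a)%N -> H (v u)) ->
  a != 0 ->
  forall h : {poly D}, h != 0 -> exists (c : D) (u : {poly D}) (i : nat),
    [/\ c != 0, u != 0, H (v u) & v c%:P + v h = v u + v a *+ i].
Proof.
move=> val HB Hdiv HC Ha Hlt a0 h.
have [vM vD] := val.
have HN x : H x -> H (- x).
  by move=> Hx; rewrite -sub0r; apply: (HB) => //; rewrite -(subrr x); apply: HB.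
have HD x y : H x -> H y -> H (x + y).
  by move=> Hx Hy; rewrite -(opprK y); apply/HB/HN.
have [m] := ubnP (size h); elim: m h => // m IH h; rewrite ltnS => hm h0.
have [ha|ah] := ltnP (size h) (size a).
  exists 1, h, 0; split; rewrite ?oner_neq0 //; first exact: Hlt.
  by rewrite polyC1 (is_val1 val) add0r mulr0n addr0.
pose c := lead_coef a ^+ Pdiv.Idomain.scalp h a.
have c0 : c != 0 by rewrite expf_neq0 // lead_coef_eq0.
have c0P : c%:P != 0 by rewrite polyC_eq0.
have := Pdiv.Idomain.divp_eq h a; rewrite -/c -mul_polyC.
set q := Pdiv.Idomain.divp h a; set r := Pdiv.Idomain.modp h a => E.
have sr : (size r < size a)%N by rewrite ltn_modp.
have q0 : q != 0.
  apply/eqP => q0; move: E; rewrite q0 mul0r add0r => E.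
  have : (size (c%:P * h)%R < size a)%N by rewrite E.
  by rewrite mul_polyC size_scale // ltnNge ah.
have sq : (size q < m)%N.
  apply: leq_trans hm; rewrite size_divp // ltn_subrL.
  rewrite size_poly_gt0 h0 andbT -subn1 subn_gt0.
  rewrite ltnNge; apply/negP => /size1_polyC aC; apply: Ha.
  by rewrite aC; apply: HC; rewrite -polyC_eq0 -aC.
have [c' [u [i [c'0 u0 Hu Eq]]]] := IH _ sq q0.
have c'0P : c'%:P != 0 by rewrite polyC_eq0.
have qa0 : q * a != 0 by rewrite mulf_neq0.
have Eqa : v c'%:P + v (q * a) = v u + v a *+ i.+1.
  by rewrite vM // addrA Eq mulrSr addrA.
have [r0|r0] := eqVneq r 0.
  exists (c' * c), u, i.+1; split=> //; first by rewrite mulf_neq0.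
  by rewrite polyCM vM // -addrA -(vM c%:P) // E r0 addr0.
have Hr := Hlt _ r0 sr.
have nE : v (q * a) <> v r.
  move=> qr; apply: Ha; apply: (Hdiv _ i).
  have -> : v a *+ i.+1 = v c'%:P + v r - v u.
    by rewrite -qr Eqa addrAC subrr add0r.
  by apply: HB => //; apply: HD => //; apply: HC.
have [_ [Er|Er]] := vD _ _ qa0 r0 nE; rewrite -E vM // in Er.
  exists (c' * c), u, i.+1; split=> //; first by rewrite mulf_neq0.
  by rewrite polyCM vM // -addrA Er.
by exists c, r, 0; split; rewrite // Er mulr0n addr0.
Qed.

Lemma key_polynomial_exists (G : zmodType) (D : idomainType)
    (v : {poly D} -> G) (H : G -> Prop) :
  is_val v -> (forall x y, H x -> H y -> H (x - y)) ->
  (forall x m, H (x *+ m.+1) -> H x) ->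
  (forall c : D, c != 0 -> H (v c%:P)) ->
  (exists2 a : {poly D}, a != 0 & ~ H (v a)) ->
  exists a : {poly D}, [/\ a != 0, ~ H (v a) &
   forall h : {poly D}, h != 0 -> exists (c : D) (u : {poly D}) (i : nat),
    [/\ c != 0, u != 0, H (v u) & v c%:P + v h = v u + v a *+ i]].
Proof.
move=> val HB Hdiv HC [a1 a10 Ha1].
suff [a [a0 Ha Hlt]] : exists a : {poly D}, [/\ a != 0, ~ H (v a) &
    forall u : {poly D}, u != 0 -> (size u < size a)%N -> H (v u)].
  by exists a; split=> //; apply: key_polynomial.
have [m] := ubnP (size a1); elim: m a1 a10 Ha1 => // m IH a a0 Ha am.
have [|ex] := boolp.pselect (exists u : {poly D}, [/\ u != 0, (size u < size a)%N & ~ H (v u)]).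
  case=> u [u0 ua Hu]; apply: (IH u) => //; exact: leq_trans ua _.
exists a; split=> // u u0 ua; apply: boolp.contrapT => Hu.
by apply: ex; exists u.
Qed.

(** The weak form of Abhyankar's inequality.  Each new variable adds at most one
    dimension to the span of the values: take for [H] the span already obtained;
    by [key_polynomial] all values lie in [H] plus the line of one value. *)
Lemma val_rank (k : fieldType) N n (v : {mpoly k[n]} -> 'rV[rat]_N) :
  is_val v -> (forall c, c != 0 -> v c%:MP = 0) ->
  exists M : 'M[rat]_(n, N), forall p, p != 0 -> (v p <= M)%MS.
Proof.
elim: n v => [|n IH] v val vC.
  exists 0 => p p0.
  have Ep : p = (p@_0)%:MP.
    apply/mpolyP => m; rewrite mcoeffC.
    have -> : m = 0%MM by apply/mnmP => -[].
    by rewrite eqxx mulr1.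
  rewrite Ep vC ?sub0mx //.
  by apply: contraNneq p0 => E; rewrite Ep E.
pose h : {rmorphism {poly {mpoly k[n]}} -> {mpoly k[n.+1]}} :=
  horner_eval 'X_ord_max \o map_poly (@mwiden n k).
have hC c : h c%:P = mwiden c by rewrite /h /= map_polyC /horner_eval hornerC.
have hX : h 'X = 'X_ord_max by rewrite /h /= map_polyX /horner_eval hornerX.
have muniXw (i : 'I_n) : muni ('X_(widen_ord (leqnSn n) i) : {mpoly k[n.+1]}) = ('X_i)%:P.
  rewrite muniE msuppX big_seq1 mcoeffX eqxx scale1r.
  have -> : U_(widen_ord (leqnSn n) i)%MM ord_max = 0%N.
    by rewrite mnm1E -val_eqE /= ltn_eqF.
  rewrite expr0 alg_polyC; congr ('X_[_])%:P; apply/mnmP => j.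
  by rewrite mnmE !mnm1E -!val_eqE.
have muniXm : muni ('X_ord_max : {mpoly k[n.+1]}) = 'X.
  rewrite muniE msuppX big_seq1 mcoeffX eqxx scale1r mnm1E eqxx expr1.
  rewrite (_ : [multinom _ | i < n] = 0%MM) ?mpolyX0 ?scale1r //.
  by apply/mnmP => j; rewrite mnmE mnm1E mnm0E -val_eqE /= gtn_eqF.
have munih : cancel h (@muni n k).
  apply: (@poly_morph_ext _ _ (@muni n k \o h) idfun) => [c|]; last first.
    by rewrite [LHS](congr1 _ hX).
  rewrite [LHS](congr1 _ (hC c)) /=; apply: (@mpoly_morph_ext _ _ _ (@muni n k \o @mwiden n k) polyC) => [a|i] /=.
    by rewrite mwidenC muniC.
  by rewrite mwidenX mnmwiden1 muniXw.
have hmuni : cancel (@muni n k) h.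
  apply: (@mpoly_morph_ext _ _ _ (h \o @muni n k) idfun) => [a|i].
    by rewrite [LHS](congr1 h (muniC _ a)) hC mwidenC.
  change (h (muni 'X_i) = 'X_i).
  have [j ->|->] := unliftP ord_max i; last by rewrite muniXm.
  have -> : lift ord_max j = widen_ord (leqnSn n) j.
    by apply/val_inj; rewrite /= /bump leqNgt ltn_ord.
  by rewrite muniXw hC mwidenX mnmwiden1.
pose v' := v \o h.
have val' : is_val v' by apply: is_val_comp (can_inj munih) val.
have val'' : is_val (v' \o polyC) by apply: is_val_comp (@polyC_inj _) val'.
have [c c0|M MP] := IH _ val''; first by rewrite /comp /v' /comp (hC c%:MP) mwidenC; apply: vC.
have hne p : p != 0 -> exists2 q, q != 0 & p = h q.
  move=> p0; exists (muni p); last by rewrite hmuni.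
  by apply: contraNneq p0 => E; rewrite -(hmuni p) E rmorph0.
pose H (x : 'rV[rat]_N) := (x <= M)%MS.
suff [b bP] : exists b : 'rV[rat]_N, forall q, q != 0 -> (v' q <= col_mx b M)%MS.
  by exists (col_mx b M : 'M_(1 + n, N)) => p /hne[q q0 ->]; apply: bP.
have sub b x : H x -> (x <= col_mx b M)%MS.
  by move=> Hx; rewrite -addsmxE; exact: (submx_trans (Hx : (x <= M)%MS) (addsmxSr _ _)).
have [ex|nex] := pselect (exists2 a, a != 0 & ~ H (v' a)); last first.
  by exists 0 => q q0; apply: sub; apply: contrapT => Hq; apply: nex; exists q.
have HB x y : H x -> H y -> H (x - y).
  by move=> Hx Hy; apply: addmx_sub => //; rewrite eqmx_opp.
have HZ x m : H (x *+ m.+1) -> H x.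
  by rewrite /H -scaler_nat eqmx_scale // pnatr_eq0.
have [|a [a0 Ha aP]] := key_polynomial_exists val' HB HZ _ ex.
  by move=> c c0; apply: MP.
exists (v' a) => q q0; have [c [u [i [c0 u0 Hu E]]]] := aP q q0.
have -> : v' q = (v' u - v' c%:P) + v' a *+ i by rewrite addrAC -E addrC addKr.
apply: addmx_sub; first by apply: sub; apply: HB => //; apply: MP.
rewrite -scaler_nat; apply: scalemx_sub.
by rewrite -addsmxE; apply: addsmxSl.
Qed.
End Valuations.

(** * Valuations in an ordered group *)

Section Lexicographic.
Variables (G : zmodType) (I : eqType) (f : I -> G -> rat).
Hypothesis fD : forall i x y, f i (x + y) = f i x + f i y.
Implicit Types (x y : G) (s : seq I).

Fixpoint lexpos s x : bool :=
  if s is i :: s' then (0 < f i x) || ((f i x == 0) && lexpos s' x) else false.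

Lemma lexposD s x y : lexpos s x -> lexpos s y -> lexpos s (x + y).
Proof.
elim: s => //= i s IH; rewrite fD.
case/orP => [fx|/andP[/eqP fx px]]; case/orP => [fy|/andP[/eqP fy py]].
- by rewrite addr_gt0.
- by rewrite fy addr0 fx.
- by rewrite fx add0r fy.
- by rewrite fx fy addr0 ltxx eqxx IH.
Qed.

Lemma lex_form0 i : f i 0 = 0.
Proof. by apply: (addrI (f i 0)); rewrite -fD !addr0. Qed.

Lemma lexpos0 s : ~~ lexpos s 0.
Proof. by elim: s => //= i s IH; rewrite lex_form0 ltxx eqxx. Qed.

Lemma lexposN s x : (exists2 i, i \in s & f i x != 0) ->
  lexpos s x || lexpos s (- x).
Proof.
elim: s => [[]//|i s IH [j js jx]].
have fN : f i (- x) = - f i x.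
  by apply/eqP; rewrite -addr_eq0 -fD addNr lex_form0.
rewrite /= fN oppr_gt0 oppr_eq0.
have [fx|fx|fx] := ltgtP (f i x) 0; rewrite ?orbT //=.
apply: IH; exists j => //; move: js; rewrite inE => /predU1P[E|//].
by rewrite E fx eqxx in jx.
Qed.

End Lexicographic.

Section OrderedValuation.
Variables (G : zmodType) (lt : G -> G -> Prop).
Hypothesis lt_trans : forall x y z, lt x y -> lt y z -> lt x z.
Hypothesis lt_irr : forall x, ~ lt x x.
Hypothesis lt_total : forall x y, x <> y -> lt x y \/ lt y x.
Hypothesis lt_add : forall x y z, lt x y -> lt (x + z) (y + z).

(** The third clause is the usual inequality v (x + y) <= max (v x) (v y),
    expressed through strict upper bounds so that the strict order suffices. *)
Definition is_oval (R : nzRingType) (v : R -> G) : Prop :=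
  [/\ forall x y : R, x != 0 -> y != 0 -> v (x * y) = v x + v y,
     forall x y : R, x != 0 -> y != 0 -> lt (v x) (v y) ->
        x + y != 0 /\ v (x + y) = v y
   & forall (x y : R) g, x != 0 -> y != 0 -> x + y != 0 ->
        lt (v x) g -> lt (v y) g -> lt (v (x + y)) g].

Lemma is_oval_val (R : nzRingType) (v : R -> G) : is_oval v -> is_val v.
Proof.
case=> vM vD _; split=> // x y x0 y0 /lt_total[] /vD.
  by case/(_ x0 y0) => ? ->; split=> //; right.
by case/(_ y0 x0) => ? ?; rewrite addrC; split=> //; left.
Qed.

Lemma seq_max (I : eqType) (f : I -> G) (s : seq I) : s != [::] ->
  exists2 x, x \in s & forall y, y \in s -> f y = f x \/ lt (f y) (f x).
Proof.
elim: s => // a [|b s] IH _.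
  by exists a => [|y]; rewrite inE ?eqxx // => /eqP ->; left.
have [x xs xP] := IH isT.
have [E|NE] := pselect (f a = f x).
  exists x => [|y]; first by rewrite inE xs orbT.
  by rewrite inE => /orP[/eqP ->|/xP//]; left.
have [L|L] := lt_total NE.
  exists x => [|y]; first by rewrite inE xs orbT.
  by rewrite inE => /orP[/eqP ->|/xP//]; right.
exists a => [|y]; first by rewrite inE eqxx.
rewrite inE => /orP[/eqP ->|/xP]; first by left.
by case=> [->|Hy]; right => //; apply: lt_trans Hy L.
Qed.

Lemma oval_sum_lt (R : nzRingType) (v : R -> G) (I : eqType) (s : seq I)
    (F : I -> R) g : is_oval v ->
  (forall i, i \in s -> F i = 0 \/ lt (v (F i)) g) ->
  \sum_(i <- s) F i = 0 \/ lt (v (\sum_(i <- s) F i)) g.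
Proof.
case=> _ _ vL; elim: s => [_|i s IH Hs]; first by rewrite big_nil; left.
rewrite big_cons; set S := \sum_(_ <- _) _.
have {}IH : S = 0 \/ lt (v S) g by apply: IH => a ai; apply: Hs; rewrite inE ai orbT.
have [->|Hi] := Hs i (mem_head _ _); first by rewrite add0r.
have [->|HS] := IH.
  by rewrite addr0; right.
have [|NE] := eqVneq (F i + S) 0; first by left.
have [F0|F0] := eqVneq (F i) 0; first by right; rewrite F0 add0r.
have [S0|S0] := eqVneq S 0; first by right; rewrite S0 addr0.
by right; apply: vL.
Qed.

(** The term of largest value dominates the sum of all others. *)
Lemma oval_sum_distinct (R : nzRingType) (v : R -> G) (I : eqType) (s : seq I)
    (F : I -> R) : is_oval v -> s != [::] -> uniq s ->
  (forall i, i \in s -> F i != 0) -> {in s &, injective (v \o F)} ->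
  \sum_(i <- s) F i != 0 /\
  exists2 i, i \in s & v (\sum_(i <- s) F i) = v (F i).
Proof.
move=> ov s0 us F0 inj; have [vM vD vL] := ov.
have [x xs xP] := seq_max (v \o F) s0.
rewrite (big_rem x) //=.
have [|->|LS] := @oval_sum_lt R v I (rem x s) F (v (F x)) ov.
- move=> i; rewrite mem_rem_uniq // inE => /andP[/= ix iS]; right.
  case: (xP i iS) => // E; case/eqP: ix; exact: inj E.
- by rewrite addr0; split; [apply: F0 | exists x].
have [S0|S0] := eqVneq (\sum_(i <- rem x s) F i) 0.
  by rewrite S0 addr0; split; [apply: F0 | exists x].
have [NE E] := vD _ _ S0 (F0 x xs) LS.
by rewrite addrC; split=> //; exists x.
Qed.

Lemma frac_quot (E : idomainType) (x : {fraction E}) :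
  exists p q : E, q != 0 /\ x = tofrac p / tofrac q.
Proof.
elim/quotW: x => r; exists r.1, r.2; split; first exact: denom_ratioP.
have q0 : tofrac r.2 != 0 :> {fraction E} by rewrite tofrac_eq0; exact: denom_ratioP.
apply: (mulIf q0); rewrite divfK //.
rewrite !piE.
have d0 := @denom_ratioP _ r.
apply/eqmodP; rewrite /= FracField.equivfE /FracField.mulf.
by rewrite !numden_Ratio ?mulf_neq0 ?oner_neq0 // !mulr1 mulrC.
Qed.

(** The value of a fraction is v p - v q; sums are computed over a common
    denominator, and translation invariance of the order does the rest. *)
Lemma oval_frac (E : idomainType) (v : E -> G) : is_oval v ->
  exists vK : {fraction E} -> G,
    is_oval vK /\ forall p, p != 0 -> vK (tofrac p) = v p.
Proof.
move=> ov; have [vM vD vL] := ov.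
have ex (x : {fraction E}) : exists pq : E * E, pq.2 != 0 /\ x = tofrac pq.1 / tofrac pq.2.
  by have [p [q Hpq]] := frac_quot x; exists (p, q).
pose num x := (projT1 (cid (ex x))).1.
pose den x := (projT1 (cid (ex x))).2.
have den0 x : den x != 0 by rewrite /den; case: (cid _) => /= ? [].
have xE x : x = tofrac (num x) / tofrac (den x).
  by rewrite /num /den; case: (cid _) => /= ? [].
have num0 x : (num x == 0) = (x == 0).
  by rewrite {2}(xE x) mulf_eq0 invr_eq0 !tofrac_eq0 (negPf (den0 x)) orbF.
pose vK x := v (num x) - v (den x).
have vKE (p q : E) : p != 0 -> q != 0 -> vK (tofrac p / tofrac q) = v p - v q.
  move=> p0 q0; set x := _ / _.
  have x0 : x != 0 by rewrite mulf_neq0 ?invr_neq0 // tofrac_eq0.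
  have : tofrac (p * den x) = tofrac (num x * q).
    rewrite !tofracM; have := xE x; rewrite {1}/x => /eqP.
    by rewrite eqr_div ?tofrac_eq0 // => /eqP.
  move/eqP; rewrite tofrac_eq => /eqP/(congr1 v).
  rewrite !vM ?num0 // /vK => E1.
  by apply/eqP; rewrite subr_eq addrAC eq_sym subr_eq E1.
have comm (x y : {fraction E}) : x != 0 -> y != 0 -> exists p q r : E, [/\ p != 0, q != 0, r != 0,
    x = tofrac p / tofrac r & y = tofrac q / tofrac r].
  move=> x0 y0; exists (num x * den y), (num y * den x), (den x * den y).
  rewrite !mulf_neq0 ?num0 //; split=> //.
    by rewrite {1}(xE x) !tofracM -mulf_div divff ?mulr1 // tofrac_eq0.
  by rewrite {1}(xE y) !tofracM [tofrac (den x) * _]mulrC -mulf_div divff ?mulr1 // tofrac_eq0.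
have lt_sub a b c : lt (a - c) b -> lt a (b + c).
  by move=> /(lt_add c); rewrite subrK.
have lt_sub' a b c : lt a (b + c) -> lt (a - c) b.
  by move=> /(lt_add (- c)); rewrite addrK.
exists vK; split; last first.
  move=> p p0; have := vKE p 1 p0 (oner_neq0 _).
  by rewrite tofrac1 divr1 (is_val1 (is_oval_val ov)) subr0.
split.
- move=> x y x0 y0.
  rewrite {1}(xE x) {1}(xE y) mulf_div -!tofracM vKE ?mulf_neq0 ?num0 //.
  by rewrite !vM ?num0 // /vK opprD addrACA.
- move=> x y x0 y0; have [p [q [r [p0 q0 r0 -> ->]]]] := comm x y x0 y0.
  rewrite -mulrDl -tofracD (vKE p) // (vKE q) // => /lt_sub.
  rewrite subrK => /(vD _ _ p0 q0)[pq E1].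
  by rewrite vKE // E1 mulf_neq0 ?invr_neq0 // tofrac_eq0.
move=> x y g x0 y0 xy0; have [p [q [r [p0 q0 r0 Ex Ey]]]] := comm x y x0 y0.
move: xy0; rewrite Ex Ey -mulrDl -tofracD mulf_eq0 negb_or tofrac_eq0 => /andP[pq0 _].
rewrite (vKE p) // (vKE q) // (vKE (p + q)) // => /lt_sub Lx /lt_sub Ly.
by apply: lt_sub'; apply: vL.
Qed.
End OrderedValuation.

(** * Linear combinations of monomials *)

Section Span.
Variables (C : nmodType) (I : eqType) (V : zmodType) (mu : C -> I -> V).

(** [mu c i] is the monomial of index [i] with coefficient [c].  As an inductive
    predicate, membership in the span of the monomials with index in [A] can be
    proved and used by induction, without naming a finite support. *)
Inductive spanned (A : I -> Prop) : V -> Prop :=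
| spanned0 : spanned A 0
| spannedD c i x : A i -> spanned A x -> spanned A (mu c i + x).

Lemma spanned_term (A : I -> Prop) c i : A i -> spanned A (mu c i).
Proof. by move=> Ai; rewrite -[mu c i]addr0; apply: spannedD => //; apply: spanned0. Qed.

Lemma spanned_add (A : I -> Prop) x y : spanned A x -> spanned A y -> spanned A (x + y).
Proof.
by move=> Sx Sy; elim: Sx => [|c i z Ai _ IH]; rewrite ?add0r // -addrA; apply: spannedD.
Qed.

Lemma spanned_sum (A : I -> Prop) (J : Type) (s : seq J) (Q : pred J) (F : J -> V) :
  (forall i, Q i -> spanned A (F i)) -> spanned A (\sum_(i <- s | Q i) F i).
Proof. by move=> SF; apply: big_ind => //; [apply: spanned0 | apply: spanned_add]. Qed.

Lemma spanned_sub (A B : I -> Prop) x : (forall i, A i -> B i) -> spanned A x -> spanned B x.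
Proof. by move=> AB; elim=> [|c i y /AB Bi _ Sy]; [apply: spanned0 | apply: spannedD]. Qed.

(** Collecting the terms of equal index and dropping those that vanish. *)
Lemma spanned_normal (A : I -> Prop) x :
  (forall c c' i, mu c i + mu c' i = mu (c + c') i) -> spanned A x ->
  exists (s : seq I) (c : I -> C), [/\ uniq s, x = \sum_(i <- s) mu (c i) i &
    forall i, i \in s -> A i /\ mu (c i) i != 0].
Proof.
move=> muD; elim=> [|c0 i0 y Ai _ [s [c [us -> sP]]]].
  by exists [::], (fun=> 0); rewrite big_nil.
have drop (s' : seq I) (c' : I -> C) : uniq s' -> (forall i, i \in s' -> A i) ->
    exists (s : seq I) (c : I -> C), [/\ uniq s,
      \sum_(i <- s') mu (c' i) i = \sum_(i <- s) mu (c i) i &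
      forall i, i \in s -> A i /\ mu (c i) i != 0].
  move=> us' As'; exists [seq i <- s' | mu (c' i) i != 0], c'.
  split=> [||i]; first exact: filter_uniq.
    rewrite big_filter [RHS]big_mkcond; apply: eq_bigr => i _.
    by case: eqP.
  by rewrite mem_filter => /andP[-> /As'].
have [i0s|i0s] := boolP (i0 \in s); last first.
  pose c' i := if i == i0 then c0 else c i.
  have -> : mu c0 i0 + \sum_(i <- s) mu (c i) i = \sum_(i <- i0 :: s) mu (c' i) i.
    rewrite big_cons /c' eqxx; congr (_ + _); apply: eq_big_seq => i iS.
    by case: eqP => // E; rewrite -E iS in i0s.
  apply: drop; first by rewrite /= i0s.
  by move=> i; rewrite inE => /predU1P[->|/sP[]].
pose c' i := if i == i0 then c0 + c i else c i.
have -> : mu c0 i0 + \sum_(i <- s) mu (c i) i = \sum_(i <- s) mu (c' i) i.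
  rewrite !(big_rem i0 i0s) /= addrA muD /c' eqxx; congr (_ + _).
  apply: eq_big_seq => i; rewrite mem_rem_uniq // inE => /andP[/negPf -> _] //.
by apply: drop => // i /sP[].
Qed.

End Span.

Lemma spanned_mul (C : nmodType) (I : eqType) (R : nzRingType) (mu : C -> I -> R)
    (A B D : I -> Prop) x y :
  (forall c c' i j, A i -> B j -> exists c'' l, D l /\ mu c i * mu c' j = mu c'' l) ->
  spanned mu A x -> spanned mu B y -> spanned mu D (x * y).
Proof.
move=> AB Sx Sy; elim: Sx => [|c i x' Ai _ IH]; first by rewrite mul0r; apply: spanned0.
rewrite mulrDl; apply: spanned_add => //.
elim: Sy => [|c' j y' Bj _ IH']; first by rewrite mulr0; apply: spanned0.
have [c'' [l [Dl E]]] := AB c c' i j Ai Bj.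
by rewrite mulrDr E; apply: spannedD.
Qed.

Arguments spanned_term {C I V} mu {A} c {i}.
Arguments spanned0 {C I V mu A}.

(** * Leading exponents in k[X, Z] *)

Section LeadingExponent.
Variables (k : fieldType) (n : nat) (j : 'I_n).
Local Notation G := 'rV[rat]_n.+1.
Local Notation mon := ('X_{1..n} * nat)%type.

(** In a vector of exponents, the coordinate 0 belongs to Z and the coordinate
    i + 1 to X_i. *)
Definition zexp (g : G) : rat := g 0 ord0.
Definition xexp (i : 'I_n) (g : G) : rat := g 0 (lift ord0 i).

Lemma zexpD g h : zexp (g + h) = zexp g + zexp h. Proof. by rewrite /zexp mxE. Qed.
Lemma xexpD i g h : xexp i (g + h) = xexp i g + xexp i h. Proof. by rewrite /xexp mxE. Qed.
Lemma zexpN g : zexp (- g) = - zexp g. Proof. by rewrite /zexp mxE. Qed.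
Lemma xexpN i g : xexp i (- g) = - xexp i g. Proof. by rewrite /xexp mxE. Qed.
Lemma zexp0 : zexp 0 = 0. Proof. by rewrite /zexp mxE. Qed.
Lemma xexp0 i : xexp i 0 = 0. Proof. by rewrite /xexp mxE. Qed.
Lemma zexpMn g m : zexp (g *+ m) = zexp g *+ m. Proof. by rewrite /zexp mulmxnE. Qed.
Lemma xexpMn i g m : xexp i (g *+ m) = xexp i g *+ m. Proof. by rewrite /xexp mulmxnE. Qed.

Lemma exp_ext g h : zexp g = zexp h -> (forall i, xexp i g = xexp i h) -> g = h.
Proof.
move=> Ez Ex; apply/rowP => i; have [i' ->|->] := unliftP ord0 i.
  exact: Ex.
exact: Ez.
Qed.

Definition signed_coord (s : bool * 'I_n.+1) (g : G) : rat :=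
  if s.1 then - g 0 s.2 else g 0 s.2.

Lemma signed_coordD s g h :
  signed_coord s (g + h) = signed_coord s g + signed_coord s h.
Proof. by rewrite /signed_coord; case: s.1; rewrite mxE // opprD. Qed.

(** A smaller exponent in X_j wins, then a larger exponent in Z; the remaining
    coordinates only serve to make the order total. *)
Definition keys : seq (bool * 'I_n.+1) :=
  [:: (true, lift ord0 j), (false, ord0) & [seq (false, i) | i <- enum 'I_n.+1]].

Definition ltj (g h : G) : Prop := lexpos signed_coord keys (h - g).

Lemma ltj_trans g h l : ltj g h -> ltj h l -> ltj g l.
Proof.
move=> gh hl; rewrite /ltj -(subrK h l) -addrA; apply: lexposD => //; exact: signed_coordD.
Qed.

Lemma ltj_irr g : ~ ltj g g.
Proof. by rewrite /ltj subrr; apply/negP/lexpos0/signed_coordD. Qed.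

Lemma ltj_total g h : g <> h -> ltj g h \/ ltj h g.
Proof.
move=> gh; apply/orP; rewrite -(opprB h g).
apply: lexposN; first exact: signed_coordD.
have [|H] := pselect (exists i, (h - g) 0 i != 0).
  case=> i Hi; exists (false, i) => //.
  by rewrite !inE; apply/orP; right; apply/orP; right; apply: map_f; rewrite mem_enum.
case: gh; apply/rowP => i; apply/eqP; rewrite eq_sym -subr_eq0.
by apply: contrapT => Hi; apply: H; exists i; rewrite !mxE; apply/negP.
Qed.

Lemma ltj_add g h l : ltj g h -> ltj (g + l) (h + l).
Proof. by rewrite /ltj opprD addrACA subrr addr0. Qed.

Lemma ltj_x g h : xexp j h < xexp j g -> ltj g h.
Proof. by move=> H; rewrite /ltj /= /signed_coord /= !mxE opprB subr_gt0 H. Qed.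

Lemma ltj_z g h : xexp j h = xexp j g -> zexp g < zexp h -> ltj g h.
Proof.
rewrite /xexp /zexp => E H.
by rewrite /ltj /= /signed_coord /= !mxE E subrr oppr0 eqxx subr_gt0 H orbT.
Qed.

Lemma ltj_xle g h : ltj g h -> xexp j h <= xexp j g.
Proof.
rewrite /ltj /= /signed_coord /= !mxE opprB subr_gt0 subr_eq0 /xexp.
by case/orP => [/ltW//|/andP[/eqP -> _]].
Qed.

Definition vmon (x : mon) : G :=
  \row_i (if unlift ord0 i is Some i' then x.1 i' else x.2)%:R.

Lemma zexp_vmon x : zexp (vmon x) = x.2%:R.
Proof. by rewrite /zexp mxE unlift_none. Qed.
Lemma xexp_vmon i x : xexp i (vmon x) = (x.1 i)%:R.
Proof. by rewrite /xexp mxE liftK. Qed.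

Definition addmon (x y : mon) : mon := ((x.1 + y.1)%MM, (x.2 + y.2)%N).

Lemma vmonD x y : vmon (addmon x y) = vmon x + vmon y.
Proof.
apply: exp_ext => [|i]; first by rewrite zexpD !zexp_vmon natrD.
by rewrite xexpD !xexp_vmon mnmDE natrD.
Qed.

Lemma vmon_inj : injective vmon.
Proof.
move=> [m b] [m' b'] E; congr (_, _).
  apply/mnmP => i; have := congr1 (xexp i) E; rewrite !xexp_vmon.
  by move/eqP; rewrite eqr_nat => /eqP.
by have := congr1 zexp E; rewrite !zexp_vmon => /eqP; rewrite eqr_nat => /eqP.
Qed.

Definition kmon (c : k) (x : mon) : kXZ k n := (c *: 'X_[x.1])%:P * 'X^(x.2).

Definition cf (p : kXZ k n) (x : mon) : k := (p`_x.2)@_x.1.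

Lemma cf_kmon c y x : cf (kmon c y) x = c *+ (y == x).
Proof.
rewrite /cf /kmon coefCM coefXn mulr_natr mcoeffMn mcoeffZ mcoeffX.
case: x y => [m b] [m' b'] /=; rewrite -pair_eqE /= [b == b']eq_sym mulr_natr -mulrnA.
by rewrite mulnb.
Qed.

Lemma kmonM c c' x y : kmon c x * kmon c' y = kmon (c * c') (addmon x y).
Proof.
rewrite /kmon /= mulrACA -polyCM -exprD mpolyXD -scalerAl -scalerAr scalerA //.
Qed.

Local Notation Sp := (spanned kmon).

Lemma Sp_mul (A B C : mon -> Prop) p q :
  (forall x y, A x -> B y -> C (addmon x y)) -> Sp A p -> Sp B q -> Sp C (p * q).
Proof.
move=> ABC; apply: spanned_mul => c c' x y Ax By.
by exists (c * c'), (addmon x y); split; [apply: ABC | apply: kmonM].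
Qed.

Lemma Sp_cf (A : mon -> Prop) p x : Sp A p -> ~ A x -> cf p x = 0.
Proof.
move=> + nAx; elim=> [|c y q Ay _ IH]; first by rewrite /cf coef0 mcoeff0.
rewrite /cf coefD mcoeffD [X in _ + X]IH -/(cf _ _) cf_kmon addr0.
by case: eqP => // E; case: nAx; rewrite -E.
Qed.

Lemma Sp_self p : Sp (fun x => cf p x != 0) p.
Proof.
rewrite {2}(_ : p = \sum_(b < size p) \sum_(m <- msupp p`_b) kmon (p`_b)@_m (m, b : nat)).
  apply: (big_ind (Sp _)) => [|q r Sq Sr|b _]; [exact: spanned0 | exact: spanned_add |].
  rewrite big_seq; apply: (big_ind (Sp _)) => [|q r Sq Sr|m]; [exact: spanned0 | exact: spanned_add |].
  by rewrite mcoeff_msupp => Hm; apply: spanned_term.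
rewrite -[LHS]coefK poly_def; apply: eq_bigr => b _.
rewrite -mul_polyC {1}[p`_b]mpolyE raddf_sum /= mulr_suml; exact: eq_bigr.
Qed.

Definition Low g := Sp (fun x => ltj (vmon x) g).
Definition Lead (p : kXZ k n) (x : mon) := exists2 c, c != 0 & Low (vmon x) (p - kmon c x).

Lemma Lead_cf p x : Lead p x -> cf p x != 0.
Proof.
case=> c c0 /Sp_cf -/(_ x (@ltj_irr _)).
rewrite /cf coefB mcoeffB -!/(cf _ _) cf_kmon eqxx mulr1n => /eqP.
by rewrite subr_eq0 => /eqP ->.
Qed.

Lemma Lead_neq0 p x : Lead p x -> p != 0.
Proof.
by move/Lead_cf; apply: contraNneq => ->; rewrite /cf coef0 mcoeff0.
Qed.

Lemma LeadDlt p q x y : Lead p x -> Lead q y -> ltj (vmon x) (vmon y) -> Lead (p + q) y.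
Proof.
case=> c c0 Lp [c' c0' Lq] xy; exists c' => //.
rewrite -addrA; apply: spanned_add => //.
rewrite -(subrK (kmon c x) p); apply: spanned_add; last exact: spanned_term.
by apply: spanned_sub Lp => z Hz; apply: ltj_trans Hz xy.
Qed.

Lemma LeadN p x : Lead p x -> Lead (- p) x.
Proof.
case=> c c0 Lp; exists (- c); first by rewrite oppr_eq0.
rewrite (_ : _ - _ = (kmon (- 1) (0%MM, 0%N)) * (p - kmon c x)).
  apply: (@Sp_mul (fun x => x = (0%MM, 0%N)) _ _ _ _ _ _ Lp); last exact: spanned_term.
  by move=> _ [m b] -> /=; rewrite /addmon /= add0m add0n.
rewrite mulrBr kmonM /addmon /= !add0m add0n -surjective_pairing mulN1r.
by rewrite /kmon /= mpolyX0 expr0 mulr1 scaleN1r polyCN mulN1r.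
Qed.

Lemma Lead_inj p x y : Lead p x -> Lead p y -> x = y.
Proof.
have aux x' y' : Lead p x' -> Lead p y' -> ~ ltj (vmon x') (vmon y').
  move=> /LeadN Lx Ly xy; have := Lead_neq0 (LeadDlt Lx Ly xy).
  by rewrite addNr eqxx.
move=> Lx Ly; apply: vmon_inj; apply: contrapT => /ltj_total[]; exact: aux.
Qed.

Lemma LeadM p q x y : Lead p x -> Lead q y -> Lead (p * q) (addmon x y).
Proof.
case=> c c0 Lp [c' c0' Lq]; exists (c * c'); first by rewrite mulf_neq0.
rewrite -kmonM.
have -> : p * q - kmon c x * kmon c' y =
   (p - kmon c x) * (q - kmon c' y) + ((p - kmon c x) * kmon c' y + kmon c x * (q - kmon c' y)).
  by rewrite !mulrBl !mulrBr !opprB; ring.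
apply: spanned_add; last apply: spanned_add.
- apply: Sp_mul Lp Lq => a b La Lb; rewrite !vmonD.
  apply: ltj_trans (ltj_add _ La) _; rewrite ![vmon x + _]addrC; exact: ltj_add.
- apply: (Sp_mul (B := fun b => b = y)) Lp (spanned_term _ _ _) => // a b La ->.
  by rewrite !vmonD; apply: ltj_add.
apply: (Sp_mul (A := fun b => b = x)) (spanned_term _ _ _) Lq => // a b -> Lb.
by rewrite !vmonD ![vmon x + _]addrC; apply: ltj_add.
Qed.

Lemma cf_finite p : exists s : seq mon, forall x, (x \in s) = (cf p x != 0).
Proof.
pose s := flatten [seq [seq (m, b) | m <- msupp p`_b] | b <- iota 0 (size p)].
exists [seq x <- s | cf p x != 0] => x; rewrite mem_filter.
case: eqP => //= /eqP; case: x => m b Hx; apply/flatten_mapP; exists b.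
  rewrite mem_iota add0n /=; apply: contraNT Hx; rewrite -leqNgt /cf /= => Hb.
  by rewrite nth_default // mcoeff0.
by apply/mapP; exists m => //; rewrite mcoeff_msupp.
Qed.

Lemma Lead_exists p : p != 0 -> exists x, Lead p x.
Proof.
move=> p0; have [s sP] := cf_finite p.
have s0 : s != [::].
  apply: contraNneq p0 => s0; have : Sp (fun=> False) p.
    by apply: spanned_sub (Sp_self p) => x; rewrite -sP s0.
  by case.
have [x xs xmax] := seq_max ltj_trans ltj_total vmon s0.
exists x; exists (cf p x); first by rewrite -sP.
apply: spanned_sub (Sp_self _) => y.
rewrite {1}/cf coefB mcoeffB -!/(cf _ _) cf_kmon.
have [->|xy] := eqVneq x y; first by rewrite subrr eqxx.
by rewrite subr0 -sP => /xmax[/vmon_inj E|//]; rewrite E eqxx in xy.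
Qed.

Definition lexp (p : kXZ k n) : G :=
  if pselect (exists x, Lead p x) is left h then vmon (projT1 (cid h)) else 0.

Lemma lexpE p x : Lead p x -> lexp p = vmon x.
Proof.
move=> Lx; rewrite /lexp; case: pselect => [h|[]]; last by exists x.
by congr vmon; apply: Lead_inj Lx; exact: (projT2 (cid h)).
Qed.

(** Leading terms multiply, and a sum has the larger leading term when they
    differ. *)
Lemma lexp_oval : is_oval ltj lexp.
Proof.
split=> [p q /Lead_exists[x Lx] /Lead_exists[y Ly]|p q /Lead_exists[x Lx] /Lead_exists[y Ly]|].
- by rewrite (lexpE Lx) (lexpE Ly) (lexpE (LeadM Lx Ly)) vmonD.
- rewrite (lexpE Lx) (lexpE Ly) => xy; have L := LeadDlt Lx Ly xy.
  by rewrite (lexpE L); split=> //; apply: Lead_neq0 L.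
move=> p q g /Lead_exists[x Lx] /Lead_exists[y Ly] /Lead_exists[z Lz].
rewrite (lexpE Lx) (lexpE Ly) (lexpE Lz) => xg yg.
have Lowg r w : Lead r w -> ltj (vmon w) g -> Low g r.
  case=> c c0 Lr wg; rewrite -(subrK (kmon c w) r); apply: spanned_add; last exact: spanned_term.
  by apply: spanned_sub Lr => a Ha; apply: ltj_trans Ha wg.
have Spq := spanned_add (Lowg _ _ Lx xg) (Lowg _ _ Ly yg).
apply: contrapT => /(Sp_cf Spq) E; by have := Lead_cf Lz; rewrite E eqxx.
Qed.

Lemma lexp_supp (p : kXZ k n) : p != 0 -> exists2 x, lexp p = vmon x & cf p x != 0.
Proof.
by move=> /Lead_exists[x Lx]; exists x; [exact: lexpE | apply: Lead_cf Lx].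
Qed.

Lemma lexp_size (p : kXZ k n) : p != 0 -> zexp (lexp p) <= (size p).-1%:R.
Proof.
move=> /lexp_supp[[m b] -> /= Hx]; rewrite zexp_vmon ler_nat /=.
case: (ltnP b (size p)) => [|Hb]; first by case: (size p).
by move: Hx; rewrite /cf /= nth_default // mcoeff0 eqxx.
Qed.

Lemma lexp_x_ge0 i (p : kXZ k n) : p != 0 -> 0 <= xexp i (lexp p).
Proof. by move=> /lexp_supp[x -> _]; rewrite xexp_vmon ler0n. Qed.

(** The leading monomial has the least exponent in X_j: when it involves X_j, so
    do all monomials. *)
Lemma lexp_dvd (p : kXZ k n) : p != 0 -> 0 < xexp j (lexp p) ->
  exists q : kXZ k n, p = ('X_j : {mpoly k[n]})%:P * q.
Proof.
move=> p0; have [x Lx] := Lead_exists p0; rewrite (lexpE Lx) => xj.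
have : Sp (fun y => (0 < y.1 j)%N) p.
  case: Lx => c c0 Lp; rewrite -(subrK (kmon c x) p); apply: spanned_add.
    apply: spanned_sub Lp => y /ltj_xle xy.
    by have := lt_le_trans xj xy; rewrite xexp_vmon ltr0n.
  by apply: spanned_term; move: xj; rewrite xexp_vmon ltr0n.
elim=> [|c [m b] q /= mj _ [r ->]]; first by exists 0; rewrite mulr0.
exists (kmon c ((m - U_(j))%MM, b) + r); rewrite mulrDr; congr (_ + _).
rewrite /kmon /= mulrA -polyCM -scalerAr -mpolyXD addmC submK //.
by rewrite lep1mP -lt0n.
Qed.

Lemma Lead_kmon c x : c != 0 -> Lead (kmon c x) x.
Proof. by move=> c0; exists c => //; rewrite subrr; apply: spanned0. Qed.

Lemma lexpC (c : k) : c != 0 -> lexp (c%:MP)%:P = 0.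
Proof.
move=> c0; have := lexpE (@Lead_kmon c (0%MM, 0%N) c0).
rewrite /kmon mpolyX0 expr0 mulr1 alg_mpolyC => ->.
by apply: exp_ext => [|i]; rewrite ?zexp_vmon ?xexp_vmon ?zexp0 ?xexp0 // mnm0E.
Qed.

Lemma lexpXm m : lexp ('X_[m] : {mpoly k[n]})%:P = vmon (m, 0%N).
Proof.
have := lexpE (@Lead_kmon 1 (m, 0%N) (oner_neq0 _)).
by rewrite /kmon expr0 mulr1 scale1r.
Qed.

Lemma lexpZ : lexp 'X = vmon (0%MM, 1%N).
Proof.
have := lexpE (@Lead_kmon 1 (0%MM, 1%N) (oner_neq0 _)).
by rewrite /kmon expr1 mpolyX0 scale1r mul1r.
Qed.

(** When the leading coefficient in Z is a constant, the monomial Z^deg is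
    beaten by none: it does not involve X_j and has the largest exponent in Z. *)
Lemma lexp_monic (p : kXZ k n) (c : k) : c != 0 -> lead_coef p = c%:MP ->
  lexp p = vmon (0%MM, (size p).-1).
Proof.
move=> c0 lp; apply: lexpE; exists c => //.
apply: spanned_sub (Sp_self _) => -[m b].
rewrite {1}/cf coefB mcoeffB -!/(cf _ _) cf_kmon => Hx.
have bs : (b < (size p).-1)%N.
  have lc m' : cf p (m', (size p).-1) = c *+ (m' == 0%MM).
    by rewrite /cf /= -[_`_ _]/(lead_coef p) lp mcoeffC mulr_natr.
  move: Hx; case: ltnP => // Hb; have [[<- <-]|NE] := eqVneq (0%MM, (size p).-1) (m, b).
    by rewrite lc eqxx subrr eqxx.
  rewrite subr0; move: Hb NE; rewrite leq_eqVlt => /orP[/eqP <-|Hb _].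
    by rewrite -pair_eqE /= eqxx andbT lc eq_sym => /negPf ->; rewrite eqxx.
  rewrite /cf /= nth_default ?mcoeff0 ?eqxx //.
  exact: leq_trans (leqSpred _) Hb.
have [mj|mj] := posnP (m j).
  by apply: ltj_z; rewrite ?xexp_vmon ?zexp_vmon /= ?mnm0E ?mj // ltr_nat.
by apply: ltj_x; rewrite !xexp_vmon /= mnm0E ltr_nat.
Qed.

End LeadingExponent.

(** * Values in a field containing k[X, Z] *)

Section InField.
Variables (k : fieldType) (n : nat) (F : fieldType).
Variable io : {rmorphism kXZ k n -> F}.
Hypothesis io_inj : injective io.
Implicit Types (d e m : 'X_{1..n}) (P : kXZ k n) (Q : kXYZ k n).

Definition xF m : F := io ('X_[m] : {mpoly k[n]})%:P.
Definition zF : F := io 'X.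
Definition yF d P : F := io P / xF d.
Definition evQ Q (u : F) : F := (map_poly io Q).[u].
Definition tF d e P Q : F := evQ Q (yF d P) / xF e.

Lemma io_eq0 p : (io p == 0) = (p == 0).
Proof. by rewrite -(inj_eq io_inj) rmorph0. Qed.
Lemma mpolyXC_neq0 m : ('X_[m] : {mpoly k[n]})%:P != 0 :> kXZ k n.
Proof. by rewrite polyC_eq0 -msupp_eq0 msuppX. Qed.
Lemma xF_neq0 m : xF m != 0.
Proof. by rewrite io_eq0 mpolyXC_neq0. Qed.
Lemma zF_neq0 : zF != 0.
Proof. by rewrite io_eq0 polyX_eq0. Qed.
Lemma xFD m m' : xF (m + m')%MM = xF m * xF m'.
Proof. by rewrite /xF mpolyXD polyCM rmorphM. Qed.
Lemma yFE d P : xF d * yF d P = io P.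
Proof. by rewrite /yF mulrC divfK ?xF_neq0. Qed.
Lemma tFE d e P Q : xF e * tF d e P Q = evQ Q (yF d P).
Proof. by rewrite /tF mulrC divfK ?xF_neq0. Qed.
Lemma xF0 : xF 0%MM = 1.
Proof. by rewrite /xF mpolyX0 polyC1 rmorph1. Qed.
Lemma evQE Q u : evQ Q u = \sum_(i < size Q) io Q`_i * u ^+ i.
Proof.
rewrite /evQ horner_coef size_map_inj_poly ?rmorph0 //.
by apply: eq_bigr => i _; rewrite coef_map.
Qed.

Variables (j : 'I_n) (v : F -> 'rV[rat]_n.+1).
Hypothesis ov : is_oval (ltj j) v.
Hypothesis vE : forall p : kXZ k n, p != 0 -> v (io p) = lexp j p.

Lemma vM (x y : F) : x != 0 -> y != 0 -> v (x * y) = v x + v y.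
Proof. by case: ov => H _ _; apply: H. Qed.

Lemma v1 : v 1 = 0. Proof. exact: is_val1 (is_oval_val (@ltj_total _ j) ov). Qed.

Lemma vX (x : F) (m : nat) : x != 0 -> v (x ^+ m) = v x *+ m.
Proof.
move=> x0; elim: m => [|m IH]; first by rewrite expr0 v1 mulr0n.
by rewrite exprS vM ?expf_neq0 // IH mulrS.
Qed.

Lemma v_xF m : v (xF m) = vmon (m, 0%N).
Proof. by rewrite /xF vE ?lexpXm // mpolyXC_neq0. Qed.

Lemma v_zF : v zF = vmon (0%MM, 1%N).
Proof. by rewrite /zF vE ?lexpZ // polyX_eq0. Qed.

(** The coefficients of Q have nonnegative exponents in X_j, so a value with a
    negative one makes the leading term of Q dominate. *)
Lemma v_horner Q (u : F) : Q \is monic -> u != 0 -> xexp j (v u) < 0 ->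
  evQ Q u != 0 /\ v (evQ Q u) = v u *+ (size Q).-1.
Proof.
move=> Qm u0 xu; have [_ vD _] := ov.
have Q0 : Q != 0 by apply: monic_neq0.
rewrite evQE; have -> : size Q = (size Q).-1.+1 by rewrite prednK // size_poly_gt0.
rewrite big_ord_recr /=.
rewrite -[Q`_ _]/(lead_coef Q) (monicP Qm) rmorph1 mul1r.
set q := (size Q).-1.
have uq0 : u ^+ q != 0 by rewrite expf_neq0.
have [|->|] := @oval_sum_lt _ (ltj j) _ v _ (index_enum 'I_q)
  (fun i => io Q`_i * u ^+ i) (v (u ^+ q)) ov.
- move=> i _; have [->|Qi] := eqVneq Q`_i 0; first by rewrite rmorph0 mul0r; left.
  right; rewrite vM ?io_eq0 ?expf_neq0 // vE // (vX i u0) (vX q u0); apply: ltj_x.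
  rewrite xexpD !xexpMn; have := lexp_x_ge0 j j Qi.
  have : (xexp j (v u)) *+ q < xexp j (v u) *+ i.
    by rewrite -[ltLHS]mulr_natr -[ltRHS]mulr_natr ltr_nM2l // ltr_nat.
  lra.
- by rewrite add0r vX.
have [->|S0] := eqVneq (\sum_(i < q) io Q`_i * u ^+ i) 0.
  by rewrite add0r vX.
by move=> Hlt; have [? ->] := vD _ _ S0 uq0 Hlt; rewrite vX.
Qed.
End InField.

(** * The values of the algebra generated by X, Z, y and t *)

Section Subduction.
Variables (k : fieldType) (n : nat) (F : fieldType).
Variable io : {rmorphism kXZ k n -> F}.
Hypothesis io_inj : injective io.
Variables (d e : 'X_{1..n}) (P : kXZ k n) (Q : kXYZ k n).
Hypotheses (Pm : P \is monic) (Qm : Q \is monic).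
Let p := (size P).-1.
Let q := (size Q).-1.
Hypotheses (p_gt0 : (0 < p)%N) (q_gt0 : (0 < q)%N).
Local Notation x := (xF io).
Local Notation z := (zF io).
Variables y t : F.
Hypotheses (yE : x d * y = io P) (tE : x e * t = evQ io Q y).
Local Notation mon4 := ('X_{1..n} * nat * nat * nat)%type.

Definition cst (c : k) : F := io (c%:MP)%:P.

Lemma cstM c c' : cst (c * c') = cst c * cst c'.
Proof. by rewrite /cst mpolyCM polyCM rmorphM. Qed.
Lemma cstD c c' : cst (c + c') = cst c + cst c'.
Proof. by rewrite /cst mpolyCD polyCD (rmorphD io). Qed.
Lemma cst0 : cst 0 = 0.
Proof. by apply: (addrI (cst 0)); rewrite -cstD !addr0. Qed.
Lemma cst1 : cst 1 = 1.
Proof. by rewrite /cst mpolyC1 polyC1 rmorph1. Qed.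
Lemma cst_eq0 c : (cst c == 0) = (c == 0).
Proof. by rewrite /cst io_eq0 // polyC_eq0 mpolyC_eq0. Qed.

Definition mu (c : k) (m : mon4) : F :=
  let: (a, b, c', g) := m in cst c * x a * z ^+ b * y ^+ c' * t ^+ g.

(** [P] and [Q] being monic, the relations eliminate Z^p and y^q. *)
Definition normal (m : mon4) : Prop :=
  let: (a, b, c', g) := m in (b < p)%N /\ (c' < q)%N.

Definition addmon4 (m m' : mon4) : mon4 :=
  let: (a, b, c, g) := m in let: (a', b', c', g') := m' in
  ((a + a')%MM, (b + b')%N, (c + c')%N, (g + g')%N).

Lemma muM c c' m m' : mu c m * mu c' m' = mu (c * c') (addmon4 m m').
Proof.
case: m m' => [[[a b] s] g] [[[a' b'] s'] g'] /=.
rewrite cstM xFD !exprD.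
move: (cst c) (cst c') (x a) (x a') => C C' X X'; ring.
Qed.

Lemma muD c c' m : mu c m + mu c' m = mu (c + c') m.
Proof.
case: m => [[[a b] s] g] /=.
by rewrite cstD !mulrDl.
Qed.

Lemma mu0 m : mu 0 m = 0.
Proof. by case: m => [[[a b] s] g] /=; rewrite cst0 !mul0r. Qed.

Definition inA (u : F) : Prop := spanned mu (fun=> True) u.

Lemma inA_add u w : inA u -> inA w -> inA (u + w).
Proof. exact: spanned_add. Qed.

Lemma inA_mul u w : inA u -> inA w -> inA (u * w).
Proof.
apply: spanned_mul => c c' m m' _ _; exists (c * c'), (addmon4 m m').
by rewrite muM.
Qed.

Lemma io_spanned (r : kXZ k n) :
  spanned mu (fun m => exists a i, (i < size r)%N /\ m = (a, i, 0%N, 0%N)) (io r).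
Proof.
have -> : io r = \sum_(i < size r) io (r`_i *: 'X^i).
  by rewrite -[r in LHS]coefK poly_def rmorph_sum.
apply: spanned_sum => i _.
have -> : io (r`_i *: 'X^i) = \sum_(m <- msupp r`_i) mu (r`_i)@_m (m, i : nat, 0%N, 0%N).
  rewrite -mul_polyC {1}[r`_i]mpolyE raddf_sum /= mulr_suml rmorph_sum.
  apply: eq_bigr => m _.
  by rewrite !expr0 !mulr1 !rmorphM rmorphXn /= -mul_mpolyC polyCM rmorphM.
by apply: spanned_sum => m _; apply: spanned_term; exists m, i.
Qed.

Lemma inA_io r : inA (io r).
Proof. exact: spanned_sub (io_spanned r). Qed.

Lemma mu1 m : mu 1 m = let: (a, b, c', g) := m in x a * z ^+ b * y ^+ c' * t ^+ g.
Proof. by case: m => [[[a b] s] g]; rewrite /= cst1 mul1r. Qed.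

Lemma inA_y : inA y.
Proof.
have -> : y = mu 1 (0%MM, 0%N, 1%N, 0%N).
  by rewrite mu1 xF0 !expr0 !mul1r expr1 mulr1.
exact: spanned_term.
Qed.

Lemma inA_t : inA t.
Proof.
have -> : t = mu 1 (0%MM, 0%N, 0%N, 1%N).
  by rewrite mu1 xF0 !expr0 !mul1r expr1.
exact: spanned_term.
Qed.

Variables (j : 'I_n) (v : F -> 'rV[rat]_n.+1).
Hypothesis ov : is_oval (ltj j) v.
Hypothesis vE : forall r : kXZ k n, r != 0 -> v (io r) = lexp j r.
Hypothesis dj_gt0 : (0 < d j)%N.

Lemma y_neq0 : y != 0.
Proof.
have := io_eq0 io_inj P; rewrite -yE mulf_eq0 (negPf (xF_neq0 io_inj d)) /= => ->.
exact: monic_neq0.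
Qed.

Lemma v_io_monic (r : kXZ k n) : r \is monic -> v (io r) = vmon (0%MM, (size r).-1).
Proof.
move=> rm; rewrite vE ?monic_neq0 // (@lexp_monic k n j r 1) ?oner_neq0 //.
by rewrite (monicP rm) mpolyC1.
Qed.

Lemma v_y : v y = vmon (0%MM, p) - vmon (d, 0%N).
Proof.
have := vM ov (xF_neq0 io_inj d) y_neq0; rewrite yE v_io_monic // (v_xF vE).
by move=> ->; rewrite addrC addKr.
Qed.

Lemma xexp_y i : xexp i (v y) = - (d i)%:R.
Proof. by rewrite v_y xexpD xexpN !xexp_vmon mnm0E sub0r. Qed.
Lemma zexp_y : zexp (v y) = p%:R.
Proof. by rewrite v_y zexpD zexpN !zexp_vmon subr0. Qed.

Lemma xexpy_lt0 : xexp j (v y) < 0.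
Proof. by rewrite xexp_y oppr_lt0 ltr0n. Qed.

Lemma t_neq0 : t != 0.
Proof.
have [Qy0 _] := v_horner io_inj ov vE Qm y_neq0 xexpy_lt0.
by move: Qy0; rewrite -tE mulf_eq0 negb_or => /andP[].
Qed.

Lemma v_t : v t = v y *+ q - vmon (e, 0%N).
Proof.
have [_ E] := v_horner io_inj ov vE Qm y_neq0 xexpy_lt0.
have := vM ov (xF_neq0 io_inj e) t_neq0; rewrite tE E (v_xF vE).
by move=> ->; rewrite addrC addKr.
Qed.

Lemma xexp_t i : xexp i (v t) = - (d i * q + e i)%:R.
Proof.
by rewrite v_t xexpD xexpN xexpMn xexp_y xexp_vmon natrD natrM mulr_natr opprD mulNrn.
Qed.
Lemma zexp_t : zexp (v t) = (p * q)%:R.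
Proof. by rewrite v_t zexpD zexpN zexpMn zexp_y zexp_vmon subr0 natrM mulr_natr. Qed.

Lemma mu_neq0 c m : (mu c m != 0) = (c != 0).
Proof.
have [->|c0] := eqVneq c 0; first by rewrite mu0 eqxx.
case: m => [[[a b] s] g] /=; rewrite !mulf_neq0 ?expf_neq0 ?zF_neq0 ?xF_neq0 ?y_neq0 ?t_neq0 //.
by rewrite cst_eq0.
Qed.

Lemma v_mu c m : c != 0 -> v (mu c m) =
  let: (a, b, c', g) := m in vmon (a, b) + v y *+ c' + v t *+ g.
Proof.
move=> c0; case: m => [[[a b] s] g] /=.
have cc0 : cst c != 0 by rewrite cst_eq0.
have x0 := xF_neq0 io_inj a; have z0 := zF_neq0 io_inj.
have zb0 : z ^+ b != 0 := expf_neq0 b z0.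
have ys0 : y ^+ s != 0 := expf_neq0 s y_neq0.
have tg0 : t ^+ g != 0 := expf_neq0 g t_neq0.
have h1 := mulf_neq0 cc0 x0; have h2 := mulf_neq0 h1 zb0; have h3 := mulf_neq0 h2 ys0.
rewrite (vM ov h3 tg0) (vM ov h2 ys0) (vM ov h1 zb0) (vM ov cc0 x0).
rewrite (vX ov b z0) (vX ov s y_neq0) (vX ov g t_neq0).
rewrite (v_xF vE) (v_zF vE) // /cst vE ?polyC_eq0 ?mpolyC_eq0 // lexpC // add0r.
congr (_ + _ + _); apply: exp_ext => [|i].
  by rewrite zexpD zexpMn !zexp_vmon /= add0r.
by rewrite xexpD xexpMn !xexp_vmon /= mnm0E mul0rn addr0.
Qed.

(** The opposite of the exponent in X_j of the value. *)
Definition wt (m : mon4) : int :=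
  let: (a, b, c', g) := m in
  c'%:Z * (d j)%:Z + g%:Z * ((d j)%:Z * q%:Z + (e j)%:Z) - (a j)%:Z.

Lemma xexp_mu i c a b c' g : c != 0 ->
  xexp i (v (mu c (a, b, c', g))) = (a i)%:R - (c' * d i)%:R - (g * (d i * q + e i))%:R.
Proof.
move=> c0; rewrite v_mu // !xexpD !xexpMn xexp_y xexp_t xexp_vmon.
by rewrite !mulNrn -!mulrnA (mulnC (d i) c') (mulnC (_ + _)%N g).
Qed.

Lemma zexp_mu c a b c' g : c != 0 ->
  zexp (v (mu c (a, b, c', g))) = (b + p * c' + p * q * g)%:R.
Proof.
move=> c0; rewrite v_mu // !zexpD !zexpMn zexp_y zexp_t zexp_vmon.
by rewrite -!mulrnA -!natrD.
Qed.

Lemma wt_mu c m : c != 0 -> xexp j (v (mu c m)) = - (wt m)%:~R.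
Proof.
case: m => [[[a b] s] g] c0; rewrite xexp_mu // /wt.
rewrite /= !natrM natrD natrM intrB intrD !intrM intrD intrM -!pmulrn.
move: (a j)%:R (d j)%:R (e j)%:R s%:R g%:R q%:R => A D E S H R; ring.
Qed.

(** The exponent in Z of the value is b + p c + p q g with b < p and c < q:
    a mixed radix expansion, from which b, c and g can be read off. *)
Lemma v_normal_inj c c' m m' : c != 0 -> c' != 0 -> normal m -> normal m' ->
  v (mu c m) = v (mu c' m') -> m = m'.
Proof.
case: m m' => [[[a b] s] g] [[[a' b'] s'] g'] c0 c'0 [bp sq] [b'p s'q] E.
have := congr1 (@zexp n) E; rewrite !zexp_mu // => /eqP; rewrite eqr_nat => /eqP E1.
have Eb : b = b'.
  have := congr1 (modn^~ p) E1.
  by rewrite -!addnA -!mulnA -!mulnDr !(addnC _ (p * _)%N) !(mulnC p) !modnMDl !modn_small.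
have Es : s = s'.
  move: E1; rewrite Eb -!addnA => /addnI; rewrite -!mulnA -!mulnDr => /eqP.
  rewrite eqn_pmul2l // => /eqP E2.
  have := congr1 (modn^~ q) E2.
  by rewrite !(addnC _ (q * _)%N) !(mulnC q) !modnMDl !modn_small.
have Eg : g = g'.
  move: E1; rewrite Eb Es => /addnI /eqP; rewrite eqn_pmul2l ?muln_gt0 ?p_gt0 // => /eqP.
  by [].
congr (_, _, _, _) => //; apply/mnmP => i.
have := congr1 (xexp i) E; rewrite !xexp_mu // Es Eg => /addIr/addIr/eqP.
by rewrite eqr_nat => /eqP.
Qed.

Local Arguments mu : simpl never.

Lemma muN c m : - mu c m = mu (- c) m.
Proof. by apply/eqP; rewrite eq_sym -addr_eq0 muD addNr mu0. Qed.

Lemma wtD m m' : wt (addmon4 m m') = wt m + wt m'.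
Proof.
case: m m' => [[[a b] s] g] [[[a' b'] s'] g'] /=.
by rewrite mnmDE !PoszD; ring.
Qed.

Definition filt (w : int) : F -> Prop := spanned mu (fun m => wt m <= w).

(** Rewriting to normal form is only needed for the part of weight [w]. *)
Definition reduces (w : int) (u : F) : Prop := exists u1 u2,
  [/\ u = u1 + u2, spanned mu (fun m => normal m /\ wt m = w) u1 & filt (w - 1) u2].

Lemma reduces_low w u : filt (w - 1) u -> reduces w u.
Proof. by move=> Hu; exists 0, u; split=> //; [rewrite add0r | apply: spanned0]. Qed.

Lemma reduces_add w u u' : reduces w u -> reduces w u' -> reduces w (u + u').
Proof.
case=> [u1 [u2 [-> N1 F2]]] [u1' [u2' [-> N1' F2']]].
by exists (u1 + u1'), (u2 + u2'); split; [by rewrite addrACA | |]; apply: spanned_add.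
Qed.

Lemma spanned_reduces w (A : mon4 -> Prop) u :
  (forall c m, A m -> reduces w (mu c m)) -> spanned mu A u -> reduces w u.
Proof.
move=> H; elim=> [|c m u' Am _ IH]; first exact/reduces_low/spanned0.
exact/reduces_add/IH/H.
Qed.

Lemma io_y_spanned (r : kXZ k n) s :
  spanned mu (fun m => exists a b, m = (a, b, s, 0%N)) (io r * y ^+ s).
Proof.
have -> : y ^+ s = mu 1 (0%MM, 0%N, s, 0%N) by rewrite mu1 xF0 !expr0 !mul1r mulr1.
apply: (spanned_mul (B := fun m => m = (0%MM, 0%N, s, 0%N))) (io_spanned r) (spanned_term _ _ _) => //.
move=> c c' _ _ [a [i [_ ->]]] ->; exists (c * c'), (a, i, s, 0%N); split; first by exists a, i.
by rewrite muM /= addm0 addn0.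
Qed.

(** The rule for Z^p.  Its two sides have weight 0, and the tail of [P] has weight
    at most 0 and smaller degree in Z. *)
Lemma z_pow_p : z ^+ p = mu 1 (d, 0%N, 1%N, 0%N) - io (P - 'X^p).
Proof.
by rewrite mu1 expr0 !mulr1 expr1 yE rmorphB opprB addrC subrK rmorphXn.
Qed.

(** The rule for y^q.  As d_j is positive, the tail of [Q] has smaller weight than
    y^q, whatever its degree in Z. *)
Lemma y_pow_q : y ^+ q = mu 1 (e, 0%N, 0%N, 1%N) - \sum_(i < q) io Q`_i * y ^+ i.
Proof.
rewrite mu1 !expr0 !mulr1 expr1 tE evQE //.
have -> : size Q = q.+1 by rewrite prednK // size_poly_gt0 monic_neq0.
rewrite big_ord_recr /= -[Q`_q]/(lead_coef Q) (monicP Qm) rmorph1 mul1r.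
by rewrite addrAC subrr add0r.
Qed.

Lemma mu_reduce_y c a b s g : mu c (a, b, (s + q)%N, g) =
  mu c ((a + e)%MM, b, s, g.+1) +
  mu (- c) (a, b, s, g) * \sum_(i < q) io Q`_i * y ^+ i.
Proof.
have -> : mu c (a, b, (s + q)%N, g) = mu c (a, b, s, g) * y ^+ q.
  by rewrite /mu exprD mulrA [RHS]mulrAC.
rewrite y_pow_q; have := muM c 1 (a, b, s, g) (e, 0%N, 0%N, 1%N).
rewrite /addmon4 mulr1 !addn0 addn1 => <-; rewrite -(muN c (a, b, s, g)).
move: (mu c _) (mu 1 _) (\sum_(i < q) _) => A B C.
by rewrite mulrBr mulNr.
Qed.

Lemma mu_reduce_z c a b s g : mu c (a, (b + p)%N, s, g) =
  mu c ((a + d)%MM, b, s.+1, g) + mu (- c) (a, b, s, g) * io (P - 'X^p).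
Proof.
have -> : mu c (a, (b + p)%N, s, g) = mu c (a, b, s, g) * z ^+ p.
  rewrite /mu exprD mulrA [RHS]mulrAC; congr (_ * _).
  by rewrite [RHS]mulrAC.
rewrite z_pow_p; have := muM c 1 (a, b, s, g) (d, 0%N, 1%N, 0%N).
rewrite /addmon4 mulr1 !addn0 addn1 => <-; rewrite -(muN c (a, b, s, g)).
move: (mu c _) (mu 1 _) (io (_ - _)) => A B C.
by rewrite mulrBr mulNr.
Qed.

Lemma size_tail : (size (P - 'X^p)%R <= p)%N.
Proof.
apply/leq_sizeP => i; rewrite leq_eqVlt coefB coefXn => /predU1P[<-|pi].
  by rewrite eqxx -[P`_p]/(lead_coef P) (monicP Pm) subrr.
rewrite (gtn_eqF pi) subr0 nth_default //.
exact: leq_trans (leqSpred _) pi.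
Qed.

Lemma mu_io_y_spanned c m (r : kXZ k n) s :
  spanned mu (fun m1 => exists a b, m1 = addmon4 m (a, b, s, 0%N)) (mu c m * (io r * y ^+ s)).
Proof.
apply: (spanned_mul (A := fun m1 => m1 = m)) (spanned_term _ _ _) (io_y_spanned r s) => //.
move=> c1 c2 _ _ -> [a [b ->]]; exists (c1 * c2), (addmon4 m (a, b, s, 0%N)).
by split; [exists a, b | exact: muM].
Qed.

Lemma mu_io_spanned c m (r : kXZ k n) :
  spanned mu (fun m1 => exists a b, (b < size r)%N /\ m1 = addmon4 m (a, b, 0%N, 0%N))
    (mu c m * io r).
Proof.
apply: (spanned_mul (A := fun m1 => m1 = m)) (spanned_term _ _ _) (io_spanned r) => //.
move=> c1 c2 _ _ -> [a [b [br ->]]]; exists (c1 * c2), (addmon4 m (a, b, 0%N, 0%N)).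
by split; [exists a, b | exact: muM].
Qed.

(** Up to terms of lower weight, the rule for Z^p lowers the degree in Z, and
    the rule for y^q lowers the degree in y and keeps that in Z: induction on
    the pair of degrees. *)
Lemma reduces_mu w c m : wt m <= w -> reduces w (mu c m).
Proof.
case: m => [[[a b] s] g].
have [N] := ubnP b; elim: N a b s g c => // N IHb a b s g c; rewrite ltnS => bN.
have [bp|pb] := ltnP b p.
  have [N'] := ubnP s; elim: N' a s g c => // N' IHs a s g c; rewrite ltnS => sN wm.
  have [sq|qs] := ltnP s q.
    have [wE|wNE] := eqVneq (wt (a, b, s, g)) w; last first.
      apply: reduces_low; apply: spanned_term; move: wNE wm; lia.
    by exists (mu c (a, b, s, g)), 0; rewrite addr0; split=> //;
      [exact: spanned_term | exact: spanned0].
  have [s' Es] : exists s', s = (s' + q)%N by exists (s - q)%N; rewrite subnK.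
  rewrite Es mu_reduce_y; rewrite Es in sN wm.
  apply: reduces_add.
    apply: IHs; first by lia.
    move: wm; rewrite /wt mnmDE; nia.
  apply: reduces_low; rewrite mulr_sumr; apply: spanned_sum => i _.
  apply: spanned_sub (mu_io_y_spanned _ _ _ _) => _ [a' [b' ->]].
  have iq := ltn_ord i; rewrite wtD; move: wm; rewrite /wt; nia.
move=> wm.
have [b' Eb] : exists b', b = (b' + p)%N by exists (b - p)%N; rewrite subnK.
rewrite Eb mu_reduce_z; rewrite Eb in bN wm.
apply: reduces_add.
  apply: IHb; first by lia.
  move: wm; rewrite /wt mnmDE; nia.
apply: spanned_reduces (mu_io_spanned _ _ _) => c1 _ [a1 [b1 [b1p ->]]].
have b1p' := leq_trans b1p size_tail.
apply: IHb; first by lia.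
move: wm; rewrite /addmon4 /wt mnmDE; nia.
Qed.

Lemma filt_reduces w u : filt w u -> reduces w u.
Proof. by apply: spanned_reduces => c m; apply: reduces_mu. Qed.

Lemma filt_lt w u g : filt (w - 1) u -> xexp j g <= - w%:~R ->
  u = 0 \/ ltj j (v u) g.
Proof.
move=> /(spanned_normal muD)[s [c [_ -> sP]]] xg.
apply: (oval_sum_lt ov) => m ms; right.
have [wm] := sP m ms; rewrite mu_neq0 => cm0; apply: ltj_x.
rewrite wt_mu //; apply: le_lt_trans xg _; rewrite ltrN2 ltr_int.
by move: wm; lia.
Qed.

(** If the normal part of weight [w] is nonzero, it determines the value, since
    distinct normal monomials have distinct values. *)
Lemma subduction_step w u : u != 0 -> filt w u -> filt (w - 1) u \/
  exists m, [/\ xexp j (v u) = - w%:~R, normal m & v u = v (mu 1 m)].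
Proof.
move=> u0 Hu; have [u1 [u2 [E N1 F2]]] := filt_reduces Hu.
have [s [c [us E1 sP]]] := spanned_normal muD N1.
have [s0|s0] := eqVneq s [::]; first by left; rewrite E E1 s0 big_nil add0r.
right; have c0 m : m \in s -> c m != 0 by case/sP => _; rewrite mu_neq0.
have [||u10 [m ms vu1]] := oval_sum_distinct (@ltj_trans n j) (@ltj_total n j)
  (F := fun m => mu (c m) m) ov s0 us.
- by move=> m ms; rewrite mu_neq0 c0.
- move=> m m' ms ms'; have [[Nm _] _] := sP m ms; have [[Nm' _] _] := sP m' ms'.
  exact: v_normal_inj (c0 _ ms) (c0 _ ms') Nm Nm'.
rewrite -E1 in u10 vu1; have [[Nm wm] _] := sP m ms.
have cm0 := c0 m ms.
have xu1 : xexp j (v u1) = - w%:~R by rewrite vu1 wt_mu // wm.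
have vu : v u = v u1.
  have [|E2|H] := @filt_lt w u2 (v u1) F2; first by rewrite xu1.
    by rewrite E E2 addr0.
  have [u20|u20] := eqVneq u2 0; first by rewrite E u20 addr0.
  by case: ov => _ vD _; rewrite E addrC; have [] := vD _ _ u20 u10 H.
exists m; split; [by rewrite vu | exact: Nm |].
exact: etrans vu (etrans vu1 (etrans (v_mu m cm0) (esym (v_mu m (oner_neq0 k))))).
Qed.

(** The weight of an expression of [u] is at least that of [u] itself, so
    lowering it stops. *)
Lemma subduction w u : u != 0 -> filt w u -> exists w' m,
  [/\ xexp j (v u) = - w'%:~R, filt w' u, normal m & v u = v (mu 1 m)].
Proof.
move=> u0; have [N] : exists N : nat, w%:~R - N%:R <= - xexp j (v u).
  exists (Num.bound `|w%:~R + xexp j (v u)|).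
  have := archi_boundP (normr_ge0 (w%:~R + xexp j (v u))).
  by have := ler_norm (w%:~R + xexp j (v u)); lra.
elim: N w => [|N IH] w wN Hu; have [F2|[m [xu Nm vu]]] := subduction_step u0 Hu.
- have [||] := @filt_lt w u (v u) F2; first by move: wN; lra.
    by move=> u00; rewrite u00 eqxx in u0.
  by move=> H; case: (ltj_irr H).
- by exists w, m.
- apply: (IH (w - 1)) F2; move: wN; rewrite intrD -addn1 natrD; lra.
- by exists w, m.
Qed.

Lemma inA_filt u : inA u -> exists w, filt w u.
Proof.
elim=> [|c m u' _ _ [w Hw]]; first by exists 0; apply: spanned0.
exists (Num.max (wt m) w); apply: spannedD; first by rewrite le_max lexx.
by apply: spanned_sub Hw => m' Hm'; rewrite le_max Hm' orbT.
Qed.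

Lemma inA_form u : u != 0 -> inA u -> exists (a : 'X_{1..n}) (b c' g : nat),
  [/\ (b < p)%N, (c' < q)%N,
    forall i, xexp i (v u) = (a i)%:R - (c' * d i)%:R - (g * (d i * q + e i))%:R &
    zexp (v u) = (b + p * c' + p * q * g)%:R].
Proof.
move=> u0 /inA_filt[w /(subduction u0)[w' [[[[a b] s] g] [_ _ [bp sq] ->]]]].
exists a, b, s, g; split=> // [i|]; first exact: xexp_mu (oner_neq0 _).
exact: zexp_mu (oner_neq0 _).
Qed.

(** After subduction [u] is a combination of monomials of negative weight, and in
    such a monomial the exponent of X_j is positive. *)
Lemma inA_dvd u : u != 0 -> inA u -> 0 < xexp j (v u) ->
  exists2 u', inA u' & u = x U_(j)%MM * u'.
Proof.
move=> u0 /inA_filt[w /(subduction u0)[w' [_ [-> Fu _ _]]]].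
rewrite oppr_gt0 ltrz0 => w'0.
elim: Fu => [|c [[[a b] s] g] u1 wm _ [u' Au' ->]].
  by exists 0; rewrite ?mulr0 //; apply: spanned0.
exists (mu c ((a - U_(j))%MM, b, s, g) + u'); first by apply: spannedD.
rewrite mulrDr; congr (_ + _).
have aj : (U_(j) <= a)%MM.
  rewrite lep1mP -lt0n; move: wm w'0; rewrite /wt; case: (a j) => //; nia.
by rewrite /mu -{1}(submK aj) xFD; move: (x _) (x _) (cst c) => X X' C; ring.
Qed.

End Subduction.

(** * The image of k[X] under an isomorphism *)

(** [A] is the algebra generated by k[X, Z], y and t inside [F], and [rho] embeds
    k[X, Z] into [A] a second time, in such a way that each element of [A] is a
    fraction rho h / rho c with c in k[X]; an isomorphism with another such
    algebra provides this.  The elements of rho (k[X]) are called constants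
    below. *)
Section Invariant.
Variables (k : fieldType) (n : nat) (F : fieldType).
Variable io : {rmorphism kXZ k n -> F}.
Hypothesis io_inj : injective io.
Variables (d e : 'X_{1..n}) (P : kXZ k n) (Q : kXYZ k n).
Hypotheses (Pm : P \is monic) (Qm : Q \is monic).
Local Notation p := (size P).-1.
Local Notation q := (size Q).-1.
Hypotheses (p_gt1 : (1 < p)%N) (q_gt1 : (1 < q)%N).
Local Notation x := (xF io).
Local Notation z := (zF io).
Variables y t : F.
Hypotheses (yE : x d * y = io P) (tE : x e * t = evQ io Q y).
Hypotheses (d_gt0 : forall i, (0 < d i)%N) (e_gt0 : forall i, (0 < e i)%N).
Local Notation A := (inA io y t).
Variables (j : 'I_n) (v : F -> 'rV[rat]_n.+1).
Hypothesis ov : is_oval (ltj j) v.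
Hypothesis vE : forall r : kXZ k n, r != 0 -> v (io r) = lexp j r.
Variable rho : {rmorphism kXZ k n -> F}.
Hypothesis rho_inj : injective rho.
Hypothesis rho_k : forall c : k, rho (c%:MP)%:P = io (c%:MP)%:P.
Hypothesis rho_A : forall h, A (rho h).
Hypothesis rho_loc : forall u, A u -> exists (c : {mpoly k[n]}) h,
  c != 0 /\ rho c%:P * u = rho h.
Local Notation G := 'rV[rat]_n.+1.

Let p_gt0 : (0 < p)%N := ltnW p_gt1.
Let q_gt0 : (0 < q)%N := ltnW q_gt1.

Let rho_eq0 h : (rho h == 0) = (h == 0).
Proof. by rewrite -(inj_eq rho_inj) rmorph0. Qed.

Let rhoC_neq0 (c : {mpoly k[n]}) : c != 0 -> rho c%:P != 0.
Proof. by rewrite rho_eq0 polyC_eq0. Qed.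

Let rhoCM (c c' : {mpoly k[n]}) : rho (c * c')%:P = rho c%:P * rho c'%:P.
Proof. by rewrite polyCM rmorphM. Qed.

Let v_mul (u w : F) : u != 0 -> w != 0 -> v (u * w) = v u + v w := vM ov (y := w) (x := u).

Section Functional.
Variable l : G -> rat.
Hypothesis lD : forall g h, l (g + h) = l g + l h.
Hypothesis l_kills : forall c : {mpoly k[n]}, c != 0 -> l (v (rho c%:P)) = 0.

Let l0 : l 0 = 0.
Proof. by apply: (addrI (l 0)); rewrite -lD !addr0. Qed.
Let lN g : l (- g) = - l g.
Proof. by apply/eqP; rewrite -addr_eq0 -lD addNr l0. Qed.
Let lMn g m : l (g *+ m) = l g *+ m.
Proof. by elim: m => [|m IH]; rewrite ?mulr0n ?l0 // !mulrS lD IH. Qed.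

(** [key_polynomial] for the valuation v o rho of k[X][Z] and the kernel of [l],
    carried over to [A] by clearing denominators. *)
Lemma functional_key : (exists2 u, A u /\ u != 0 & l (v u) != 0) ->
  exists a, [/\ a != 0, l (v (rho a)) != 0 &
    forall u, A u -> u != 0 -> exists (c : {mpoly k[n]}) (w : kXZ k n) i,
      [/\ c != 0, w != 0, l (v (rho w)) = 0 &
        v (rho c%:P) + v u = v (rho w) + v (rho a) *+ i]].
Proof.
case=> u0 [Au0 u00] lu0.
have val : is_val (v \o rho).
  by apply: is_val_comp rho_inj (is_oval_val (@ltj_total n j) ov).
have loc u : A u -> u != 0 -> exists (c : {mpoly k[n]}) h,
    [/\ c != 0, h != 0 & v (rho c%:P) + v u = v (rho h)].
  move=> Au un0; have [c [h [c0 E]]] := rho_loc Au.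
  exists c, h; split=> //; last by rewrite -v_mul ?E // rhoC_neq0.
  by rewrite -rho_eq0 -E mulf_neq0 // rhoC_neq0.
have [||||a [a0 la aP]] := @key_polynomial_exists _ _ _ (fun g => l g = 0) val.
- by move=> g h lg lh; rewrite lD lN lg lh subr0.
- by move=> g m; rewrite lMn => /eqP; rewrite mulrn_eq0 => /eqP.
- by move=> c c0; apply: l_kills.
- have [c [h [c0 h0 E]]] := loc u0 Au0 u00.
  refine (ex_intro2 _ _ h h0 _); rewrite /comp => H.
  move: lu0; have := congr1 l E; rewrite lD H l_kills // add0r => ->.
  by rewrite eqxx.
exists a; split=> //; first exact/eqP.
move=> u Au un0; have [c [h [c0 h0 E]]] := loc u Au un0.
have [c' [w [i [c'0 w0 lw /= E']]]] := aP h h0.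
exists (c' * c), w, i; split=> //; first by rewrite mulf_neq0.
by rewrite rhoCM (v_mul (rhoC_neq0 c'0) (rhoC_neq0 c0)) -addrA [X in _ + X]E.
Qed.

(** Up to the kernel of [l], all values are multiples of a single one by natural
    numbers. *)
Lemma functional_sign :
  (forall u, A u -> u != 0 -> 0 <= l (v u)) \/ (forall u, A u -> u != 0 -> l (v u) <= 0).
Proof.
have [ex|nex] := pselect (exists2 u, A u /\ u != 0 & l (v u) != 0); last first.
  left=> u Au u0; rewrite le_eqVlt; apply/orP; left; apply: contraPT isT => H.
  by case: nex; exists u => //; rewrite eq_sym.
have [a [a0 la aP]] := functional_key ex.
have lE u : A u -> u != 0 -> exists i : nat, l (v u) = l (v (rho a)) *+ i.
  move=> Au u0; have [c [w [i [c0 w0 lw E]]]] := aP u Au u0.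
  by exists i; have := congr1 l E; rewrite !lD l_kills // lw !add0r lMn.
have [la0|la0] := lerP 0 (l (v (rho a))); [left | right] => u Au u0;
  have [i ->] := lE u Au u0; first exact: mulrn_wge0.
by rewrite mulrn_wle0 // ltW.
Qed.

End Functional.

(** [facet i] is the equation of the facet opposite to X_i in the cone generated
    by the exponents of the X_i and of t, the latter having the coordinates
    - [Di i] in X_i and p q in Z. *)
Let Di i := (d i * q + e i)%N.
Let facet i (g : G) : rat := (p * q)%:R * xexp i g + (Di i)%:R * zexp g.

Let Ax m : A (x m). Proof. exact: inA_io. Qed.
Let Az : A z. Proof. exact: inA_io. Qed.
Let x0 m : x m != 0. Proof. exact: xF_neq0. Qed.
Let z0 : z != 0. Proof. exact: zF_neq0. Qed.

Let form u : u != 0 -> A u -> exists (a : 'X_{1..n}) (b c' g : nat),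
  [/\ forall i, xexp i (v u) = (a i)%:R - (c' * d i)%:R - (g * Di i)%:R,
      zexp (v u) = (b + p * c' + p * q * g)%:R &
      forall i, facet i (v u) = (p * q * a i + Di i * b + p * e i * c')%:R].
Proof.
move=> u0 Au.
have [a [b [c' [g [_ _ xE zE]]]]] :=
  inA_form io_inj Pm Qm p_gt0 q_gt0 yE tE ov vE (d_gt0 j) u0 Au.
exists a, b, c', g; split=> // i; rewrite /facet xE zE /Di.
rewrite !(natrM, natrD); ring.
Qed.

Let facetD i g h : facet i (g + h) = facet i g + facet i h.
Proof. by rewrite /facet xexpD zexpD !mulrDr addrACA. Qed.

(** Assume that [facet i] kills the constants, and let a be the corresponding
    key polynomial.  In the coordinates (X_i, Z) the exponents of X_i and Z are
    integral combinations of the value of a and of that of t, so taking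
    determinants shows that [facet i] takes the value 1 at the value of a.  But
    p q a' + (d_i q + e_i) b' + p e_i c' is never 1. *)
Lemma no_x_facet i :
  ~ (forall c : {mpoly k[n]}, c != 0 -> facet i (v (rho c%:P)) = 0).
Proof.
move=> kills; have fx m : v (x m) = vmon (m, 0%N) by apply: v_xF vE m.
have fz : v z = vmon (0%MM, 1%N) by apply: v_zF vE.
have Di_gt2 : (2 < Di i)%N.
  by have := d_gt0 i; have := e_gt0 i; move: q_gt1; rewrite /Di; nia.
have [|a [a0 la aP]] := functional_key (facetD i) kills.
  exists (x U_(i)%MM) => //; rewrite /facet fx xexp_vmon zexp_vmon /= mnm1E eqxx.
  by rewrite mulr0 addr0 mulr1 pnatr_eq0 -lt0n muln_gt0 p_gt0 q_gt0.
have ra0 : rho a != 0 by rewrite rho_eq0.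
have [a1 [b1 [c1 [g1 [xa za fa]]]]] := form ra0 (rho_A a).
(* The values in the facet are, in the coordinates (X_i, Z), multiples of that of t. *)
have zero u : u != 0 -> A u -> facet i (v u) = 0 -> exists g : nat,
    xexp i (v u) = - (g * Di i)%:R /\ zexp (v u) = (p * q * g)%:R.
  move=> u0 Au; have [a2 [b2 [c2 [g2 [xu zu ->]]]]] := form u0 Au.
  move/eqP; rewrite pnatr_eq0 !addn_eq0 !muln_eq0 => Ez.
  have [a20 b20 c20] : [/\ a2 i = 0, b2 = 0 & c2 = 0]%N.
    move: Ez; rewrite (gtn_eqF p_gt0) (gtn_eqF q_gt0) (gtn_eqF (e_gt0 i)).
    rewrite (gtn_eqF (ltnW (ltnW Di_gt2))) /=.
    by case/andP => /andP[/eqP -> /eqP ->] /eqP ->.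
  exists g2; rewrite xu zu a20 b20 c20 mul0n muln0 !add0n; split=> //.
  by rewrite subr0 sub0r.
have rel u : u != 0 -> A u -> exists (m r : int),
    xexp i (v u) = - (r * (Di i)%:Z)%:~R + m%:~R * xexp i (v (rho a)) /\
    zexp (v u) = ((p * q)%:Z * r)%:~R + m%:~R * zexp (v (rho a)).
  move=> u0 Au; have [c [w [m [c0 w0 lw E]]]] := aP u Au u0.
  have [g2 [xc zc]] := zero _ (rhoC_neq0 c0) (rho_A _) (kills c c0).
  have rw0 : rho w != 0 by rewrite rho_eq0.
  have [g3 [xw zw]] := zero _ rw0 (rho_A _) lw.
  exists m%:Z, (g3%:Z - g2%:Z); split.
    have := congr1 (xexp i) E; rewrite !xexpD xexpMn xc xw -[_ *+ m]mulr_natl.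
    rewrite !(intrM, intrB) -!pmulrn !natrM; lra.
  have := congr1 (@zexp n) E; rewrite !zexpD zexpMn zc zw -[_ *+ m]mulr_natl.
  rewrite !(intrM, intrB) -!pmulrn !natrM; lra.
have [m1 [r1 [e11 e12]]] := rel _ (x0 U_(i)%MM) (Ax _).
have [m2 [r2 [e21 e22]]] := rel _ z0 Az.
rewrite fx xexp_vmon mnm1E eqxx in e11; rewrite fx zexp_vmon in e12.
rewrite fz xexp_vmon mnm0E in e21; rewrite fz zexp_vmon in e22.
have det1 := congr2 (fun u w : rat => u - w)
  (congr2 (fun u w : rat => u * w) e11 e22) (congr2 (fun u w : rat => u * w) e12 e21).
have : facet i (v (rho a)) * (m1 * r2 - m2 * r1)%:~R = 1.
  transitivity (1 * 1 - 0 * 0 : rat); last by ring.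
  rewrite [RHS]det1 /facet; move: (xexp _ _) (zexp _) => X Z.
  by rewrite !(intrM, intrB) -!pmulrn !natrM; ring.
rewrite fa; set N := (_ + _ + _)%N; rewrite pmulrn -intrM => /eqP.
rewrite -[1]/(1%:~R) eqr_int => /eqP N1.
have N0 : (N <> 1)%N.
  move: p_gt1 q_gt1 Di_gt2 (e_gt0 i); rewrite /N; clear.
  move: (a1 i) (Di i) (e i) p q => A' D' E' p' q' p1 q1 D2 E0.
  have pq : (1 < p' * q')%N by nia.
  have pE : (1 < p' * E')%N by nia.
  move: (p' * q')%N (p' * E')%N pq pE => M1 M2 h1 h2.
  by case: A' => [|A']; case: b1 => [|b1]; case: c1 => [|c1]; nia.
apply: N0; have := congr1 absz N1; rewrite abszM absz_nat => /eqP.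
by rewrite muln_eq1 => /andP[/eqP].
Qed.

(** Let l be a functional killing the values of the constants, with sign chosen
    so that it is nonnegative on the values of [A].  A positive multiple of l is
    zexp * tau + \sum_i facet i * c_i with nonnegative tau and c_i.  On the
    constants every term is nonnegative and the sum is zero, while tau or some
    c_i is positive. *)
Lemma some_facet : (exists i, forall c : {mpoly k[n]}, c != 0 -> facet i (v (rho c%:P)) = 0)
  \/ (forall c : {mpoly k[n]}, c != 0 -> zexp (v (rho c%:P)) = 0).
Proof.
have [|c c0|M MP] := @val_rank k n.+1 n (fun c => v (rho c%:P)).
- have rhoC_inj : injective (rho \o polyC : {mpoly k[n]} -> F).
    exact: inj_comp rho_inj (@polyC_inj _).
  exact: (@is_val_comp _ _ _ v (rho \o polyC) rhoC_inj (is_oval_val (@ltj_total n j) ov)).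
- by rewrite rho_k vE ?lexpC // polyC_eq0 mpolyC_eq0.
have [col [col0 Mcol]] : exists col : 'cV[rat]_n.+1, col != 0 /\ M *m col = 0.
  have ck0 : cokermx M != 0.
    by rewrite -mxrank_eq0 mxrank_coker subn_eq0 -ltnNge ltnS rank_leq_row.
  have [i ci] : exists i, col i (cokermx M) != 0.
    apply: contrapT => H; case/eqP: ck0; apply/matrixP => a b.
    have : col b (cokermx M) = 0 by apply/eqP; apply: contrapT => Hb; apply: H; exists b; apply/negP.
    by move/matrixP/(_ a 0); rewrite !mxE.
  by exists (col i (cokermx M)); split=> //; rewrite colE mulmxA mulmx_coker mul0mx.
pose l (g : G) : rat := (g *m col) 0 0.
have lD g h : l (g + h) = l g + l h by rewrite /l mulmxDl mxE.
have l_kills c : c != 0 -> l (v (rho c%:P)) = 0.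
  by move=> /MP /submxP[D E]; rewrite /l E -mulmxA Mcol mulmx0 mxE.
have lE g : l g = zexp g * col ord0 0 + \sum_i xexp i g * col (lift ord0 i) 0.
  by rewrite /l mxE big_ord_recl.
have fx m : v (x m) = vmon (m, 0%N) by apply: v_xF vE m.
have fz : v z = vmon (0%MM, 1%N) by apply: v_zF vE.
have dj := d_gt0 j.
have t0 : t != 0 := t_neq0 io_inj Pm Qm yE tE ov vE dj.
have At : A t := inA_t io y t.
have [s [s0 sP]] : exists s : rat, s != 0 /\ forall u, A u -> u != 0 -> 0 <= s * l (v u).
  have [H|H] := functional_sign lD l_kills; [exists 1 | exists (- 1)]; split=> // u Au u0.
    by rewrite mul1r H.
  by rewrite mulN1r oppr_ge0 H.
pose c0 := s * col ord0 0; pose c_ i := s * col (lift ord0 i) 0.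
have slE g : s * l g = zexp g * c0 + \sum_i xexp i g * c_ i.
  rewrite lE mulrDr mulr_sumr /c0 mulrCA; congr (_ + _).
  by apply: eq_bigr => i _; rewrite mulrCA.
have cx i : 0 <= c_ i.
  have := sP _ (Ax U_(i)%MM) (x0 _); rewrite slE fx zexp_vmon mul0r add0r.
  rewrite (bigD1 i) //= big1 ?addr0 => [|i' i'i]; rewrite xexp_vmon /= mnm1E.
    by rewrite eqxx mul1r.
  by rewrite eq_sym (negPf i'i) mul0r.
pose tau := (p * q)%:R * c0 - \sum_i (Di i)%:R * c_ i.
have tau_ge0 : 0 <= tau.
  have := sP _ At t0; rewrite slE (zexp_t io_inj Pm Qm yE tE ov vE dj).
  suff -> : \sum_i xexp i (v t) * c_ i = - \sum_i (Di i)%:R * c_ i by [].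
  rewrite -sumrN; apply: eq_bigr => i _.
  by rewrite (xexp_t io_inj Pm Qm yE tE ov vE dj) mulNr.
have facet_ge0 c i : c != 0 -> 0 <= facet i (v (rho c%:P)).
  move=> cn0; have [a1 [b1 [c1 [g1 [_ _ ->]]]]] := form (rhoC_neq0 cn0) (rho_A _).
  exact: ler0n.
have zexp_ge0 c : c != 0 -> 0 <= zexp (v (rho c%:P)).
  move=> cn0; have [a1 [b1 [c1 [g1 [_ -> _]]]]] := form (rhoC_neq0 cn0) (rho_A _).
  exact: ler0n.
have key c : c != 0 -> zexp (v (rho c%:P)) * tau + \sum_i facet i (v (rho c%:P)) * c_ i = 0.
  move=> cn0; move: (l_kills c cn0) => E; move: (slE (v (rho c%:P))); rewrite E mulr0.
  move: (v (rho c%:P)) => g E'.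
  transitivity ((p * q)%:R * (zexp g * c0 + \sum_i xexp i g * c_ i)); last by rewrite -E' mulr0.
  rewrite /tau mulrBr mulrDr !mulr_sumr -addrA mulrCA; congr (_ + _).
  rewrite addrC -sumrB; apply: eq_bigr => i _; rewrite /facet; ring.
have key2 c : c != 0 -> zexp (v (rho c%:P)) * tau = 0 /\
    forall i, facet i (v (rho c%:P)) * c_ i = 0.
  move=> cn0; have h1 i : 0 <= facet i (v (rho c%:P)) * c_ i by rewrite mulr_ge0 ?facet_ge0.
  have h2 : 0 <= zexp (v (rho c%:P)) * tau by rewrite mulr_ge0 ?zexp_ge0.
  have := key c cn0; move/eqP; rewrite paddr_eq0 // ?sumr_ge0 // => /andP[/eqP -> H].
  split=> // i; move: H; rewrite psumr_eq0 // => /allP/(_ i (mem_index_enum _)).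
  by move/eqP.
have [[i ci]|nex] := pselect (exists i, c_ i != 0).
  left; exists i => c /key2[_ /(_ i)/eqP]; rewrite mulf_eq0 (negPf ci) orbF.
  by move/eqP.
have c00 i : c_ i = 0 by apply/eqP; apply: contrapT => H; apply: nex; exists i; apply/negP.
right=> c /key2[/eqP + _]; rewrite mulf_eq0 => /orP[/eqP //|].
rewrite /tau big1 ?subr0 => [|i _]; last by rewrite c00 mulr0.
rewrite mulf_eq0 pnatr_eq0 -leqn0 leqNgt muln_gt0 p_gt0 q_gt0 /= => c0E.
case/eqP: col0; apply/matrixP => a b; rewrite ord1 mxE; apply: (mulfI s0); rewrite mulr0.
by have [i ->|->] := unliftP ord0 a; [exact: c00 | exact/eqP].
Qed.

(** Suppose not.  If a constant had positive exponent in X_j, it would be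
    divisible by X_j in [A]; as the factors of a polynomial of degree 0 have
    degree 0, X_j would be a fraction of constants after all.  In the facet
    zexp = 0 the exponents in X_j are nonnegative, so they vanish on the
    constants like those in Z.  Then the functional xexp j - zexp kills the
    constants, although it takes the values 1 at X_j and -1 at Z, against
    [functional_sign]. *)
Lemma x_fraction_of_constants : exists (c h : {mpoly k[n]}), c != 0 /\
  rho c%:P * x U_(j)%MM = rho h%:P.
Proof.
apply: contrapT => nex.
have dj := d_gt0 j.
have order_le0 f : f != 0 -> xexp j (v (rho f%:P)) <= 0.
  move=> f0; rewrite leNgt; apply/negP => xf.
  have [u Au E] := inA_dvd io_inj Pm Qm p_gt0 q_gt0 yE tE ov vE dj (rhoC_neq0 f0) (rho_A _) xf.
  have [c [h [c0 Eu]]] := rho_loc Au.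
  have [c' [h' [c'0 Ex]]] := rho_loc (Ax U_(j)%MM).
  have E3 : (c * c' * f)%:P = h * h'.
    apply: rho_inj; transitivity ((rho c%:P * u) * (rho c'%:P * x U_(j)%MM)).
      rewrite rhoCM rhoCM [X in _ * X]E.
      move: (rho c%:P) (rho c'%:P) (x _) => C C' X; ring.
    by rewrite [X in X * _]Eu [X in _ * X]Ex [RHS](rmorphM rho).
  have [h0 h'0] : h != 0 /\ h' != 0.
    apply/andP; rewrite -negb_or -mulf_eq0 -E3 polyC_eq0.
    by rewrite !mulf_neq0.
  have s1 : size h' = 1.
    have := congr1 (fun r : {poly _} => size r) E3; rewrite /= size_polyC.
    rewrite !mulf_neq0 // size_mul // => sE.
    move: sE h0 h'0; rewrite -!size_poly_gt0.
    by case: (size h) => // a; case: (size h') => // b /=; lia.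
  by apply: nex; exists c', h'`_0; split=> //; rewrite -size1_polyC ?s1.
have [[i]|zkill] := some_facet; first exact: no_x_facet.
have xkill f : f != 0 -> xexp j (v (rho f%:P)) = 0.
  move=> f0; apply/eqP; rewrite eq_le order_le0 //=.
  have [a1 [b1 [c1 [g1 [xE zE _]]]]] := form (rhoC_neq0 f0) (rho_A _).
  move/eqP: (zkill f f0); rewrite zE pnatr_eq0 !addn_eq0 !muln_eq0.
  rewrite (gtn_eqF p_gt0) (gtn_eqF q_gt0) /= => /andP[/andP[_ /eqP c10] /eqP g10].
  by rewrite xE c10 g10 !mul0n !subr0 ler0n.
pose l (g : G) : rat := xexp j g - zexp g.
have lD g h : l (g + h) = l g + l h by rewrite /l xexpD zexpD opprD addrACA.
have [c c0|H|H] := functional_sign (l := l) lD; first by rewrite /l xkill // zkill // subrr.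
  have := H z Az z0; rewrite /l (v_zF vE) xexp_vmon zexp_vmon /= mnm0E; lra.
have := H _ (Ax U_(j)%MM) (x0 _); rewrite /l (v_xF vE) xexp_vmon zexp_vmon mnm1E eqxx /=; lra.
Qed.

End Invariant.

(** * Reduction modulo one variable *)

Section PolyDivisibility.

Lemma poly_coef_dvd (R : comNzRingType) (a : R) (p : {poly R}) :
  (forall i, exists c, p`_i = a * c) -> exists q : {poly R}, p = a%:P * q.
Proof.
elim/poly_ind: p => [_|p c IH H]; first by exists 0; rewrite mulr0.
have [i|q Eq] := IH.
  by have [b E] := H i.+1; exists b; rewrite -E coefD coefMX coefC addr0.
have [b E] := H 0; exists (q * 'X + b%:P).
by rewrite mulrDr mulrA -Eq -polyCM -E coefD coefMX coefC add0r.
Qed.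

Lemma map_poly_ker (R S : comNzRingType) (f : {rmorphism R -> S}) (a : R) :
  (forall r, f r = 0 -> exists c, r = a * c) ->
  forall p : {poly R}, map_poly f p = 0 -> exists q : {poly R}, p = a%:P * q.
Proof.
move=> kerf p fp; apply: poly_coef_dvd => i; apply: kerf.
by rewrite -coef_map fp coef0.
Qed.

Lemma map_poly_surj (R S : nzRingType) (f : {rmorphism R -> S}) :
  (forall s, exists r, f r = s) ->
  forall p : {poly S}, exists q : {poly R}, map_poly f q = p.
Proof.
move=> sf; elim/poly_ind => [|p c [q E]]; first by exists 0; rewrite rmorph0.
have [b Eb] := sf c; exists (q * 'X + b%:P).
by rewrite rmorphD rmorphM /= map_polyX map_polyC /= E Eb.
Qed.

(** Comparing leading coefficients, [a] divides that of [w]; subtract. *)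
Lemma monic_dvd (R : idomainType) (a : R) (Q u w : {poly R}) : a != 0 ->
  Q \is monic -> a%:P * u = w * Q -> exists w', w = a%:P * w'.
Proof.
move=> a0 Qm; have [m] := ubnP (size w); elim: m w u => // m IH w u; rewrite ltnS => wm E.
have [->|w0] := eqVneq w 0; first by exists 0; rewrite mulr0.
have lE : lead_coef w = a * lead_coef u.
  have := congr1 (@lead_coef _) E.
  by rewrite lead_coefM lead_coefC (lead_coef_Mmonic _ Qm) => ->.
pose r := lead_coef u *: 'X^((size w).-1).
have [||w' Ew] := IH (w - a%:P * r) (u - r * Q).
- apply: leq_trans wm; rewrite /r mul_polyC scalerA -lE.
  rewrite -[X in (_ < X)%N]prednK ?size_poly_gt0 // ltnS; apply/leq_sizeP => i.
  rewrite leq_eqVlt coefB coefZ coefXn => /predU1P[<-|wi].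
    by rewrite eqxx mulr1 subrr.
  rewrite (gtn_eqF wi) mulr0 subr0 nth_default //.
  by apply: leq_trans wi; exact: leqSpred.
- by rewrite mulrBr E mulrBl mulrA.
by exists (w' + r); rewrite mulrDr -Ew subrK.
Qed.

End PolyDivisibility.

Section AtZero.
Variables (k : fieldType) (n : nat) (i : 'I_n).

Let lift0 : {rmorphism {mpoly k[n.-1]} -> {mpoly k[n]}} :=
  comp_mpoly [tuple 'X_(lift i j) | j < n.-1].

Lemma at0C c : at0 k i c%:MP = c%:MP.
Proof. exact: comp_mpolyC. Qed.

Lemma at0X : at0 k i 'X_i = 0.
Proof. by rewrite /at0 /= comp_mpolyXU -tnth_nth tnth_mktuple unlift_none. Qed.

Lemma at0_lift j : at0 k i 'X_(lift i j) = 'X_j.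
Proof. by rewrite /at0 /= comp_mpolyXU -tnth_nth tnth_mktuple liftK. Qed.

Lemma at0_surj s : exists r, at0 k i r = s.
Proof.
exists (lift0 s); move: s.
apply: (@mpoly_morph_ext _ _ _ (at0 k i \o lift0) idfun) => [c|j].
  by rewrite /= !comp_mpolyC.
change (at0 k i (lift0 'X_j) = 'X_j).
have -> : lift0 'X_j = 'X_(lift i j).
  by rewrite /lift0 /= comp_mpolyXU -tnth_nth tnth_mktuple.
exact: at0_lift.
Qed.

(** Modulo X_i, [r] agrees with its restriction to X_i = 0; this is clear on
    generators. *)
Lemma at0_ker r : at0 k i r = 0 -> exists c, r = 'X_i * c.
Proof.
suff [c E] : exists c, r = lift0 (at0 k i r) + 'X_i * c.
  by move=> r0; exists c; rewrite {1}E r0 rmorph0 add0r.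
move: r; apply: mpoly_gen => [c|j|r s [a Ea] [b Eb]|r s [a Ea] [b Eb]].
- by exists 0; rewrite mulr0 addr0 at0C /lift0 /= comp_mpolyC.
- have [j' ->|->] := unliftP i j; last by exists 1; rewrite at0X rmorph0 add0r mulr1.
  exists 0; rewrite mulr0 addr0 at0_lift /lift0 /= comp_mpolyXU.
  by rewrite -tnth_nth tnth_mktuple.
- by exists (a + b); rewrite {1}Ea {1}Eb !rmorphD /= mulrDr addrACA.
exists (a * lift0 (at0 k i s) + lift0 (at0 k i r) * b + 'X_i * a * b).
rewrite {1}Ea {1}Eb !rmorphM /=.
by move: (lift0 _) (lift0 _) ('X_i) => u w x; ring.
Qed.

Lemma at0Z_ker r : at0Z k i r = 0 -> exists c : kXZ k n, r = ('X_i : {mpoly k[n]})%:P * c.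
Proof. exact: (map_poly_ker at0_ker). Qed.
Lemma at0Z_surj s : exists r, at0Z k i r = s.
Proof. exact: (map_poly_surj at0_surj). Qed.
Lemma at0YZ_ker r : at0YZ k i r = 0 ->
  exists c : kXYZ k n, r = ('X_i : {mpoly k[n]})%:P%:P * c.
Proof. exact: (map_poly_ker at0Z_ker). Qed.
Lemma at0YZ_surj s : exists r, at0YZ k i r = s.
Proof. exact: (map_poly_surj at0Z_surj). Qed.

Lemma at0_mX (m : 'X_{1..n}) : (0 < m i)%N -> at0 k i 'X_[m] = 0.
Proof.
move=> mi; have -> : m = (U_(i) + (m - U_(i)))%MM by rewrite addmC submK // lep1mP -lt0n.
by rewrite mpolyXD rmorphM at0X mul0r.
Qed.

Lemma at0ZC c : at0Z k i c%:P = (at0 k i c)%:P. Proof. exact: map_polyC. Qed.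
Lemma at0YZC c : at0YZ k i c%:P = (at0Z k i c)%:P. Proof. exact: map_polyC. Qed.

End AtZero.

(** * Presentation of the quotient ring *)

Lemma ideal_quot_surj (R : comNzRingType) (I : idealr R) (a : {ideal_quot I}) :
  exists s, (\pi_({ideal_quot I}) s)%qT = a.
Proof. by exists (repr a); rewrite reprK. Qed.

Lemma ideal_quot_eq0 (R : comNzRingType) (I : idealr R) (s : R) :
  (\pi_({ideal_quot I}) s)%qT = 0 <-> s \in I.
Proof.
have E := Quotient.idealrBE I s 0; rewrite subr0 in E; rewrite E -(rmorph0 \pi_({ideal_quot I})%qT).
by split=> [->|/eqP].
Qed.

Section Concrete.
Variables (k : fieldType) (n : nat) (d e : 'X_{1..n}) (P : kXZ k n) (Q : kXYZ k n).

Definition piL : {rmorphism kXYZT k n -> L d e P Q} := \pi_(L d e P Q)%qT.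

Lemma piL_k (c : k) :
  L_str d e P Q c = (\pi_(L d e P Q)%qT (c%:MP%:P%:P%:P : kXYZT k n) : L d e P Q).
Proof. by rewrite /L_str; cbn [GRing.RMorphism.sort comp]. Qed.

Lemma L_strE (c : k) : L_str d e P Q c = piL c%:MP%:P%:P%:P :> L d e P Q.
Proof. exact: piL_k. Qed.

Lemma piL_surj a : exists s, piL s = a.
Proof. exact: ideal_quot_surj a. Qed.

Lemma relIdealP s : s \in relIdeal d e P Q <->
  exists u w, s = u * rel1 d P + w * rel2 e Q.
Proof.
split=> [/asboolP[c ->]|[u [w ->]]].
  by exists (c ord0), (c (lift ord0 ord0)); rewrite !big_ord_recl big_ord0 addr0.
apply/asboolP; exists (fun i => if i == ord0 then u else w).
by rewrite !big_ord_recl big_ord0 addr0.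
Qed.

Lemma piL_eq0 s : piL s = 0 <-> exists u w, s = u * rel1 d P + w * rel2 e Q.
Proof. exact: iff_trans (ideal_quot_eq0 _ s) (relIdealP s). Qed.

End Concrete.

Section Quotient.
Variables (k : fieldType) (n : nat) (d e : 'X_{1..n}) (P : kXZ k n) (Q : kXYZ k n).
Local Notation r1 := (rel1 d P).
Local Notation r2 := (rel2 e Q).
Variables (L : comNzRingType) (pi : {rmorphism kXYZT k n -> L}).
Hypothesis pi_surj : forall a, exists s, pi s = a.
Hypothesis pi_eq0 : forall s, pi s = 0 <-> exists u w, s = u * r1 + w * r2.

Lemma L_factor (S : comNzRingType) (h : {rmorphism kXYZT k n -> S}) :
  h r1 = 0 -> h r2 = 0 -> exists g : {rmorphism L -> S}, forall s, g (pi s) = h s.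
Proof.
move=> h1 h2; pose g (a : L) := h (projT1 (cid (pi_surj a))).
have gE s : g (pi s) = h s.
  rewrite /g; case: cid => s' /= Es.
  have : pi (s' - s) = 0 by rewrite rmorphB Es subrr.
  move/pi_eq0 => [u [w E]]; apply/eqP; rewrite -subr_eq0 -rmorphB E.
  by rewrite rmorphD !rmorphM h1 h2 !mulr0 addr0.
have gB : zmod_morphism g.
  move=> a b; have [s <-] := pi_surj a; have [s' <-] := pi_surj b.
  by rewrite -rmorphB !gE rmorphB.
have gM : monoid_morphism g.
  split=> [|a b]; first by rewrite -(rmorph1 pi) gE rmorph1.
  have [s <-] := pi_surj a; have [s' <-] := pi_surj b.
  by rewrite -rmorphM !gE rmorphM.
pose gA := GRing.isZmodMorphism.Build L S g gB.
pose gMM := GRing.isMonoidMorphism.Build L S g gM.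
pose gR : {rmorphism L -> S} := HB.pack g gA gMM.
by exists gR.
Qed.

End Quotient.

(** Modulo x the relations become - A and - B, a regular sequence.  So if x h is a
    combination of the relations, its coefficients are modulo x a multiple of
    the trivial syzygy (B, - A); subtracting the corresponding trivial syzygy of
    the relations leaves coefficients divisible by x. *)
Lemma regular_quotient_torsion_free (S S' : idomainType) (th : {rmorphism S -> S'})
    (x D E Y T A B : S) :
  (forall r, th r = 0 -> exists c, r = x * c) -> (forall s, exists r, th r = s) ->
  th x = 0 -> x != 0 -> th A != 0 ->
  (forall u w, th A * u = w * th B -> exists w', w = th A * w') ->
  forall h u w, x * h = u * (x * D * Y - A) + w * (x * E * T - B) ->
  exists u' w', h = u' * (x * D * Y - A) + w' * (x * E * T - B).
Proof.
move=> th_ker th_surj thx x0 A0 div h u w Eh.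
have Euw : th A * - th u = th w * th B.
  have := congr1 th Eh; rewrite !(rmorphM, rmorphB, rmorphD) thx !mul0r !sub0r => Eth.
  apply/eqP; rewrite -subr_eq0; apply/eqP; rewrite [RHS]Eth; ring.
have [s0 Es0] := div _ _ Euw; have [s Es] := th_surj s0.
have Eu : th u = - (th s * th B).
  by apply: (mulfI A0); rewrite mulrN mulrA Es -Es0 -Euw mulrN opprK.
have [w2 Ew] : exists w2, w - A * s = x * w2.
  by apply: th_ker; rewrite rmorphB rmorphM Es0 Es subrr.
have [u2 Eu2] : exists u2, u + s * B = x * u2.
  by apply: th_ker; rewrite rmorphD rmorphM Eu addNr.
exists (u2 - s * E * T), (w2 + s * D * Y); apply: (mulfI x0); rewrite Eh.
have -> : u = x * u2 - s * B by rewrite -Eu2 addrK.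
have -> : w = x * w2 + A * s by rewrite -Ew subrK.
ring.
Qed.

Lemma poly_quotient_torsion_free (R R' : idomainType) (th : {rmorphism R -> R'})
    (x Xd Xe D E A : R) (B : {poly R}) :
  (forall r, th r = 0 -> exists c, r = x * c) -> (forall s, exists r, th r = s) ->
  th x = 0 -> x != 0 -> th A != 0 -> B \is monic -> Xd = x * D -> Xe = x * E ->
  forall h u w : {poly {poly R}},
  let r1 := (Xd%:P * 'X - A%:P)%:P in let r2 := Xe%:P%:P * 'X - B%:P in
  x%:P%:P * h = u * r1 + w * r2 -> exists u' w', h = u' * r1 + w' * r2.
Proof.
move=> th_ker th_surj thx x0 A0 Bm Ed Ee h u w r1 r2.
pose thY : {rmorphism {poly R} -> {poly R'}} := map_poly th.
pose thT : {rmorphism {poly {poly R}} -> {poly {poly R'}}} := map_poly thY.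
have thTB b : thT b%:P = (thY b)%:P by exact: map_polyC.
have thTC c : thT c%:P%:P = (th c)%:P%:P.
  by rewrite thTB; congr _%:P; exact: map_polyC.
have -> : r1 = x%:P%:P * D%:P%:P * 'X%:P - A%:P%:P.
  by rewrite /r1 Ed polyCB !polyCM.
have -> : r2 = x%:P%:P * E%:P%:P * 'X - B%:P by rewrite /r2 Ee !polyCM.
apply: (@regular_quotient_torsion_free _ _ thT x%:P%:P D%:P%:P E%:P%:P 'X%:P 'X A%:P%:P B%:P).
- exact: map_poly_ker (map_poly_ker th_ker).
- exact: map_poly_surj (map_poly_surj th_surj).
- by rewrite thTC thx.
- by rewrite !polyC_eq0.
- by rewrite thTC !polyC_eq0.
move=> u' w'; rewrite thTC thTB => E'; apply: poly_coef_dvd => i.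
apply: (@monic_dvd _ _ (thY B) u'`_i _ A0); first exact: monic_map.
by have := congr1 (fun s : {poly _} => s`_i) E'; rewrite coefCM coefMC.
Qed.

Section Quotient.
Variables (k : fieldType) (n : nat) (d e : 'X_{1..n}) (P : kXZ k n) (Q : kXYZ k n).
Local Notation r1 := (rel1 d P).
Local Notation r2 := (rel2 e Q).
Variables (L : comNzRingType) (pi : {rmorphism kXYZT k n -> L}).
Hypothesis pi_surj : forall a, exists s, pi s = a.
Hypothesis pi_eq0 : forall s, pi s = 0 <-> exists u w, s = u * r1 + w * r2.

Definition xz_ : {rmorphism kXZ k n -> L} := pi \o (polyC \o polyC).
Definition xyz_ : {rmorphism kXYZ k n -> L} := pi \o polyC.
Definition y_ : L := pi ('X%:P).
Definition t_ : L := pi 'X.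
Definition x_ (m : 'X_{1..n}) : L := xz_ ('X_[m] : {mpoly k[n]})%:P.

Lemma L_gen (Pr : L -> Prop) :
  (forall h, Pr (xz_ h)) -> Pr y_ -> Pr t_ ->
  (forall a b, Pr a -> Pr b -> Pr (a + b)) ->
  (forall a b, Pr a -> Pr b -> Pr (a * b)) -> forall a, Pr a.
Proof.
move=> Pz Py Pt PD PM a; have [s <-] := pi_surj a.
elim/poly_ind: s => [|s c IH]; first by rewrite -polyC0 -polyC0; exact: Pz.
rewrite rmorphD rmorphM; apply: (PD); first exact: PM.
elim/poly_ind: c => [|c b IHc]; first by rewrite -polyC0; exact: Pz.
rewrite polyCD polyCM rmorphD rmorphM; apply: (PD); last exact: Pz.
exact: PM.
Qed.

Lemma rel1E : r1 = ('X_[d] : {mpoly k[n]})%:P%:P%:P * 'X%:P - P%:P%:P.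
Proof. by rewrite /rel1 polyCB polyCM. Qed.

Lemma y_E : x_ d * y_ = xz_ P.
Proof.
have E : pi r1 = 0 by apply/pi_eq0; exists 1, 0; ring.
by move: E; rewrite rel1E rmorphB rmorphM => /eqP; rewrite subr_eq0 => /eqP.
Qed.

Lemma t_E : x_ e * t_ = xyz_ Q.
Proof.
have E : pi r2 = 0 by apply/pi_eq0; exists 0, 1; ring.
by move: E; rewrite /rel2 rmorphB rmorphM => /eqP; rewrite subr_eq0 => /eqP.
Qed.

Lemma x_D m m' : x_ (m + m')%MM = x_ m * x_ m'.
Proof. by rewrite /x_ mpolyXD polyCM rmorphM. Qed.

Section Torsion.
Hypotheses (Pm : P \is monic) (Qm : Q \is monic).
Variable j : 'I_n.
Hypotheses (dj : (0 < d j)%N) (ej : (0 < e j)%N).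

Lemma x_torsion1 a : x_ U_(j)%MM * a = 0 -> a = 0.
Proof.
have [h <-] := pi_surj a; rewrite -(rmorphM pi) => /pi_eq0[u [w E]].
apply/pi_eq0; move: E.
have split (m : 'X_{1..n}) : (0 < m j)%N -> ('X_[m] : {mpoly k[n]})%:P =
    ('X_j : {mpoly k[n]})%:P * ('X_[m - U_(j)] : {mpoly k[n]})%:P :> kXZ k n.
  by move=> mj; rewrite -polyCM -mpolyXD addmC submK // lep1mP -lt0n.
have thX : at0Z k j ('X_j : {mpoly k[n]})%:P = 0 by rewrite at0ZC at0X.
have X0 : ('X_j : {mpoly k[n]})%:P != 0 :> kXZ k n by rewrite polyC_eq0 -msupp_eq0 msuppX.
have thP : at0Z k j P != 0 by apply: monic_neq0; apply: monic_map.
have tf := poly_quotient_torsion_free (@at0Z_ker k n j) (@at0Z_surj k n j) thX X0 thP Qm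
  (split d dj) (split e ej).
exact (tf h u w).
Qed.

End Torsion.
End Quotient.

(** All that is used of L_[d],[e]: the relations, generation, the regularity of
    the monomials in X, and the universal property.  An abstract ring with these
    properties keeps the later computations away from the quotient. *)
Record presented (k : fieldType) (n : nat) (d e : 'X_{1..n}) (P : kXZ k n) (Q : kXYZ k n)
    (L : comNzRingType) (xz : {rmorphism kXZ k n -> L}) (y t : L) : Prop := Presented {
  pres_y : xz ('X_[d] : {mpoly k[n]})%:P * y = xz P;
  pres_t : xz ('X_[e] : {mpoly k[n]})%:P * t = (map_poly xz Q).[y];
  pres_gen : forall Pr : L -> Prop, (forall h, Pr (xz h)) -> Pr y -> Pr t ->
    (forall a b, Pr a -> Pr b -> Pr (a + b)) ->
    (forall a b, Pr a -> Pr b -> Pr (a * b)) -> forall a, Pr a;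
  pres_torsion : forall m a, xz ('X_[m] : {mpoly k[n]})%:P * a = 0 -> a = 0;
  pres_univ : forall (S : comNzRingType) (r : {rmorphism kXZ k n -> S}) (y' t' : S),
    r ('X_[d] : {mpoly k[n]})%:P * y' = r P ->
    r ('X_[e] : {mpoly k[n]})%:P * t' = (map_poly r Q).[y'] ->
    exists g : {rmorphism L -> S}, [/\ forall h, g (xz h) = r h, g y = y' & g t = t'] }.

Section Quotient.
Variables (k : fieldType) (n : nat) (d e : 'X_{1..n}) (P : kXZ k n) (Q : kXYZ k n).
Local Notation r1 := (rel1 d P).
Local Notation r2 := (rel2 e Q).
Variables (L : comNzRingType) (pi : {rmorphism kXYZT k n -> L}).
Hypothesis pi_surj : forall a, exists s, pi s = a.
Hypothesis pi_eq0 : forall s, pi s = 0 <-> exists u w, s = u * r1 + w * r2.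

Local Notation xz_ := (xz_ pi).
Local Notation xyz_ := (xyz_ pi).
Local Notation x_ := (x_ pi).
Local Notation y_ := (y_ pi).
Local Notation t_ := (t_ pi).

Section TorsionFree.
Hypotheses (Pm : P \is monic) (Qm : Q \is monic).
Hypotheses (d_gt0 : forall i, (0 < d i)%N) (e_gt0 : forall i, (0 < e i)%N).

Lemma x_torsion m a : x_ m * a = 0 -> a = 0.
Proof.
have [N] := ubnP (mdeg m); elim: N m a => // N IH m a; rewrite ltnS => mN.
have [->|m0] := eqVneq m 0%MM.
  by rewrite /x_ mpolyX0 polyC1 rmorph1 mul1r.
have [i mi] : exists i, (0 < m i)%N.
  apply: contrapT => H; case/eqP: m0; apply/mnmP => i; rewrite mnm0E.
  by apply/eqP; rewrite -leqn0 leqNgt; apply/negP => mi; apply: H; exists i.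
have Em : m = (U_(i) + (m - U_(i)))%MM by rewrite addmC submK // lep1mP -lt0n.
rewrite Em x_D -mulrA => /(x_torsion1 pi_surj pi_eq0 Pm Qm (d_gt0 i) (e_gt0 i)).
by apply: IH; apply: leq_trans mN; rewrite {2}Em mdegD mdeg1 add1n.
Qed.

End TorsionFree.

Lemma L_hom (S : comNzRingType) (r : {rmorphism kXZ k n -> S}) (y t : S) :
  r ('X_[d] : {mpoly k[n]})%:P * y = r P ->
  r ('X_[e] : {mpoly k[n]})%:P * t = (map_poly r Q).[y] ->
  exists g : {rmorphism L -> S}, [/\ forall h, g (xz_ h) = r h,
    g y_ = y, g t_ = t & forall q, g (xyz_ q) = (map_poly r q).[y]].
Proof.
move=> yE tE.
pose hY : {rmorphism kXYZ k n -> S} := horner_eval y \o map_poly r.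
pose hT : {rmorphism kXYZT k n -> S} := horner_eval t \o map_poly hY.
have hYC c : hY c%:P = r c by rewrite /hY /= map_polyC /horner_eval hornerC.
have hTC c : hT c%:P = hY c by rewrite /hT /= map_polyC /horner_eval hornerC.
have hYX : hY 'X = y by rewrite /hY /= map_polyX /horner_eval hornerX.
have hTX : hT 'X = t by rewrite /hT /= map_polyX /horner_eval hornerX.
have [||g gE] := @L_factor _ _ _ _ _ _ _ pi pi_surj pi_eq0 S hT.
- by rewrite rel1E (rmorphB hT) (rmorphM hT) !hTC !hYC hYX yE subrr.
- by rewrite /rel2 (rmorphB hT) (rmorphM hT) !hTC !hYC hTX tE subrr.
exists g; split=> [h|||q]; rewrite [LHS]gE.
- by rewrite hTC hYC.
- by rewrite hTC hYX.
- exact: hTX.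
exact: hTC.
Qed.

Lemma xyz_E q : xyz_ q = (map_poly xz_ q).[y_].
Proof.
pose g : {rmorphism kXYZ k n -> L} := horner_eval y_ \o map_poly xz_.
apply: (@poly_morph_ext _ _ xyz_ g) => [c|].
  by rewrite /g /= map_polyC /horner_eval hornerC.
by rewrite /g /= map_polyX /horner_eval hornerX.
Qed.

Lemma presentedP : P \is monic -> Q \is monic -> (forall i, (0 < d i)%N) ->
  (forall i, (0 < e i)%N) -> presented d e P Q xz_ y_ t_.
Proof.
move=> Pm Qm d0 e0; split.
- exact: y_E.
- by rewrite -xyz_E; apply: t_E.
- exact: L_gen.
- exact: x_torsion.
by move=> S r y' t' y'E t'E; have [g [gz gy gt _]] := L_hom y'E t'E; exists g.
Qed.

End Quotient.

Section Presented.
Variables (k : fieldType) (n : nat) (d e : 'X_{1..n}) (P : kXZ k n) (Q : kXYZ k n).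
Variables (L : comNzRingType) (xz : {rmorphism kXZ k n -> L}) (y t : L).
Hypothesis pL : presented d e P Q xz y t.

Local Notation x m := (xz ('X_[m] : {mpoly k[n]})%:P).

Lemma xzXD m m' : x (m + m')%MM = x m * x m'.
Proof. by rewrite mpolyXD polyCM rmorphM. Qed.

(** y and t are polynomials in X and Z up to a monomial in X. *)
Lemma localize a : exists m h, x m * a = xz h.
Proof.
have x0 : x 0%MM = 1 by rewrite mpolyX0 polyC1 rmorph1.
move: a; apply: (pres_gen pL) => [h||||].
- by exists 0%MM, h; rewrite x0 mul1r.
- by exists d, P; apply: pres_y pL.
- have [m [h E]] : exists m h, x m * (map_poly xz Q).[y] = xz h.
    elim/poly_ind: Q => [|q c [m [h E]]].
      by exists 0%MM, 0; rewrite !rmorph0 horner0 mulr0.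
    exists (m + d)%MM, (h * P + ('X_[m + d] : {mpoly k[n]})%:P * c).
    rewrite !rmorphD !rmorphM /= map_polyX map_polyC hornerD hornerM hornerX hornerC.
    rewrite -E -(pres_y pL) xzXD /=.
    move: (xz c) (x m) (x d) _.[y] => c' X X' q'; ring.
  by exists (m + e)%MM, h; rewrite xzXD -mulrA [X in _ * X](pres_t pL).
- move=> a b [m [h Ea]] [m' [h' Eb]].
  exists (m + m')%MM, (('X_[m'] : {mpoly k[n]})%:P * h + ('X_[m] : {mpoly k[n]})%:P * h').
  rewrite rmorphD !rmorphM -Ea -Eb xzXD.
  move: (x m) (x m') => X X'; ring.
move=> a b [m [h Ea]] [m' [h' Eb]]; exists (m + m')%MM, (h * h').
by rewrite rmorphM -Ea -Eb xzXD mulrACA.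
Qed.

Lemma pres_hom_ext (S : nzRingType) (f g : {rmorphism L -> S}) :
  (forall h, f (xz h) = g (xz h)) -> f y = g y -> f t = g t -> f =1 g.
Proof.
move=> fgz fgy fgt; apply: (pres_gen pL) => // a b Ea Eb.
  by rewrite !rmorphD Ea Eb.
by rewrite !rmorphM Ea Eb.
Qed.

End Presented.

Lemma quotient_presented (k : fieldType) (n : nat) (d e : 'X_{1..n}) (P : kXZ k n) (Q : kXYZ k n)
    (L : comNzRingType) (pi : {rmorphism kXYZT k n -> L}) (iL : {rmorphism k -> L}) :
  (forall a, exists s, pi s = a) ->
  (forall s, pi s = 0 <-> exists u w, s = u * rel1 d P + w * rel2 e Q) ->
  (forall c, iL c = pi c%:MP%:P%:P%:P) ->
  P \is monic -> Q \is monic -> (forall i, (0 < d i)%N) -> (forall i, (0 < e i)%N) ->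
  exists (xz : {rmorphism kXZ k n -> L}) (y t : L),
  presented d e P Q xz y t /\ forall c, iL c = xz (c%:MP)%:P.
Proof.
move=> pi_surj pi_eq0 iLE Pm Qm d_gt0 e_gt0; exists (xz_ pi), (y_ pi), (t_ pi).
by split; [exact: presentedP | exact: iLE].
Qed.

(** * Embedding into a field *)

Lemma morph_monomial (R S : comNzRingType) (f : {rmorphism R -> S}) (a b c d e : R)
  i j l : f (a * b * c ^+ i * d ^+ j * e ^+ l) = f a * f b * f c ^+ i * f d ^+ j * f e ^+ l.
Proof. by rewrite !rmorphM !rmorphXn. Qed.

Section Embedding.
Variables (k : fieldType) (n : nat) (F : fieldType).
Variable io : {rmorphism kXZ k n -> F}.
Hypothesis io_inj : injective io.
Variables (d e : 'X_{1..n}) (P : kXZ k n) (Q : kXYZ k n).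
Variables (L : comNzRingType) (xz : {rmorphism kXZ k n -> L}) (y t : L).
Hypothesis pL : presented d e P Q xz y t.
Local Notation yf := (yF io d P).
Local Notation tf := (tF io d e P Q).
Local Notation x m := (xz ('X_[m] : {mpoly k[n]})%:P).

Lemma embedding : exists iota : {rmorphism L -> F},
  [/\ injective iota, forall h, iota (xz h) = io h, iota y = yf, iota t = tf &
      forall u, inA io yf tf u <-> exists a, iota a = u].
Proof.
have [iota [iz iy it]] := pres_univ pL (yFE io_inj d P) (tFE io_inj d e P Q).
have iinj : injective iota.
  apply: raddf_inj => a ia; have [m [h E]] := localize pL a.
  have := congr1 iota E; rewrite rmorphM ia mulr0 iz => /esym/eqP.
  rewrite io_eq0 // => /eqP h0; rewrite h0 rmorph0 in E.
  exact: pres_torsion pL _ _ E.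
exists iota; split; [exact: iinj | exact: iz | exact: iy | exact: it |] => u; split.
  elim=> [|c [[[a b] s] g] w _ _ [a' <-]]; first by exists 0; rewrite rmorph0.
  exists (xz (c%:MP)%:P * x a * xz 'X ^+ b * y ^+ s * t ^+ g + a').
  rewrite rmorphD morph_monomial; congr (_ + _).
  by congr (_ * _ * _ ^+ _ * _ ^+ _ * _ ^+ _);
    [exact: iz | exact: iz | exact: iz | exact: iy | exact: it].
case=> a <-; move: a; apply: (pres_gen pL) => [h||||].
- by rewrite iz; apply: inA_io.
- by rewrite iy; apply: inA_y.
- by rewrite it; apply: inA_t.
- by move=> a b Ha Hb; rewrite rmorphD; apply: inA_add.
by move=> a b Ha Hb; rewrite rmorphM; apply: inA_mul.
Qed.

Lemma xz_inj : injective xz.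
Proof.
have [iota [_ iz _ _ _]] := embedding => h h' E; apply: io_inj.
by rewrite -!iz E.
Qed.

Hypotheses (Pm : P \is monic) (Qm : Q \is monic).
Local Notation p := (size P).-1.
Local Notation q := (size Q).-1.
Hypotheses (p_gt0 : (0 < p)%N) (q_gt0 : (0 < q)%N).
Hypothesis d_gt0 : forall i, (0 < d i)%N.
Hypothesis Hv : forall j : 'I_n, exists v : F -> 'rV[rat]_n.+1,
  is_oval (ltj j) v /\ forall r : kXZ k n, r != 0 -> v (io r) = lexp j r.

(** Let X_j divide X^m.  As [r] has degree less than p in Z, neither y nor t
    occurs in the normal monomial with the value of r / X_j.  So the value of [r]
    has positive exponent in X_j, X_j divides [r], and it can be cancelled. *)
Lemma low_degree m a r : x m * a = xz r -> (size r <= p)%N -> exists r', a = xz r'.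
Proof.
have [iota [iinj iz iy it iA]] := embedding.
have [N] := ubnP (mdeg m); elim: N m a r => // N IH m a r; rewrite ltnS => mN E rp.
have [m0|m0] := eqVneq m 0%MM.
  by exists r; rewrite -E m0 mpolyX0 polyC1 rmorph1 mul1r.
have [j mj] : exists i, (0 < m i)%N.
  apply: contrapT => H; case/eqP: m0; apply/mnmP => i; rewrite mnm0E.
  by apply/eqP; rewrite -leqn0 leqNgt; apply/negP => mi; apply: H; exists i.
have [r0|r0] := eqVneq r 0.
  exists 0; rewrite rmorph0; apply: (pres_torsion pL (m := m)).
  by rewrite E r0 rmorph0.
have Em : m = (U_(j) + (m - U_(j)))%MM by rewrite addmC submK // lep1mP -lt0n.
pose a' := x (m - U_(j))%MM * a.
have Ea' : x U_(j)%MM * a' = xz r by rewrite /a' mulrA -(xzXD xz) -Em.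
have [v [ov vE]] := Hv j.
have Eu : xF io U_(j)%MM * iota a' = io r by rewrite -[io r]iz -Ea' rmorphM iz.
have u0 : iota a' != 0.
  apply: contraNneq r0 => H; move: Eu; rewrite H mulr0 => /esym/eqP.
  by rewrite io_eq0.
have Au : inA io yf tf (iota a') by apply/iA; exists a'.
have [a1 [b [c [g [_ _ xE zE]]]]] :=
  inA_form io_inj Pm Qm p_gt0 q_gt0 (yFE io_inj d P) (tFE io_inj d e P Q) ov vE (d_gt0 j) u0 Au.
have vr := vM ov (xF_neq0 io_inj U_(j)%MM) u0; rewrite Eu vE // (v_xF vE) in vr.
have [c0 g0] : c = 0%N /\ g = 0%N.
  have := lexp_size j r0; rewrite vr zexpD zexp_vmon add0r zE ler_nat => H.
  rewrite -size_poly_gt0 in r0.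
  have {}H : (b + p * c + p * q * g < p)%N.
    by apply: leq_ltn_trans H _; rewrite prednK // (leq_trans _ rp).
  split; apply/eqP; rewrite -leqn0 leqNgt; apply/negP => pos.
    by move: H; rewrite ltnNge => /negP[]; rewrite -addnA addnCA (leq_trans _ (leq_addr _ _)) // leq_pmulr.
  move: H; rewrite ltnNge => /negP[]; rewrite (leq_trans _ (leq_addl _ _)) // -mulnA leq_pmulr //.
  by rewrite muln_gt0 q_gt0.
have [s Es] : exists s : kXZ k n, r = ('X_j : {mpoly k[n]})%:P * s.
  apply: lexp_dvd r0 _; rewrite vr xexpD xexp_vmon mnm1E eqxx xE c0 g0 !mul0n !subr0.
  by rewrite -natrD ltr0n.
apply: (IH (m - U_(j))%MM a s).
- by apply: leq_trans mN; rewrite {2}Em mdegD mdeg1 add1n.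
- have X0 : x U_(j)%MM * (a' - xz s) = 0 by rewrite mulrBr Ea' Es rmorphM subrr.
  by apply/eqP; rewrite -subr_eq0; apply/eqP; apply: pres_torsion pL _ _ X0.
move: rp; rewrite Es mul_polyC size_scale // -msupp_eq0 msuppX //.
Qed.

End Embedding.

(** * Images of the variables *)

Section OneWay.
Variables (k : fieldType) (n : nat) (F : fieldType).
Variable io : {rmorphism kXZ k n -> F}.
Hypothesis io_inj : injective io.
Variables (d e1 e2 : 'X_{1..n}) (P : kXZ k n) (Q : kXYZ k n).
Hypotheses (Pm : P \is monic) (Qm : Q \is monic).
Local Notation p := (size P).-1.
Local Notation q := (size Q).-1.
Hypotheses (p_gt1 : (1 < p)%N) (q_gt1 : (1 < q)%N).
Hypotheses (d_gt0 : forall i, (0 < d i)%N) (e1_gt0 : forall i, (0 < e1 i)%N).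
Hypothesis Hv : forall j : 'I_n, exists v : F -> 'rV[rat]_n.+1,
  is_oval (ltj j) v /\ forall r : kXZ k n, r != 0 -> v (io r) = lexp j r.
Variables (L1 : comNzRingType) (xz1 : {rmorphism kXZ k n -> L1}) (y1 t1 : L1).
Hypothesis pL1 : presented d e1 P Q xz1 y1 t1.
Variables (L2 : comNzRingType) (xz2 : {rmorphism kXZ k n -> L2}) (y2 t2 : L2).
Hypothesis pL2 : presented d e2 P Q xz2 y2 t2.
Variables (f : {rmorphism L1 -> L2}) (g : {rmorphism L2 -> L1}).
Hypotheses (fK : cancel f g) (gK : cancel g f).
Hypothesis f_k : forall c : k, f (xz1 (c%:MP)%:P) = xz2 (c%:MP)%:P.

Let p_gt0 : (0 < p)%N := ltnW p_gt1.
Let q_gt0 : (0 < q)%N := ltnW q_gt1.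
Let xz1_inj : injective xz1 := xz_inj io_inj pL1.
Let xz2_inj : injective xz2 := xz_inj io_inj pL2.

(** By [x_fraction_of_constants], c f(X_j) = h with c and h in k[X], so f(X_j) is a
    fraction of degree 0 in Z whose denominator is a monomial in X; apply
    [low_degree]. *)
Lemma image_x j : exists c : {mpoly k[n]}, f (xz1 ('X_j : {mpoly k[n]})%:P) = xz2 c%:P.
Proof.
have [iota [iinj iz iy it iA]] := embedding io_inj pL1.
have [v [ov vE]] := Hv j.
pose rho : {rmorphism kXZ k n -> F} := iota \o (g \o xz2).
have g_k c : g (xz2 (c%:MP)%:P) = xz1 (c%:MP)%:P by rewrite -f_k fK.
have [||||c [h [c0 E]]] := @x_fraction_of_constants k n F io io_inj d e1 P Q Pm Qm p_gt1 q_gt1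
  _ _ (yFE io_inj d P) (tFE io_inj d e1 P Q) d_gt0 e1_gt0 j v ov vE rho.
- exact: inj_comp iinj (inj_comp (can_inj gK) xz2_inj).
- by move=> c; rewrite [LHS](congr1 iota (g_k c)) iz.
- by move=> h; apply/iA; exists (g (xz2 h)).
- move=> u /iA[a <-]; have [m [h E]] := localize pL2 (f a).
  exists 'X_[m], h; split; first by rewrite -msupp_eq0 msuppX.
  change (iota (g (xz2 ('X_[m])%:P)) * iota a = iota (g (xz2 h))).
  by rewrite -E !rmorphM fK.
have E2 : xz2 c%:P * f (xz1 ('X_j : {mpoly k[n]})%:P) = xz2 h%:P.
  rewrite -[xz2 c%:P]gK -(rmorphM f) -[RHS]gK; congr (f _); apply: iinj.
  by rewrite (rmorphM iota) iz; exact: E.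
have [m [r Er]] := localize pL2 (f (xz1 ('X_j : {mpoly k[n]})%:P)).
have Ecr : c%:P * r = ('X_[m] : {mpoly k[n]})%:P * h%:P.
  apply: xz2_inj; rewrite !(rmorphM xz2) -Er -E2.
  move: (xz2 _) (xz2 _) (f _) => A B C; ring.
have rs : (size r <= 1)%N.
  have := congr1 (fun s : {poly _} => size s) Ecr.
  rewrite /= mul_polyC size_scale // -polyCM => ->; exact: size_polyC_leq1.
have [r' Er'] := low_degree io_inj pL2 Pm Qm p_gt0 q_gt0 d_gt0 Hv Er (leq_trans rs p_gt0).
exists r'`_0; rewrite Er' -size1_polyC //.
have : ('X_[m] : {mpoly k[n]})%:P * r' = r.
  by apply: xz2_inj; rewrite (rmorphM xz2) -Er' Er.
by move=> Em; move: rs; rewrite -Em mul_polyC size_scale // -msupp_eq0 msuppX.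
Qed.

Lemma image_mpoly (c : {mpoly k[n]}) : exists c' : {mpoly k[n]}, f (xz1 c%:P) = xz2 c'%:P.
Proof.
have [F1 E1] : exists F1 : {rmorphism {mpoly k[n]} -> L2}, forall c, F1 c = f (xz1 c%:P).
  by exists (f \o (xz1 \o polyC)).
have [F2 E2] : exists F2 : {rmorphism {mpoly k[n]} -> L2}, forall c, F2 c = xz2 c%:P.
  by exists (xz2 \o polyC).
suff [c' E] : exists c', F1 c = F2 c' by exists c'; rewrite -E1 -E2.
move: c; apply: mpoly_gen => [c|j|a b [a' Ea] [b' Eb]|a b [a' Ea] [b' Eb]].
- by exists c%:MP; rewrite E1 E2; exact: f_k.
- by have [c Ec] := image_x j; exists c; rewrite E1 E2.
- by exists (a' + b'); rewrite !rmorphD Ea Eb.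
by exists (a' * b'); rewrite !rmorphM Ea Eb.
Qed.

(** Let r be f(Z) up to a monomial.  As Z is the image of its preimage, it is up
    to elements of k[X] a polynomial in r, so r has degree 1 in Z. *)
Lemma image_z : exists R : kXZ k n, size R = 2 /\ f (xz1 'X) = xz2 R.
Proof.
have [a Ea] : exists a, a = f (xz1 'X) by exists (f (xz1 'X)).
rewrite -Ea; have [m [r Er]] := localize pL2 a.
have [m' [s Es]] := localize pL1 (g (xz2 'X)).
have [M' EM] := image_mpoly 'X_[m'].
have M0 : M' != 0.
  apply: contraTneq isT => H; move: EM; rewrite H polyC0 rmorph0 => /eqP.
  rewrite -(rmorph0 f) (inj_eq (can_inj fK)) -(rmorph0 xz1) (inj_eq xz1_inj).
  by rewrite polyC_eq0 -msupp_eq0 msuppX.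
have [N [W EW]] : exists N (W : kXZ k n),
    xz2 ('X_[m] : {mpoly k[n]})%:P ^+ N * f (xz1 s) = xz2 (W \Po r).
  elim/poly_ind: (s) => [|s' c [N [W EW]]].
    by exists 0, 0; rewrite !rmorph0 mulr0.
  have [c' Ec] := image_mpoly c.
  exists N.+1, (W * 'X + ('X_[m] ^+ N.+1 * c')%:P).
  have -> : f (xz1 (s' * 'X + c%:P)) = f (xz1 s') * a + xz2 c'%:P.
    by rewrite (rmorphD xz1) (rmorphM xz1) (rmorphD f) (rmorphM f) -Ea Ec.
  rewrite comp_poly_MXaddC (rmorphD xz2) (rmorphM xz2) -EW -Er.
  rewrite polyCM (rmorphM xz2) (rmorphXn polyC) (rmorphXn xz2) exprS.
  by move: (xz2 _) (f _) (xz2 _) => X A B; ring.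
have {}EW : ('X_[m] ^+ N * M')%:P * 'X = W \Po r.
  apply: xz2_inj; rewrite -EW -Es (rmorphM f) gK EM.
  by rewrite polyCM rmorphXn !(rmorphM xz2) (rmorphXn xz2) mulrA.
have r2 : size r = 2.
  have X0 : 'X_[m] ^+ N * M' != 0 :> {mpoly k[n]}.
    by rewrite mulf_neq0 // expf_neq0 // -msupp_eq0 msuppX.
  have := congr1 (fun u : {poly _} => (size u).-1) EW.
  rewrite size_comp_poly mul_polyC size_scale // size_polyX /= => /esym/eqP.
  by rewrite muln_eq1 => /andP[_]; case: (size r) => [|[|[|]]].
have rp : (size r <= p)%N by rewrite r2.
have [R ER] := low_degree io_inj pL2 Pm Qm p_gt0 q_gt0 d_gt0 Hv Er rp.
exists R; split=> //.
have : ('X_[m] : {mpoly k[n]})%:P * R = r by apply: xz2_inj; rewrite (rmorphM xz2) -ER Er.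
by move=> Em; move: r2; rewrite -Em mul_polyC size_scale // -msupp_eq0 msuppX.
Qed.

End OneWay.

(** * Comparison of exponents *)

Lemma mpoly_mul_eq1 (k : fieldType) n (a b : {mpoly k[n]}) : a * b = 1 ->
  exists2 c, c != 0 & b = c%:MP.
Proof.
move/(@mpoly_intro_unit _ _ b a); case/andP => /eqP E u0.
by exists b@_0 => //; rewrite -unitfE.
Qed.

(** Setting X_i = 0 shows that X_i divides one of the two factors; cancel it. *)
Lemma mpoly_dvd_monomial (k : fieldType) n (m : 'X_{1..n}) (a b : {mpoly k[n]}) :
  a * b = 'X_[m] -> exists (c : k) m', c != 0 /\ b = c *: 'X_[m'].
Proof.
have [N] := ubnP (mdeg m); elim: N m a b => // N IH m a b; rewrite ltnS => mN E.
have [m0|m0] := eqVneq m 0%MM.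
  move: E; rewrite m0 mpolyX0 => /mpoly_mul_eq1[c c0 ->].
  by exists c, 0%MM; rewrite mpolyX0 -mul_mpolyC mulr1.
have [i mi] : exists i, (0 < m i)%N.
  apply: contrapT => H; case/eqP: m0; apply/mnmP => i; rewrite mnm0E.
  by apply/eqP; rewrite -leqn0 leqNgt; apply/negP => mi; apply: H; exists i.
have Em : m = (U_(i) + (m - U_(i)))%MM by rewrite addmC submK // lep1mP -lt0n.
have mN' : (mdeg (m - U_(i)) < N)%N.
  by apply: leq_trans mN; rewrite {2}Em mdegD mdeg1 add1n.
have X0 : ('X_i : {mpoly k[n]}) != 0 by rewrite -msupp_eq0 msuppX.
have /eqP : at0 k i a * at0 k i b = 0 by rewrite -rmorphM E at0_mX.
rewrite mulf_eq0 => /orP[/eqP/at0_ker[a' Ea]|/eqP/at0_ker[b' Eb]].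
  apply: (IH (m - U_(i))%MM a') mN' _; apply: (mulfI X0).
  by rewrite mulrA -Ea E {1}Em mpolyXD.
have [|c [m' [c0 E']]] := IH (m - U_(i))%MM a b' mN' _.
  by apply: (mulfI X0); rewrite mulrCA -Eb E {1}Em mpolyXD.
exists c, (U_(i) + m')%MM; split=> //.
by rewrite Eb E' mpolyXD scalerAr.
Qed.

Section NonIso.
Variables (k : fieldType) (n : nat) (F : fieldType).
Variable io : {rmorphism kXZ k n -> F}.
Hypothesis io_inj : injective io.
Variables (d e1 e2 : 'X_{1..n}) (P : kXZ k n) (Q : kXYZ k n).
Hypotheses (Pm : P \is monic) (Qm : Q \is monic).
Local Notation p := (size P).-1.
Local Notation q := (size Q).-1.
Hypotheses (p_gt1 : (1 < p)%N) (q_gt1 : (1 < q)%N).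
Hypotheses (d_gt0 : forall i, (0 < d i)%N).
Hypotheses (e1_gt0 : forall i, (0 < e1 i)%N) (e2_gt0 : forall i, (0 < e2 i)%N).
Hypothesis Hv : forall j : 'I_n, exists v : F -> 'rV[rat]_n.+1,
  is_oval (ltj j) v /\ forall r : kXZ k n, r != 0 -> v (io r) = lexp j r.
Variables (L1 : comNzRingType) (xz1 : {rmorphism kXZ k n -> L1}) (y1 t1 : L1).
Hypothesis pL1 : presented d e1 P Q xz1 y1 t1.
Variables (L2 : comNzRingType) (xz2 : {rmorphism kXZ k n -> L2}) (y2 t2 : L2).
Hypothesis pL2 : presented d e2 P Q xz2 y2 t2.
Variables (f : {rmorphism L1 -> L2}) (g : {rmorphism L2 -> L1}).
Hypotheses (fK : cancel f g) (gK : cancel g f).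
Hypothesis f_k : forall c : k, f (xz1 (c%:MP)%:P) = xz2 (c%:MP)%:P.

Let p_gt0 : (0 < p)%N := ltnW p_gt1.
Let q_gt0 : (0 < q)%N := ltnW q_gt1.
Let xz1_inj : injective xz1 := xz_inj io_inj pL1.
Let xz2_inj : injective xz2 := xz_inj io_inj pL2.

(** The degree of f(Z) being 1, the isomorphism preserves degrees in Z; applied
    to its inverse, this makes the leading coefficient of f(Z) a unit. *)
Lemma restriction : exists (s : {rmorphism {mpoly k[n]} -> {mpoly k[n]}})
    (tau : {rmorphism kXZ k n -> kXZ k n}) (l : k),
  [/\ injective s /\ forall c, s c%:MP = c%:MP, forall c, tau c%:P = (s c)%:P,
    forall h, f (xz1 h) = xz2 (tau h), forall h, size (tau h) = size h &
    l != 0 /\ forall h, h \is monic -> lead_coef (tau h) = (l ^+ (size h).-1)%:MP].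
Proof.
have g_k c : g (xz2 (c%:MP)%:P) = xz1 (c%:MP)%:P by rewrite -f_k fK.
have ix := image_x io_inj Pm Qm p_gt1 q_gt1 d_gt0 e1_gt0 Hv pL1 pL2 fK gK f_k.
have [R [R2 ER]] := image_z io_inj Pm Qm p_gt1 q_gt1 d_gt0 e1_gt0 Hv pL1 pL2 fK gK f_k.
have [R0 [R02 ER0]] := image_z io_inj Pm Qm p_gt1 q_gt1 d_gt0 e2_gt0 Hv pL2 pL1 gK fK g_k.
pose Fx j := projT1 (cid (ix j)).
have FxE j : f (xz1 ('X_j : {mpoly k[n]})%:P) = xz2 (Fx j)%:P by rewrite /Fx; case: cid.
pose s : {rmorphism {mpoly k[n]} -> {mpoly k[n]}} := comp_mpoly [tuple Fx j | j < n].
have sC c : s c%:MP = c%:MP by exact: comp_mpolyC.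
have sX j : s 'X_j = Fx j by rewrite /s /= comp_mpolyXU -tnth_nth tnth_mktuple.
pose tau : {rmorphism kXZ k n -> kXZ k n} := comp_poly R \o map_poly s.
have tauC c : tau c%:P = (s c)%:P by rewrite /tau /= map_polyC comp_polyC.
have tauX : tau 'X = R by rewrite /tau /= map_polyX comp_polyX.
have fE h : f (xz1 h) = xz2 (tau h).
  move: h; apply: (@poly_morph_ext _ _ (f \o xz1) (xz2 \o tau)) => [c|]; last first.
    by rewrite [LHS]ER [RHS](congr1 xz2 tauX).
  rewrite [RHS](congr1 xz2 (tauC c)).
  move: c; apply: (@mpoly_morph_ext _ _ _ (f \o (xz1 \o polyC)) (xz2 \o (polyC \o s))) => [c|j].
    by rewrite [RHS](congr1 (fun u => xz2 u%:P) (sC c)); exact: f_k.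
  by rewrite [RHS](congr1 (fun u => xz2 u%:P) (sX j)); exact: FxE.
have s_inj : injective s.
  apply: raddf_inj => c sc; have := fE c%:P; rewrite tauC sc polyC0 rmorph0 => /eqP.
  rewrite -(rmorph0 f) (inj_eq (can_inj fK)) -(rmorph0 xz1) (inj_eq xz1_inj).
  by rewrite polyC_eq0 => /eqP.
have ER1 : map_poly s R0 \Po R = 'X.
  by apply: xz2_inj; rewrite -[LHS]fE -ER0 gK.
have [l l0 lR] : exists2 l, l != 0 & lead_coef R = l%:MP.
  have := congr1 (@lead_coef _) ER1; rewrite lead_coef_comp ?R2 // lead_coefX.
  rewrite size_map_inj_poly ?rmorph0 // R02 expr1.
  exact: mpoly_mul_eq1.
exists s, tau, l; split=> //.
  by move=> h; rewrite /tau /= size_comp_poly2 // size_map_inj_poly ?rmorph0.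
split=> // h hm.
rewrite /tau /= lead_coef_comp ?R2 // lead_coef_map_inj ?rmorph0 //.
by rewrite (monicP hm) rmorph1 mul1r lR size_map_inj_poly ?rmorph0 // rmorphXn.
Qed.

(** Injectivity of s prevents the image of X_j from being constant, so the
    total degree does not decrease. *)
Lemma monomial_images (s : {rmorphism {mpoly k[n]} -> {mpoly k[n]}}) :
  injective s -> (forall c, s c%:MP = c%:MP) ->
  (forall j, exists (c : k) m, c != 0 /\ s 'X_j = c *: 'X_[m]) ->
  exists D : 'X_{1..n} -> 'X_{1..n}, (forall a, (mdeg a <= mdeg (D a))%N) /\
    forall a, exists2 c : k, c != 0 & s 'X_[a] = c *: 'X_[D a].
Proof.
move=> s_inj sC sX.
have /choice[M MP] : forall j, exists m, (0 < mdeg m)%N /\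
    exists2 c : k, c != 0 & s 'X_j = c *: 'X_[m].
  move=> j; have [c [m [c0 E]]] := sX j.
  exists m; split; last by exists c.
  rewrite lt0n mdeg_eq0; apply: contraNneq c0 => m0.
  have /s_inj : s 'X_j = s c%:MP by rewrite sC E m0 mpolyX0 -mul_mpolyC mulr1.
  move/(congr1 (mcoeff U_(j))); rewrite mcoeffX eqxx mcoeffC mnm1_eq0 mulr0.
  by move/eqP; rewrite oner_eq0.
exists (fun a => \big[mnm_add/0%MM]_(j < n) (M j *+ a j)%MM); split=> a.
  rewrite mdegE mdeg_sum; apply: leq_sum => j _.
  by rewrite mdegMn; have [Mj _] := MP j; rewrite leq_pmull.
rewrite mpolyXE_id rmorph_prod /=.
elim/big_ind2: _ => [|b m b' m' [c c0 ->] [c' c'0 ->]|j _].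
- by exists 1; rewrite ?oner_neq0 // mpolyX0 scale1r.
- exists (c * c'); first by rewrite mulf_neq0.
  by rewrite mpolyXD -scalerAl -scalerAr scalerA.
have [_ [c c0 E]] := MP j; exists (c ^+ a j); first by rewrite expf_neq0.
by rewrite rmorphXn /= E exprZn mpolyXn.
Qed.

(** The exponents in Z of the images of y1 and t1 are p and p q: the normal
    monomials with these exponents are X^a y and X^a t. *)
Let z_exponent1 (b c h : nat) : (b < p)%N -> (b + p * c + p * q * h)%N = p ->
  [/\ b = 0, c = 1 & h = 0]%N.
Proof.
move: p q p_gt1 q_gt1 => p' q' p1 q1 bp E.
have h0 : h = 0%N by case: h E => // h E; nia.
have c1 : c = 1%N by case: c E => [|[|c]] E //; nia.
by split=> //; nia.
Qed.

Let z_exponent2 (b c h : nat) : (b < p)%N -> (c < q)%N ->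
  (b + p * c + p * q * h)%N = (p * q)%N -> [/\ b = 0, c = 0 & h = 1]%N.
Proof.
move: p q p_gt1 q_gt1 => p' q' p1 q1 bp cq E.
have h1 : h = 1%N.
  case: h E => [|[|h]] E //; last by nia.
  have : (p' * c + p' <= p' * q')%N by rewrite -mulnSr leq_mul2l cq orbT.
  by lia.
by split=> //; nia.
Qed.

(** If X^a goes to X^(D a), the value of the image of y1 is that of Z^p / X^(D d),
    and it is also the value of some X^a y2; hence D d <= d, and D d = d since D
    does not lower the total degree.  In the same way the value of the image of
    t1 is that of some X^a t2, whence D e1 <= e2. *)
Lemma mdeg_le : (0 < n)%N -> (mdeg e1 <= mdeg e2)%N.
Proof.
move=> n_gt0; have [s [tau [l [[s_inj sC] tauC fE size_tau [l0 lead_tau]]]]] := restriction.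
have lead_tauP := lead_tau P Pm.
have lp0 : l ^+ p != 0 by rewrite expf_neq0.
have fy : xz2 (s 'X_[d])%:P * f y1 = xz2 (tau P).
  transitivity (f (xz1 ('X_[d] : {mpoly k[n]})%:P * y1)).
    by rewrite (rmorphM f) fE tauC.
  by rewrite (pres_y pL1) fE.
(* y1 is sent to tau P / s X^d, which X^m turns into a polynomial r: comparing
     leading coefficients, s X^d, hence s X_j, divides the monomial X^m. *)
have sX j : exists (c : k) m, c != 0 /\ s 'X_j = c *: 'X_[m].
  have [m [r Er]] := localize pL2 (f y1).
  have E1 : (s 'X_[d])%:P * r = ('X_[m] : {mpoly k[n]})%:P * tau P.
    apply: xz2_inj; rewrite !(rmorphM xz2) -Er -fy.
    by move: (xz2 _) (xz2 _) (f _) => A B C; ring.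
  have := congr1 (@lead_coef _) E1; rewrite !lead_coefM !lead_coefC lead_tauP => E2.
  have Ed : s 'X_[d] = s 'X_[d - U_(j)] * s 'X_j.
    by rewrite -rmorphM -mpolyXD submK // lep1mP -lt0n.
  apply: (@mpoly_dvd_monomial k n m (lead_coef r * (l ^+ p)^-1%:MP * s 'X_[d - U_(j)])).
  by rewrite -[LHS]mulrA -Ed mulrC mulrA E2 -mulrA -mpolyCM divff // mpolyC1 mulr1.
have [D [mdegD' sD]] := monomial_images s_inj sC sX.
have [iota [iinj iz iy it iA]] := embedding io_inj pL2.
have [v [ov vE]] := Hv (Ordinal n_gt0).
set j := Ordinal n_gt0 in v ov vE.
have v_s a : io (s 'X_[a])%:P != 0 /\ v (io (s 'X_[a])%:P) = vmon (D a, 0%N).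
  have [c c0 ->] := sD a; have cc0 : io (c%:MP)%:P != 0.
    by rewrite io_eq0 // polyC_eq0 mpolyC_eq0.
  have -> : io (c *: 'X_[D a])%:P = io (c%:MP)%:P * xF io (D a).
    by rewrite -mul_mpolyC polyCM (rmorphM io).
  split; first exact: mulf_neq0 cc0 (xF_neq0 io_inj (D a)).
  rewrite (vM ov cc0 (xF_neq0 io_inj (D a))) (v_xF vE).
  by rewrite vE ?polyC_eq0 ?mpolyC_eq0 // lexpC // add0r.
have e2j := e2_gt0 j; have form := inA_form io_inj Pm Qm p_gt0 q_gt0
   (yFE io_inj d P) (tFE io_inj d e2 P Q) ov vE (d_gt0 j).
have tauP0 : tau P != 0 by rewrite -size_poly_eq0 size_tau size_poly_eq0 monic_neq0.
pose u := iota (f y1); pose w := iota (f t1).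
have Eu : io (s 'X_[d])%:P * u = io (tau P).
  by have := congr1 iota fy; rewrite (rmorphM iota) !iz.
have u0 : u != 0.
  apply: contraNneq tauP0 => H; move: Eu; rewrite H mulr0 => /esym/eqP.
  by rewrite io_eq0.
have vu : v u = vmon (0%MM, p) - vmon (D d, 0%N).
  have [sd0 vs] := v_s d; have := vM ov sd0 u0; rewrite Eu vs vE //.
  rewrite (lexp_monic j lp0 lead_tauP) size_tau => ->.
  by rewrite addrC addKr.
have Au : inA io (yF io d P) (tF io d e2 P Q) u by apply/iA; exists (f y1).
have Dd : D d = d.
  have [a [b [c [g1 [bp cq xE zE]]]]] := form u u0 Au.
  have [b0 c1 g0] : [/\ b = 0, c = 1 & g1 = 0]%N.
    apply: z_exponent1 bp _; apply/eqP; rewrite -(eqr_nat rat) -zE vu.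
    by rewrite zexpD zexpN !zexp_vmon subr0.
  have le i : (D d i <= d i)%N.
    have := xE i; rewrite vu xexpD xexpN !xexp_vmon c1 g0 mul1n mul0n subr0 /= mnm0E sub0r.
    move=> H; have {}H : (d i)%:R = (a i)%:R + (D d i)%:R :> rat by lra.
    by move: H; rewrite -natrD => /eqP; rewrite eqr_nat => /eqP ->; apply: leq_addl.
  have Ed : d = (D d + (d - D d))%MM by rewrite addmC submK //; apply/mnm_lepP.
  have := mdegD' d; rewrite {1}Ed mdegD -[X in (_ <= X)%N]addn0 leq_add2l leqn0 mdeg_eq0.
  by move/eqP => H; rewrite {2}Ed H addm0.
pose Q' := map_poly tau Q.
have Q'm : Q' \is monic by exact: monic_map.
have sQ' : size Q' = size Q.
  apply: size_map_poly_id0; rewrite (monicP Qm) (rmorph1 tau); exact: oner_neq0.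
have Ew : io (s 'X_[e1])%:P * w = evQ io Q' u.
  have := congr1 (iota \o f) (pres_t pL1); rewrite /= !rmorphM fE iz tauC => ->.
  rewrite /evQ /Q' /u -map_poly_comp -horner_map -horner_map /= -!map_poly_comp.
  by congr (_.[_]); apply: eq_map_poly => h /=; rewrite fE iz.
have xu : xexp j (v u) = - (d j)%:R.
  by rewrite vu xexpD xexpN !xexp_vmon Dd mnm0E sub0r.
have xu0 : xexp j (v u) < 0 by rewrite xu oppr_lt0 ltr0n.
have [Qu0 vQu] := v_horner io_inj ov vE Q'm u0 xu0.
have w0 : w != 0 by apply: contraNneq Qu0 => H; rewrite -Ew H mulr0.
have vw : v w = v u *+ q - vmon (D e1, 0%N).
  have [sd0 vs] := v_s e1; have := vM ov sd0 w0; rewrite Ew vs vQu sQ' => ->.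
  by rewrite addrC addKr.
have Aw : inA io (yF io d P) (tF io d e2 P Q) w by apply/iA; exists (f t1).
have [a [b [c [g1 [bp cq xE zE]]]]] := form w w0 Aw.
have [b0 c0 g11] : [/\ b = 0, c = 0 & g1 = 1]%N.
  apply: z_exponent2 bp cq _; apply/eqP; rewrite -(eqr_nat rat) -zE vw vu.
  by rewrite zexpD zexpN zexpMn zexpD zexpN !zexp_vmon !subr0 natrM mulr_natr.
apply: leq_trans (mdegD' e1) _; rewrite !mdegE; apply: leq_sum => i _.
have := xE i; rewrite vw vu xexpD xexpN xexpMn xexpD xexpN !xexp_vmon Dd c0 g11.
rewrite mul0n mul1n subr0 /= mnm0E sub0r -mulr_natr natrD natrM => H.
have {}H : (e2 i)%:R = (a i)%:R + (D e1 i)%:R :> rat by lra.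
by move: H; rewrite -natrD => /eqP; rewrite eqr_nat => /eqP ->; apply: leq_addl.
Qed.

End NonIso.

(** * Shifting Z *)

Lemma horner_map_MXaddC (A R : comNzRingType) (f : {rmorphism A -> R}) (q : {poly A}) a Y :
  (map_poly f (q * 'X + a%:P)).[Y] = (map_poly f q).[Y] * Y + f a.
Proof.
by rewrite rmorphD rmorphM /= map_polyX map_polyC hornerD hornerM hornerX hornerC.
Qed.

Section Shift.
Variables (A R : comNzRingType) (r r' : {rmorphism {poly A} -> R}) (h : R).
Hypothesis r'C : forall c, r' c%:P = r c%:P.
Hypothesis r'X : r' 'X = r 'X + h.

Lemma shift_taylor p : exists c, r' p = r p + h * r p^`() + h ^+ 2 * c.
Proof.
elim/poly_ind: p => [|p a [c E]].
  by exists 0; rewrite deriv0 !rmorph0 !mulr0 !addr0.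
exists (c * (r 'X + h) + r p^`()).
rewrite derivD derivM derivX derivC addr0 mulr1.
rewrite !(rmorphD r) !(rmorphD r') !(rmorphM r) !(rmorphM r') r'C r'X E.
move: (r p) (r p^`()) (r 'X) (r a%:P) => u u' z b; ring.
Qed.

(** Taylor expansion in both variables; the coefficients of [q] are shifted
    by [h] and its argument by [h1]. *)
Lemma shift_taylor2 (q : {poly {poly A}}) (y h1 : R) : exists c1 c2,
  (map_poly r' q).[y + h1] =
  (map_poly r q).[y] + h1 * (map_poly r q^`()).[y] + h1 ^+ 2 * c1 + h * c2.
Proof.
elim/poly_ind: q => [|q a [c1 [c2 E]]].
  by exists 0, 0; rewrite deriv0 !rmorph0 !horner0 !mulr0 !addr0.
have [c Ea] := shift_taylor a.
exists (c1 * (y + h1) + (map_poly r q^`()).[y]), (c2 * (y + h1) + r a^`() + h * c).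
rewrite derivD derivM derivX derivC addr0 mulr1.
rewrite !horner_map_MXaddC E Ea rmorphD hornerD.
have -> : (map_poly r (q^`() * 'X)).[y] = (map_poly r q^`()).[y] * y.
  by rewrite rmorphM /= map_polyX hornerM hornerX.
move: (map_poly r q).[y] (map_poly r q^`()).[y] (r a) (r a^`()) => u u' b b'; ring.
Qed.

End Shift.

Lemma shifted (A R : comNzRingType) (r : {rmorphism {poly A} -> R}) (h : R) :
  exists r' : {rmorphism {poly A} -> R}, (forall c, r' c%:P = r c%:P) /\ r' 'X = r 'X + h.
Proof.
exists (horner_eval (r 'X + h) \o map_poly (r \o polyC)); split=> [c|] /=.
  by rewrite map_polyC /horner_eval hornerC.
by rewrite map_polyX /horner_eval hornerX.
Qed.

Section Modification.
Variables (k : fieldType) (n : nat) (d e : 'X_{1..n}) (P : kXZ k n) (Q : kXYZ k n).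
Hypotheses (d_gt0 : forall i, (0 < d i)%N) (e_gt0 : forall i, (0 < e i)%N).
Definition ones : 'X_{1..n} := [multinom 1%N | i < n].

Lemma split_ones (m : 'X_{1..n}) : (forall i, (0 < m i)%N) ->
  exists m', m = (ones + m')%MM.
Proof.
move=> m_gt0; exists (m - ones)%MM; rewrite addmC submK //.
by apply/mnm_lepP => i; rewrite mnmE.
Qed.

Section Shifting.
Variables (R : comNzRingType) (r : {rmorphism kXZ k n -> R}) (y t W : R).
Local Notation x m := (r ('X_[m] : {mpoly k[n]})%:P).
Hypotheses (yE : x d * y = r P) (tE : x e * t = (map_poly r Q).[y]).

Let xD m m' : x (m + m')%MM = x m * x m'.
Proof. by rewrite mpolyXD polyCM rmorphM. Qed.

(** Z moves by X^(d+e) W, so y moves by X^e W P' up to multiples of X^(d+e), and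
    then t by W P' Q' up to multiples of X. *)
Lemma shift_solution : exists (r' : {rmorphism kXZ k n -> R}) (y1 t1 c : R),
  [/\ forall a, r' a%:P = r a%:P, r' 'X = r 'X + x d * x e * W,
    x d * y1 = r' P /\ x e * t1 = (map_poly r' Q).[y1],
    t1 = t + W * (r P^`() * (map_poly r Q^`()).[y]) + x ones * c &
    forall G, exists c', (map_poly r' G).[y1] = (map_poly r G).[y] + x ones * c'].
Proof.
have [r' [r'C r'X]] := shifted r (x d * x e * W).
have [c Ec] := shift_taylor r'C r'X P.
have [H HE] : exists H, H = W * r P^`() + x d * x e * W ^+ 2 * c by eexists.
have [c1 [c2 Ec2]] := shift_taylor2 r'C r'X Q y (x e * H).
have [d' Ed] := split_ones d_gt0; have [e' Ee] := split_ones e_gt0.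
have xd : x d = x ones * x d' by rewrite -(xD ones d') -Ed.
have xe : x e = x ones * x e' by rewrite -(xD ones e') -Ee.
exists r', (y + x e * H),
  (t + H * (map_poly r Q^`()).[y] + x e * H ^+ 2 * c1 + x d * W * c2),
  (x d' * x e * W ^+ 2 * c * (map_poly r Q^`()).[y] + x e' * H ^+ 2 * c1 + x d' * W * c2).
split=> //.
- split; first by rewrite Ec -yE HE; move: (x d) (x e) (r P^`()) => X X' P'; ring.
  by rewrite Ec2 -tE; move: (x d) (x e) (_.[y]) => X X' Q'; ring.
- rewrite HE; move: (_.[y]) (r P^`()) xd xe => Q' P' -> ->.
  move: (x ones) (x d') (x e') => X0 X1 X2; ring.
move=> G; have [c3 [c4 ->]] := shift_taylor2 r'C r'X G y (x e * H).
exists (x e' * H * (map_poly r G^`()).[y] + x e' * H * (x e * H) * c3 + x d' * x e * W * c4).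
move: (map_poly r G).[y] (map_poly r G^`()).[y] xd xe => u u' -> ->.
move: (x ones) (x d') (x e') => X0 X1 X2; ring.
Qed.

End Shifting.
End Modification.

(** * Invertibility modulo the product of the variables *)

(** An ideal comaximal with each x i is comaximal with their product. *)
Lemma comaximal_prod (A : comNzRingType) (M p q : A) (I : Type) (x : I -> A) (s : seq I) :
  (forall i, exists G a b c, 1 = G * M + a * p + b * q + x i * c) ->
  exists G a b c, 1 = G * M + a * p + b * q + (\prod_(i <- s) x i) * c.
Proof.
move=> H; elim: s => [|i s [G2 [a2 [b2 [c2 E2]]]]].
  by exists 0, 0, 0, 1; rewrite big_nil; ring.
have [G1 [a1 [b1 [c1 E1]]]] := H i.
exists (G1 + x i * c1 * G2), (a1 + x i * c1 * a2), (b1 + x i * c1 * b2), (c1 * c2).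
rewrite big_cons; move: (\prod_(_ <- _) _) E2 => X E2.
by rewrite {1}E1 -[x i * c1]mulr1 {1}E2; ring.
Qed.

(** p' is invertible modulo (p, x), and q' modulo (p, q, x). *)
Lemma comaximal_step (A : comNzRingType) (p q p' q' x a b c a' b' c' s : A) :
  1 = a * p + b * p' + x * c -> 1 = a' * p + b' * q + c' * q' + x * s ->
  exists G u w v, 1 = G * (p' * q') + u * p + w * q + x * v.
Proof.
move=> E1 E2.
exists (b * c'), (a + b * p' * a'), (b * p' * b'), (c + b * p' * s).
by rewrite {1}E1 -[b * p']mulr1 {1}E2; ring.
Qed.

Section UnitMod.
Variables (k : fieldType) (n : nat) (P : kXZ k n) (Q : kXYZ k n).
Hypothesis P_cond : forall i : 'I_n, ideal_gen [:: at0Z k i P; at0Z k i P^`()] =i predT.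
Hypothesis Q_cond : forall i : 'I_n,
  ideal_gen [:: (at0Z k i P)%:P; at0YZ k i Q; at0YZ k i Q^`()] =i predT.

Lemma unit_mod_x (i : 'I_n) : exists G a b c : kXYZ k n,
  1 = G * ((P^`())%:P * Q^`()) + a * P%:P + b * Q + ('X_i : {mpoly k[n]})%:P%:P * c.
Proof.
have [a [b [c E1]]] : exists a b c : kXZ k n,
    1 = a * P + b * P^`() + ('X_i : {mpoly k[n]})%:P * c.
  have : 1 \in ideal_gen [:: at0Z k i P; at0Z k i P^`()] by rewrite P_cond.
  case/asboolP => u; rewrite !big_ord_recl big_ord0 /= addr0 => E.
  have [a Ea] := at0Z_surj i (u ord0); have [b Eb] := at0Z_surj i (u (lift ord0 ord0)).
  have /at0Z_ker[c Ec] : at0Z k i (1 - (a * P + b * P^`())) = 0.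
    by rewrite rmorphB rmorph1 rmorphD !rmorphM Ea Eb {1}E subrr.
  by exists a, b, c; rewrite -Ec addrC subrK.
have [a' [b' [c' [s E2]]]] : exists a' b' c' s : kXYZ k n,
    1 = a' * P%:P + b' * Q + c' * Q^`() + ('X_i : {mpoly k[n]})%:P%:P * s.
  have : 1 \in ideal_gen [:: (at0Z k i P)%:P; at0YZ k i Q; at0YZ k i Q^`()] by rewrite Q_cond.
  case/asboolP => u; rewrite !big_ord_recl big_ord0 /= addr0 => E.
  have [a' Ea] := at0YZ_surj i (u ord0).
  have [b' Eb] := at0YZ_surj i (u (lift ord0 ord0)).
  have [c' Ec] := at0YZ_surj i (u (lift ord0 (lift ord0 ord0))).
  have /at0YZ_ker[s Es] : at0YZ k i (1 - (a' * P%:P + b' * Q + c' * Q^`())) = 0.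
    rewrite rmorphB rmorph1 !rmorphD !rmorphM Ea Eb Ec at0YZC.
    by rewrite {1}E addrA subrr.
  by exists a', b', c', s; rewrite -Es addrC subrK.
apply: (@comaximal_step _ P%:P Q (P^`())%:P Q^`() ('X_i)%:P%:P a%:P b%:P c%:P a' b' c' s _ E2).
by rewrite -!polyCM -!polyCD -E1.
Qed.

Lemma unit_mod_ones : exists G a b c : kXYZ k n,
  1 = G * ((P^`())%:P * Q^`()) + a * P%:P + b * Q + ('X_[ones n] : {mpoly k[n]})%:P%:P * c.
Proof.
have [G [a [b [c E]]]] := comaximal_prod (index_enum 'I_n) unit_mod_x.
exists G, a, b, c; rewrite {1}E; congr (_ + _ * _).
rewrite mpolyXE_id !rmorph_prod; apply: eq_bigr => i _.
by rewrite mnmE expr1.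
Qed.

End UnitMod.

Section PresentedMore.
Variables (k : fieldType) (n : nat) (d e : 'X_{1..n}) (P : kXZ k n) (Q : kXYZ k n).
Variables (L : comNzRingType) (xz : {rmorphism kXZ k n -> L}) (y t : L).
Hypothesis pL : presented d e P Q xz y t.
Local Notation x m := (xz ('X_[m] : {mpoly k[n]})%:P).

Lemma horner_map_comp (S : comNzRingType) (f : {rmorphism L -> S})
    (r : {rmorphism kXZ k n -> S}) (q : kXYZ k n) (u : L) :
  (forall h, f (xz h) = r h) -> f (map_poly xz q).[u] = (map_poly r q).[f u].
Proof.
move=> fr; rewrite -horner_map -map_poly_comp; congr (_.[_]).
exact: eq_map_poly.
Qed.

Lemma hom_ext_torsion_free (S : comNzRingType) (f g : {rmorphism L -> S}) :
  (forall m a, f (x m) * a = 0 -> a = 0) -> (forall h, f (xz h) = g (xz h)) -> f =1 g.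
Proof.
move=> tf fg.
have cancel_x m a b : f (x m) * a = f (x m) * b -> a = b.
  move=> E; apply/eqP; rewrite -subr_eq0; apply/eqP; apply: (tf m).
  by rewrite mulrBr E subrr.
have fgy : f y = g y.
  apply: (cancel_x d); rewrite -(rmorphM f) (pres_y pL) fg -(pres_y pL).
  by rewrite (rmorphM g) fg.
apply: (pres_hom_ext pL fg fgy); apply: (cancel_x e).
rewrite -(rmorphM f) (pres_t pL) [RHS](congr1 (fun u => u * g t) (fg _)) -(rmorphM g) (pres_t pL).
by rewrite (horner_map_comp (r := g \o xz) Q y fg) (horner_map_comp (r := g \o xz) Q y) // fgy.
Qed.

Lemma poly_torsion_free m (a : {poly L}) : (x m)%:P * a = 0 -> a = 0.
Proof.
move=> E; apply/polyP => i; rewrite coef0; apply: (pres_torsion pL (m := m)).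
by rewrite -coefCM E coef0.
Qed.

Hypotheses (d_gt0 : forall i, (0 < d i)%N) (e_gt0 : forall i, (0 < e i)%N).

(** P and Q become divisible by X in the presented ring. *)
Lemma unit_mod_pres (G a b c : kXYZ k n) :
  1 = G * ((P^`())%:P * Q^`()) + a * P%:P + b * Q + ('X_[ones n] : {mpoly k[n]})%:P%:P * c ->
  exists c', 1 = (map_poly xz G).[y] * (xz P^`() * (map_poly xz Q^`()).[y]) + x (ones n) * c'.
Proof.
pose ev : {rmorphism kXYZ k n -> L} := horner_eval y \o map_poly xz.
have evC h : ev h%:P = xz h by rewrite /ev /= map_polyC /horner_eval hornerC.
move=> /(congr1 ev); rewrite rmorph1 !(rmorphD ev) !(rmorphM ev) !evC => E.
have [d' Ed] := split_ones d_gt0; have [e' Ee] := split_ones e_gt0.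
have evQ : ev Q = x (ones n) * (x e' * t).
  by rewrite mulrA -xzXD -Ee [RHS](pres_t pL).
have evP : xz P = x (ones n) * (x d' * y) by rewrite mulrA -xzXD -Ed [RHS](pres_y pL).
exists (ev a * (x d' * y) + ev b * (x e' * t) + ev c).
rewrite {1}E evP evQ -/(ev G) -/(ev _).
rewrite -[(map_poly xz G).[y]]/(ev G) -[(map_poly xz Q^`()).[y]]/(ev Q^`()).
move: (ev _) (ev _) (ev a) (ev b) (ev c) (xz _) (x _) (x _) (x _) => G' Q' a' b' c' P' X X' X''.
ring.
Qed.

End PresentedMore.

(** * The isomorphism of polynomial rings *)

Lemma poly_hom (R S : comNzRingType) (f : {rmorphism R -> S}) (u : S) :
  exists g : {rmorphism {poly R} -> S}, (forall c, g c%:P = f c) /\ g 'X = u.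
Proof.
exists (horner_eval u \o map_poly f); split=> [c|] /=.
  by rewrite map_polyC /horner_eval hornerC.
by rewrite map_polyX /horner_eval hornerX.
Qed.

Lemma mul_swap (R : comNzRingType) (a b c : R) : a * b * c = b * (a * c).
Proof. by rewrite mulrCA mulrA. Qed.

(** With m = P' Q' and its inverse g modulo X, the image of g t is congruent to
    V modulo X. *)
Lemma correction_psi (R : comNzRingType) (X g m s t V c1 c2 t1 : R) :
  1 = g * m + X * s -> t1 = X * t + V * m + X * c1 ->
  X * (g * t + g * c1 + c2 * t1 - V * s) = (g + X * c2) * t1 - V.
Proof.
move=> E Et; apply/eqP; rewrite -subr_eq0.
have -> : X * (g * t + g * c1 + c2 * t1 - V * s) - ((g + X * c2) * t1 - V) =
    g * (X * t + V * m + X * c1 - t1) + V * (1 - (g * m + X * s)) by ring.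
by rewrite -E -Et !subrr !mulr0 addr0.
Qed.

(** With the shift by X V - g t, the image of t is congruent to t (1 - g m), hence
    to 0, modulo X. *)
Lemma correction_phi (R : comNzRingType) (X g m s t V c t2 : R) :
  1 = g * m + X * s -> t2 = t + (X * V - g * t) * m + X * c ->
  t2 = X * (s * t + V * m + c).
Proof.
move=> E ->; apply/eqP; rewrite -subr_eq0.
have -> : t + (X * V - g * t) * m + X * c - X * (s * t + V * m + c) =
    t * (1 - (g * m + X * s)) by ring.
by rewrite -E subrr mulr0.
Qed.

Lemma back_of_shift (R S : comNzRingType) (h : {rmorphism R -> S})
    (Z D E V : R) (Z' D' E' X' V' g : S) :
  h Z = Z' + D' * E' * (X' * V' - g) -> h D = D' -> h E = E' ->
  h V = g - X' * V' -> h (Z + D * E * V) = Z'.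
Proof.
by move=> hZ hD hE hV; rewrite rmorphD !rmorphM hZ hD hE hV; ring.
Qed.

Lemma shift_of_back (R S : comNzRingType) (f : {rmorphism R -> S})
    (Z D E X V g : R) (Z' D' E' X' V' v g' : S) :
  f Z = Z' + D' * E' * V' -> f D = D' -> f E = E' -> f X = X' -> f V = v ->
  f g = g' -> X' * v = g' - V' -> f (Z + D * E * (X * V - g)) = Z'.
Proof.
move=> fZ fD fE fX fV fg E1.
by rewrite rmorphD !rmorphM rmorphB rmorphM fZ fD fE fX fV fg E1; ring.
Qed.

Section ShiftPoly.
Variables (k : fieldType) (n : nat) (d e : 'X_{1..n}) (P : kXZ k n) (Q : kXYZ k n).
Hypotheses (d_gt0 : forall i, (0 < d i)%N) (e_gt0 : forall i, (0 < e i)%N).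
Variables (M : comNzRingType) (r : {rmorphism kXZ k n -> M}) (y t : M).
Local Notation x m := (r ('X_[m] : {mpoly k[n]})%:P).
Hypotheses (yE : x d * y = r P) (tE : x e * t = (map_poly r Q).[y]).

Lemma constant_horner (G : kXYZ k n) (u : M) :
  (map_poly (polyC \o r) G).[u%:P] = ((map_poly r G).[u])%:P.
Proof. by rewrite map_poly_comp /= horner_map. Qed.

Lemma shift_poly (W : {poly M}) :
  exists (r1 : {rmorphism kXZ k n -> {poly M}}) (y1 t1 c : {poly M}),
  [/\ forall a, r1 a%:P = (r a%:P)%:P, r1 'X = (r 'X)%:P + (x d)%:P * (x e)%:P * W,
   (x d)%:P * y1 = r1 P /\ (x e)%:P * t1 = (map_poly r1 Q).[y1],
   t1 = t%:P + W * (r P^`() * (map_poly r Q^`()).[y])%:P + (x (ones n))%:P * c &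
   forall G, exists c', (map_poly r1 G).[y1] =
     ((map_poly r G).[y])%:P + (x (ones n))%:P * c'].
Proof.
pose r0 : {rmorphism kXZ k n -> {poly M}} := polyC \o r.
have r0y : r0 ('X_[d])%:P * y%:P = r0 P by rewrite -[LHS](polyCM _ y) yE.
have r0t : r0 ('X_[e])%:P * t%:P = (map_poly r0 Q).[y%:P].
  by rewrite constant_horner -tE -[LHS](polyCM _ t).
have [r1 [y1 [t1 [c1 [r1C r1X y1E t1E r1G]]]]] := shift_solution d_gt0 e_gt0 W r0y r0t.
exists r1, y1, t1, c1; split=> //.
  by rewrite t1E constant_horner polyCM.
by move=> G; have [c' ->] := r1G G; exists c'; rewrite constant_horner.
Qed.
End ShiftPoly.

Section Stable.
Variables (k : fieldType) (n : nat) (d e : 'X_{1..n}) (P : kXZ k n) (Q : kXYZ k n).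
Hypotheses (d_gt0 : forall i, (0 < d i)%N) (e_gt0 : forall i, (0 < e i)%N).
Hypothesis P_cond : forall i : 'I_n, ideal_gen [:: at0Z k i P; at0Z k i P^`()] =i predT.
Hypothesis Q_cond : forall i : 'I_n,
  ideal_gen [:: (at0Z k i P)%:P; at0YZ k i Q; at0YZ k i Q^`()] =i predT.
Let e' := (ones n + e)%MM.
Variables (L : comNzRingType) (xz : {rmorphism kXZ k n -> L}) (y t : L).
Hypothesis pL : presented d e P Q xz y t.
Variables (L' : comNzRingType) (xz' : {rmorphism kXZ k n -> L'}) (y' t' : L').
Hypothesis pL' : presented d e' P Q xz' y' t'.

Let e'_gt0 i : (0 < e' i)%N.
Proof. by rewrite /e' mnmDE mnmE. Qed.

Local Notation x m := (xz ('X_[m] : {mpoly k[n]})%:P).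
Local Notation x' m := (xz' ('X_[m] : {mpoly k[n]})%:P).

(** In L' the role of t is played by x (ones n) * t'.
    That the two morphisms are inverse to each other is checked on k[X, Z] and
    extends by [hom_ext_torsion_free]. *)
Theorem stable_iso : exists (f : {rmorphism {poly L} -> {poly L'}}) (g : {rmorphism {poly L'} -> {poly L}}),
  [/\ cancel f g, cancel g f & forall c : {mpoly k[n]}, f (xz c%:P)%:P = (xz' c%:P)%:P].
Proof.
have [G [a0 [b0 [c0 EG]]]] := unit_mod_ones P_cond Q_cond.
have [s Es] := unit_mod_pres pL d_gt0 e_gt0 EG.
have [s' Es'] := unit_mod_pres pL' d_gt0 e'_gt0 EG.
have [g gE] : exists g, g = (map_poly xz G).[y] by eexists.
have [g' g'E] : exists g, g = (map_poly xz' G).[y'] by eexists.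
have [m mE] : exists m, m = xz P^`() * (map_poly xz Q^`()).[y] by eexists.
have [m' m'E] : exists m, m = xz' P^`() * (map_poly xz' Q^`()).[y'] by eexists.
rewrite -gE -mE in Es; rewrite -g'E -m'E in Es'.
have xe' u : x' e' * u = x' e * (x' (ones n) * u).
  by rewrite /e' xzXD; exact: mul_swap.
have xe'L : x e' = x (ones n) * x e by rewrite -xzXD.
have t'E : x' e * (x' (ones n) * t') = (map_poly xz' Q).[y'].
  by rewrite -xe' (pres_t pL').
(* psi : L -> L'[V'], where W = V' and t1 is congruent to V' P' Q' modulo X. *)
have [r1 [y1 [t1 [c1 [r1C r1X [y1E t1E] t1F r1G]]]]] :=
  shift_poly d_gt0 e_gt0 (pres_y pL') t'E 'X.
have [psi [psiz psiy psit]] : exists psi : {rmorphism L -> {poly L'}},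
    [/\ forall h, psi (xz h) = r1 h, psi y = y1 & psi t = t1].
  by apply: (pres_univ pL); rewrite r1C.
have [c2 psig] := r1G G; rewrite -g'E in psig; rewrite -m'E in t1F.
have psigE : psi g = (map_poly r1 G).[y1].
  by rewrite gE (horner_map_comp (r := r1) G y psiz) psiy.
have [v1 v1E] : exists v1, (x' (ones n))%:P * v1 = psi (g * t) - 'X.
  exists (g'%:P * t'%:P + g'%:P * c1 + c2 * t1 - 'X * s'%:P).
  rewrite (rmorphM psi) psigE psig psit; apply: correction_psi.
    by rewrite -[LHS]polyC1 {1}Es' polyCD !polyCM.
  by rewrite t1F polyCM.
(* phi : L' -> L[V]; the choice W = X V - g t makes t2 divisible by X. *)
have [r2 [y2 [t2 [c3 [r2C r2X [y2E t2E] t2F r2G]]]]] :=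
  shift_poly d_gt0 e_gt0 (pres_y pL) (pres_t pL) ((x (ones n))%:P * 'X - (g * t)%:P).
rewrite -mE in t2F.
have {}t2F : t2 = (x (ones n))%:P * (s%:P * t%:P + 'X * m%:P + c3).
  apply: (@correction_phi _ _ g%:P); last by rewrite t2F polyCM.
  by rewrite -[LHS]polyC1 {1}Es polyCD !polyCM.
have [phi [phiz phiy phit]] : exists phi : {rmorphism L' -> {poly L}},
    [/\ forall h, phi (xz' h) = r2 h, phi y' = y2 &
       phi t' = s%:P * t%:P + 'X * m%:P + c3].
  apply: (pres_univ pL'); first by rewrite r2C.
  rewrite -t2E t2F r2C xe'L polyCM.
  exact: mul_swap.
(* V is sent to (psi (g t) - V') / X and V' to g t - X V. *)
have [f [fC fX]] := poly_hom psi v1.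
have [h [hC hX]] := poly_hom phi ((g * t)%:P - (x (ones n))%:P * 'X).
have fz c : f (xz c%:P)%:P = (xz' c%:P)%:P by rewrite fC psiz r1C.
have hz c : h (xz' c%:P)%:P = (xz c%:P)%:P by rewrite hC phiz r2C.
have fZ : f (xz 'X)%:P = (xz' 'X)%:P + (x' d)%:P * (x' e)%:P * 'X by rewrite fC psiz r1X.
have hZ : h (xz' 'X)%:P = (xz 'X)%:P + (x d)%:P * (x e)%:P * ((x (ones n))%:P * 'X - (g * t)%:P).
  by rewrite hC phiz r2X.
have xv1 : (x' (ones n))%:P * v1 = f (g * t)%:P - 'X by rewrite fC.
exists f, h.
have hfz q : h (f (xz q)%:P) = (xz q)%:P.
  move: q; apply: (@poly_morph_ext _ _ (h \o (f \o (polyC \o xz))) (polyC \o xz)) => [c|].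
    by change (h (f (xz c%:P)%:P) = (xz c%:P)%:P); rewrite fz hz.
  change (h (f (xz 'X)%:P) = (xz 'X)%:P); rewrite fZ.
  exact: (back_of_shift hZ (hz _) (hz _) hX).
have fhz q : f (h (xz' q)%:P) = (xz' q)%:P.
  move: q; apply: (@poly_morph_ext _ _ (f \o (h \o (polyC \o xz'))) (polyC \o xz')) => [c|].
    by change (f (h (xz' c%:P)%:P) = (xz' c%:P)%:P); rewrite hz fz.
  change (f (h (xz' 'X)%:P) = (xz' 'X)%:P); rewrite hZ.
  exact: (shift_of_back fZ (fz _) (fz _) (fz _) fX (erefl _) xv1).
have hfC a : h (f a%:P) = a%:P.
  apply: (@hom_ext_torsion_free _ _ _ _ _ _ _ _ _ _ pL _ (h \o (f \o polyC)) polyC).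
    by move=> m1 b; rewrite [X in X * _]hfz; apply: poly_torsion_free pL _ _.
  exact: hfz.
have fhC a : f (h a%:P) = a%:P.
  apply: (@hom_ext_torsion_free _ _ _ _ _ _ _ _ _ _ pL' _ (f \o (h \o polyC)) polyC).
    by move=> m1 b; rewrite [X in X * _]fhz; apply: poly_torsion_free pL' _ _.
  exact: fhz.
split.
- apply: (@poly_morph_ext _ _ (h \o f) idfun) => [a|]; first exact: hfC.
  change (h (f 'X) = 'X); rewrite fX.
  apply/eqP; rewrite -subr_eq0; apply/eqP; apply: (poly_torsion_free pL (m := ones n)).
  rewrite mulrBr -{1}hz -(rmorphM h) xv1 (rmorphB h) hfC hX.
  by move: (g * t)%:P (_ * 'X) => A B; ring.
- apply: (@poly_morph_ext _ _ (f \o h) idfun) => [a|]; first exact: fhC.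
  change (f (h 'X) = 'X); rewrite hX (rmorphB f) (rmorphM f) fz fX xv1.
  by move: (f _) => A; ring.
exact: fz.
Qed.

End Stable.

(** * The rings L_[d],[e] and L_[d],[e]+1 *)

Lemma inverse_morphism (R S : nzRingType) (f : {rmorphism R -> S}) :
  bijective f -> exists g : {rmorphism S -> R}, cancel f g /\ cancel g f.
Proof.
case=> g fK gK.
have gB : zmod_morphism g.
  by move=> a b; apply: (can_inj fK); rewrite rmorphB !gK.
have gM : monoid_morphism g.
  by split=> [|a b]; apply: (can_inj fK); rewrite ?rmorph1 ?rmorphM !gK.
pose gA := GRing.isZmodMorphism.Build S R g gB.
pose gMM := GRing.isMonoidMorphism.Build S R g gM.
pose gR : {rmorphism S -> R} := HB.pack g gA gMM.
by exists gR.
Qed.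

Lemma multinom_succE n (e : 'X_{1..n}) : multinom_succ e = (ones n + e)%MM.
Proof. by apply/mnmP => i; rewrite mnmDE !mnmE add1n. Qed.

Lemma lexp_frac (k : fieldType) n (j : 'I_n) :
  exists v : {fraction kXZ k n} -> 'rV[rat]_n.+1,
  is_oval (ltj j) v /\ forall r : kXZ k n, r != 0 -> v (tofrac r) = lexp j r.
Proof.
apply: oval_frac; first exact: (@ltj_total n j).
  exact: (@ltj_add n j).
exact: lexp_oval.
Qed.

Lemma field_embedding (k : fieldType) n : exists (F : fieldType) (io : {rmorphism kXZ k n -> F}),
  injective io /\ forall j : 'I_n, exists v : F -> 'rV[rat]_n.+1,
  is_oval (ltj j) v /\ forall r : kXZ k n, r != 0 -> v (io r) = lexp j r.
Proof.
exists {fraction kXZ k n}, (@tofrac (kXZ k n)); split; last exact: lexp_frac.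
by move=> a b /eqP; rewrite tofrac_eq => /eqP.
Qed.

Section StablyIsomorphic.
Variables (k : fieldType) (n : nat) (d e : 'X_{1..n}) (P : kXZ k n) (Q : kXYZ k n).
Hypotheses (P_monic : P \is monic) (P_deg : (1 < (size P).-1)%N).
Hypotheses (Q_monic : Q \is monic) (Q_deg : (1 < (size Q).-1)%N).
Hypotheses (d_gt0 : forall i, (0 < d i)%N) (e_gt0 : forall i, (0 < e i)%N).
Let e' := multinom_succ e.
Variables (L : comNzRingType) (pi : {rmorphism kXYZT k n -> L}) (iL : {rmorphism k -> L}).
Hypothesis pi_surj : forall a, exists s, pi s = a.
Hypothesis pi_eq0 : forall s, pi s = 0 <-> exists u w, s = u * rel1 d P + w * rel2 e Q.
Hypothesis iLE : forall c, iL c = pi c%:MP%:P%:P%:P.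
Variables (L' : comNzRingType) (pi' : {rmorphism kXYZT k n -> L'}) (iL' : {rmorphism k -> L'}).
Hypothesis pi'_surj : forall a, exists s, pi' s = a.
Hypothesis pi'_eq0 : forall s, pi' s = 0 <-> exists u w, s = u * rel1 d P + w * rel2 e' Q.
Hypothesis iL'E : forall c, iL' c = pi' c%:MP%:P%:P%:P.

Let e'_gt0 i : (0 < e' i)%N.
Proof. by rewrite mnmE. Qed.

Lemma not_alg_iso : (0 < n)%N -> ~ alg_iso iL iL'.
Proof.
move=> n_gt0 [f [/inverse_morphism[g [fK gK]] f_k]].
have [xz [y [t [pL iE]]]] := quotient_presented pi_surj pi_eq0 iLE P_monic Q_monic d_gt0 e_gt0.
have [xz' [y' [t' [pL' iE']]]] :=
  quotient_presented pi'_surj pi'_eq0 iL'E P_monic Q_monic d_gt0 e'_gt0.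
have [F [io [io_inj Hv]]] := field_embedding k n.
have g_k c : g (xz' (c%:MP)%:P) = xz (c%:MP)%:P by rewrite -iE' -f_k fK iE.
have := mdeg_le io_inj P_monic Q_monic P_deg Q_deg d_gt0 e'_gt0 e_gt0 Hv pL' pL gK fK g_k n_gt0.
have ones_gt0 : (0 < mdeg (ones n))%N.
  by rewrite mdegE (bigD1 (Ordinal n_gt0)) //= mnmE.
by rewrite /e' multinom_succE mdegD leqNgt -[X in (X < _)%N]add0n ltn_add2r ones_gt0.
Qed.

Lemma poly_alg_iso (i1 : {rmorphism k -> {poly L}}) (i1' : {rmorphism k -> {poly L'}}) :
  (forall i : 'I_n, ideal_gen [:: at0Z k i P; at0Z k i P^`()] =i predT) ->
  (forall i : 'I_n,
     ideal_gen [:: (at0Z k i P)%:P; at0YZ k i Q; at0YZ k i Q^`()] =i predT) ->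
  (forall c, i1 c = (iL c)%:P) -> (forall c, i1' c = (iL' c)%:P) ->
  alg_iso i1 i1'.
Proof.
move=> P_cond Q_cond i1E i1'E.
have [xz [y [t [pL iE]]]] := quotient_presented pi_surj pi_eq0 iLE P_monic Q_monic d_gt0 e_gt0.
have [xz' [y' [t' [pL' iE']]]] :=
  quotient_presented pi'_surj pi'_eq0 iL'E P_monic Q_monic d_gt0 e'_gt0.
rewrite /e' multinom_succE in pL'.
have [f [g [fK gK fc]]] := stable_iso d_gt0 e_gt0 P_cond Q_cond pL pL'.
exists f; split; first by exists g.
by move=> c; rewrite i1E i1'E iE iE'; exact: fc.
Qed.

End StablyIsomorphic.

(** The algebra L_[d],[e] as a bundled ring, so that the statements on abstract
    rings apply to it; each structure gets a name of its own in order that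
    convertible structures be compared before they are unfolded. *)
Section Bundled.
Variables (k : fieldType) (n : nat) (d : 'X_{1..n}) (P : kXZ k n) (Q : kXYZ k n).
Implicit Types e : 'X_{1..n}.

Definition L_com e : comNzRingType := Defs_L__canonical__GRing_ComNzRing d e P Q.
Definition L_com_nz e : nzRingType := L_com e.
Definition L_nz e : nzRingType := Defs_L__canonical__GRing_NzRing d e P Q.
Definition L_proj e : {rmorphism kXYZT k n -> L_com e} := piL d e P Q.
Definition L_const e : {rmorphism k -> L_com e} := L_str d e P Q.
Definition L1_const e : {rmorphism k -> {poly L_com e}} := polyC \o L_const e.

Lemma L_proj_surj e : forall a, exists s, L_proj e s = a.
Proof. exact (@piL_surj k n d e P Q). Qed.

Lemma L_proj_eq0 e : forall s, L_proj e s = 0 <-> exists u w, s = u * rel1 d P + w * rel2 e Q.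
Proof. exact (@piL_eq0 k n d e P Q). Qed.

Lemma L_constE e : forall c, L_const e c = L_proj e c%:MP%:P%:P%:P.
Proof. exact (@L_strE k n d e P Q). Qed.

Lemma L1_constE e c : L1_const e c = (L_const e c)%:P.
Proof. by []. Qed.

Let alg_iso_nz e e' : @alg_iso k (L_com_nz e) (L_com_nz e') (L_const e) (L_const e') =
  @alg_iso k (L_nz e) (L_nz e') (L_str d e P Q) (L_str d e' P Q).
Proof. reflexivity. Qed.

Lemma alg_iso_const e e' :
  alg_iso (L_const e) (L_const e') = alg_iso (L_str d e P Q) (L_str d e' P Q).
Proof. exact (alg_iso_nz e e'). Qed.

Let poly_alg_iso_nz e e' :
  @alg_iso k {poly L_com_nz e} {poly L_com_nz e'} (L1_const e) (L1_const e') =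
  @alg_iso k {poly L_nz e} {poly L_nz e'} (L1_str d e P Q) (L1_str d e' P Q).
Proof. reflexivity. Qed.

Lemma alg_iso_poly_const e e' :
  alg_iso (L1_const e) (L1_const e') = alg_iso (L1_str d e P Q) (L1_str d e' P Q).
Proof. exact (poly_alg_iso_nz e e'). Qed.

End Bundled.

Theorem corollary3p1 (k : fieldType) (n : nat) (P : kXZ k n) (Q : kXYZ k n)
  (n_ge1 : (1 <= n)%N)
  (P_monic : P \is monic) (P_deg : (2 <= (size P).-1)%N)
  (Q_monic : Q \is monic) (Q_deg : (2 <= (size Q).-1)%N)
  (P_cond : forall i : 'I_n,
     ideal_gen [:: at0Z k i P; at0Z k i P^`()] =i predT)
  (Q_cond : forall i : 'I_n,
     ideal_gen [:: (at0Z k i P)%:P; at0YZ k i Q; at0YZ k i Q^`()] =i predT)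
  (d e : 'X_{1..n})
  (d_ge1 : forall i, (1 <= d i)%N) (e_ge1 : forall i, (1 <= e i)%N) :
  ~ alg_iso (L_str d e P Q) (L_str d (multinom_succ e) P Q) /\
  alg_iso (L1_str d e P Q) (L1_str d (multinom_succ e) P Q).
Proof.
have surj := @L_proj_surj k n d P Q; have eq0 := @L_proj_eq0 k n d P Q.
have constE := @L_constE k n d P Q; have poly_constE := @L1_constE k n d P Q.
rewrite -alg_iso_const -alg_iso_poly_const; split.
  exact: (not_alg_iso P_monic P_deg Q_monic Q_deg d_ge1 e_ge1 (surj _) (eq0 _) (constE _)
    (surj _) (eq0 _) (constE _) n_ge1).
exact: (poly_alg_iso P_monic Q_monic d_ge1 e_ge1 (surj _) (eq0 _) (constE _)
  (surj _) (eq0 _) (constE _) P_cond Q_cond (poly_constE _) (poly_constE _)).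
Qed.
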